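(* The graphs $K_5$ and $K_{3,3}$ are weakly contractible.
   Context: All graphs are finite and simple (no loops or multiple edges). Let $G$ and $H$ be graphs with $V(H)\subseteq V(G)$. An $H$-scheme in $G$ is a collection of paths $\{P_{uv}: uv\in E(H)\}$ such that (1) each $P_{uv}$ is a $u,v$-path in $G$ with $V(P_{uv})\cap V(H)=\{u,v\}$, and (2) whenever $e_1,\dots,e_k\in E(H)$ satisfy $V(P_{e_1})\cap\dots\cap V(P_{e_k})\neq\emptyset$, there is a vertex $u\in V(H)$ incident with each of $e_1,\dots,e_k$. A graph $H$ is weakly contractible if every graph $G$ with $V(H)\subseteq V(G)$ that contains an $H$-scheme has an $H$-minor (in the usual, unrooted sense: there are pairwise vertex-disjoint connected subgraphs $C_v$ of $G$, one for each $v\in V(H)$, such that for each edge $uv\in E(H)$ there is an edge of $G$ joining $C_u$ and $C_v$). *)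

(* Defs.v *)
From mathcomp Require Import all_boot.

Set Implicit Arguments.
Unset Strict Implicit.
Unset Printing Implicit Defensive.

Record sgraph := SGraph {
  vertex :> finType;
  adj : rel vertex;
  adj_sym : symmetric adj;
  adj_irrefl : irreflexive adj }.

Definition edges (G : sgraph) : {set {set G}} :=
  [set [set uv.1; uv.2] | uv : G * G & adj uv.1 uv.2].

(* [p] lists, in order, the vertices of a path of [G] whose two ends are [x]
   and [y]; a path has no orientation, so [p] may start at either end. *)
Definition uv_path (G : sgraph) (x y : G) (p : seq G) : bool :=
  if p is z :: q
  then [&& uniq p, path (@adj G) z q & [set z; last z q] == [set x; y]]
  else false.

(* The inclusion of V(H) in V(G) is given by an injection [f : H -> G] (see
   [weakly_contractible]).  Only the values of [P] on [edges H] matter.  In the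
   second clause [F] is the family e_1, ..., e_k, k >= 1. *)
Definition scheme (H G : sgraph) (f : H -> G) (P : {set H} -> seq G) : Prop :=
  (forall u v : H, adj u v ->
     uv_path (f u) (f v) (P [set u; v])
     /\ [set x in P [set u; v]] :&: [set f w | w : H] = [set f u; f v])
  /\
  (forall F : {set {set H}}, F \subset edges H -> F != set0 ->
     (exists x : G, forall e, e \in F -> x \in P e) ->
     exists u : H, forall e, e \in F -> u \in e).

(* [S] is the vertex set of a connected (hence nonempty) subgraph of [G]. *)
Definition connected_set (G : sgraph) (S : {set G}) : Prop :=
  S != set0 /\
  {in S &, forall x y,
     connect [rel a b | [&& a \in S, b \in S & adj a b]] x y}.

Definition has_minor (G H : sgraph) : Prop :=
  exists C : H -> {set G},
    [/\ forall v, connected_set (C v),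
        forall u v, u != v -> [disjoint C u & C v]
      & forall u v, adj u v ->
          exists x y, [/\ x \in C u, y \in C v & adj x y]].

Definition weakly_contractible (H : sgraph) : Prop :=
  forall (G : sgraph) (f : H -> G), injective f ->
    (exists P : {set H} -> seq G, scheme f P) -> has_minor G H.

Section Complete.
Variable n : nat.

Definition complete_adj : rel 'I_n := fun x y => x != y.

Lemma complete_adj_sym : symmetric complete_adj.
Proof. by move=> x y; rewrite /complete_adj eq_sym. Qed.

Lemma complete_adj_irrefl : irreflexive complete_adj.
Proof. by move=> x; rewrite /complete_adj eqxx. Qed.

Definition complete_graph := SGraph complete_adj_sym complete_adj_irrefl.

End Complete.

Section CompleteBipartite.
Variables m n : nat.

Definition bipartite_adj : rel ('I_m + 'I_n)%type :=
  fun x y => match x, y with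
             | inl _, inr _ | inr _, inl _ => true
             | _, _ => false
             end.

Lemma bipartite_adj_sym : symmetric bipartite_adj.
Proof. by move=> [x|x] [y|y]. Qed.

Lemma bipartite_adj_irrefl : irreflexive bipartite_adj.
Proof. by move=> [x|x]. Qed.

Definition complete_bipartite_graph :=
  SGraph bipartite_adj_sym bipartite_adj_irrefl.

End CompleteBipartite.

(* Main.v *)
From Stdlib Require Import Classical_Prop Bool Ring.
Require Import Defs.
From mathcomp Require Import all_boot zify.

Set Implicit Arguments.
Unset Strict Implicit.
Unset Printing Implicit Defensive.

(* Colour each vertex by a common end of the edges of H whose paths contain it: the path of
   ij becomes a Kempe chain in the colours i and j. Take a counterexample with fewest
   vertices. Contracting an edge with equally coloured ends keeps the chains, so the
   colouring is proper, and a non-terminal vertex has two neighbours in each of two colours,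
   since otherwise it can be deleted or recoloured.

   For K33, the edges whose two colours are adjacent form a bipartite graph with at least
   2n - 3 edges, and such a graph has a K33 minor.

   For K5, passing to torsos shows that the graph is 4-connected. In every drawing of K5 the
   number of crossings between disjoint edges is odd; hence the products of the Kempe chains
   for disjoint edges add up to a cycle of the deleted product with an odd number of
   crossings. In a 3-connected graph such a cycle can be pushed through the contraction of an
   edge unless there is a K5 or K33 minor. Finally, a 4-connected graph with a K33 minor has a
   K5 minor: look at a subdivision of K33, or of the Wagner graph, that absorbs as many
   vertices as possible. *)

(** * Connectivity *)

(** Colourings rather than schemes are carried through the induction because contracting a
    monochromatic edge, recolouring a vertex and passing to a torso all yield Kempe colourings
    again. In a smallest counterexample non-terminal vertices have degree at least 4. For K33 only
    the six terminals may have degree 3, whence 2e >= 4n - 6; this is the exact threshold, as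
    K_{2,n-2} has 2n - 4 edges and no K33 minor. For K5 all degrees are at least 4, but the
    resulting 2n edges are far from the 3n - 5 that force a K5 minor, so counting cannot suffice and
    a parity obstruction replaces it. The obstruction is purely algebraic: no drawing or planarity
    occurs, a crossing is a comparison of ends mod 2. Contracting [xy] would spoil pairs of an edge
    at [x] and an edge at [y], so these are first cancelled by products of disjoint cycles. Where
    the disjoint paths for this are missing, a square around [xy] gives K33; where the cancellation
    gets stuck, three common neighbours of [x] and [y] give K5. Degree at least 4 is also what makes
    torsos work: it puts a rooted triangle behind every 3-separator. *)

Section Connectivity.
Variable T : finType.
Implicit Types (g : rel T) (A B R S U Z : {set T}) (x y : T).

Definition restr g S : rel T := [rel a b | [&& a \in S, b \in S & g a b]].
Definition joined g S a b := connect (restr g S) a b.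
Definition conn g S :=
  (S != set0) && [forall x in S, forall y in S, joined g S x y].
Definition adjS g A B := [exists x in A, exists y in B, g x y].
Definition component g S x := [set y in S | joined g S x y].

Lemma connP g S :
  reflect (S != set0 /\ {in S &, forall x y, joined g S x y}) (conn g S).
Proof.
apply: (iffP andP) => -[S0 H]; split=> //.
  by move=> x y xS yS; move/forall_inP/(_ x xS)/forall_inP: H; apply.
by apply/forall_inP=> x xS; apply/forall_inP=> y yS; apply: H.
Qed.

Lemma adjSP g A B :
  reflect (exists x y, [/\ x \in A, y \in B & g x y]) (adjS g A B).
Proof.
apply: (iffP exists_inP) => [[x xA /exists_inP[y yB gxy]]|[x [y [xA yB gxy]]]].
  by exists x, y.
by exists x => //; apply/exists_inP; exists y.
Qed.

Lemma adjS_intro g A B x y : x \in A -> y \in B -> g x y -> adjS g A B.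
Proof. by move=> xA yB gxy; apply/adjSP; exists x, y. Qed.

Lemma adjS_set1 g y z Z : g y z -> z \in Z -> adjS g [set y] Z.
Proof. by move=> gyz zZ; apply: adjS_intro zZ gyz; rewrite inE. Qed.

Lemma adjS_sub g A B A' B' :
  A \subset A' -> B \subset B' -> adjS g A B -> adjS g A' B'.
Proof.
move=> /subsetP sA /subsetP sB /adjSP[x [y [xA yB gxy]]].
exact: adjS_intro (sA _ xA) (sB _ yB) gxy.
Qed.

Lemma joined_refl g S a : joined g S a a.
Proof. exact: connect0. Qed.

Lemma joined_trans g S : transitive (joined g S).
Proof. exact: connect_trans. Qed.

Lemma joined1 g S a b : a \in S -> b \in S -> g a b -> joined g S a b.
Proof. by move=> aS bS gab; apply: connect1; apply/and3P. Qed.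

Lemma joined_map (T' : finType) (R : rel T) (R' : rel T') (phi : T -> T') a b :
  (forall u v, R u v -> connect R' (phi u) (phi v)) ->
  connect R a b -> connect R' (phi a) (phi b).
Proof.
move=> H /connectP[p]; elim: p a => [|c p IH] a /=; first by move=> _ ->.
by case/andP=> /H ac pp e; apply: connect_trans ac (IH _ pp e).
Qed.

Lemma joined_sub g S S' a b : S \subset S' -> joined g S a b -> joined g S' a b.
Proof.
move=> /subsetP sS; apply: (joined_map (phi := id)) => u v /and3P[uS vS guv].
by apply: joined1; rewrite ?sS.
Qed.

(** Paths are used below almost only in this form: the first edge that leaves a set, reached from
    inside the set. *)
Lemma joined_exit g S Z a b :
  joined g S a b -> a \in Z -> b \notin Z ->
  exists p q, [/\ p \in S :&: Z, q \in S :\: Z, g p q & joined g (S :&: Z) a p].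
Proof.
case/connectP=> p; elim: p a => [|c p IH] a /=; first by move=> _ -> ->.
case/andP=> /and3P[aS cS gac] pp e aZ bZ.
have [cZ|cZ] := boolP (c \in Z); last first.
  by exists a, c; rewrite !inE aS cS aZ cZ; split=> //; apply: joined_refl.
have [u [v [uS vS guv cu]]] := IH _ pp e cZ bZ.
exists u, v; split=> //; apply: joined_trans cu.
by apply: joined1; rewrite ?inE ?aS ?cS.
Qed.

Lemma conn_neq0 g S : conn g S -> S != set0.
Proof. by case/andP. Qed.

Lemma conn_joined g S a b : conn g S -> a \in S -> b \in S -> joined g S a b.
Proof. by case/connP=> _; apply. Qed.

Lemma conn1 g x : conn g [set x].
Proof.
apply/connP; split; first by apply/set0Pn; exists x; rewrite inE.
by move=> u v /set1P-> /set1P->; apply: joined_refl.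
Qed.

Lemma comp_sub g S x : component g S x \subset S.
Proof. by apply/subsetP=> y; rewrite inE => /andP[]. Qed.

Lemma comp_self g S x : x \in S -> x \in component g S x.
Proof. by move=> xS; rewrite inE xS joined_refl. Qed.

Lemma comp_closed g S x y z :
  y \in component g S x -> z \in S -> g y z -> z \in component g S x.
Proof.
rewrite !inE => /andP[yS xy] zS gyz; rewrite zS /=.
by apply: joined_trans xy _; apply: joined1.
Qed.

Lemma comp_joined g S x y : x \in S -> joined g S x y -> joined g (component g S x) x y.
Proof.
move=> xS; set C := component g S x; case/connectP=> p pp e.
suff: forall a, joined g C x a -> a \in C -> path (restr g S) a p ->
    y = last a p -> joined g C x y.
  by move/(_ x); apply; rewrite ?comp_self //; apply: joined_refl.
elim: p {pp e} => [|c p IH] a /=; first by move=> xa _ _ ->.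
move=> xa aC /andP[/and3P[aS cS gac] pp] e.
have cC := comp_closed aC cS gac.
by apply: IH pp e => //; apply: joined_trans xa _; apply: joined1.
Qed.

Section Sym.
Variable g : rel T.
Hypothesis gs : symmetric g.

Lemma joined_sym S a b : joined g S a b = joined g S b a.
Proof.
rewrite /joined; apply: (sym_connect_sym _) => u v; rewrite /restr /= gs.
by rewrite andbCA.
Qed.

Lemma adjS_sym A B : adjS g A B = adjS g B A.
Proof.
by apply/adjSP/adjSP=> -[x [y [xA yB gxy]]]; exists y, x; rewrite gs.
Qed.

Lemma conn_root S r : r \in S -> (forall x, x \in S -> joined g S r x) -> conn g S.
Proof.
move=> rS H; apply/connP; split; first by apply/set0Pn; exists r.
by move=> x y xS yS; apply: joined_trans (H y yS); rewrite joined_sym H.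
Qed.

Lemma conn_comp S x : x \in S -> conn g (component g S x).
Proof.
move=> xS; apply: (conn_root (comp_self g xS)) => y.
by rewrite inE => /andP[_]; apply: comp_joined.
Qed.

Lemma connU_meet A B x : conn g A -> conn g B -> x \in A -> x \in B ->
  conn g (A :|: B).
Proof.
move=> cA cB xA xB; apply: (@conn_root _ x); first by rewrite inE xA.
move=> y /setUP[yA|yB].
  by apply: joined_sub (subsetUl _ _) _; apply: conn_joined.
by apply: joined_sub (subsetUr _ _) _; apply: conn_joined.
Qed.

Lemma connU A B : conn g A -> conn g B -> adjS g A B -> conn g (A :|: B).
Proof.
move=> cA cB /adjSP[x [y [xA yB gxy]]].
apply: (@conn_root _ x); first by rewrite inE xA.
move=> z /setUP[zA|zB].
  by apply: joined_sub (subsetUl _ _) _; apply: conn_joined.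
apply: (@joined_trans _ _ y).
  by apply: joined1; rewrite ?inE ?xA ?yB ?orbT.
by apply: joined_sub (subsetUr _ _) _; apply: conn_joined.
Qed.

Lemma conn_sub_comp A S x : conn g A -> A \subset S -> x \in A ->
  A \subset component g S x.
Proof.
move=> cA sA xA; apply/subsetP=> y yA; rewrite inE (subsetP sA) //=.
by apply: joined_sub sA _; apply: conn_joined.
Qed.

Lemma comp_eq S x y : y \in component g S x -> component g S y = component g S x.
Proof.
rewrite inE => /andP[yS xy]; apply/setP=> z; rewrite !inE.
case: (z \in S) => //=; apply/idP/idP; first exact: joined_trans.
by apply: joined_trans; rewrite joined_sym.
Qed.

Lemma comp_disjoint S x y : ~~ joined g S x y ->
  [disjoint component g S x & component g S y].
Proof.
move=> nxy; rewrite -setI_eq0; apply/eqP/setP=> z; rewrite !inE.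
apply/negbTE/negP=> /andP[/andP[_ xz] /andP[_ yz]].
by case/negP: nxy; apply: joined_trans xz _; rewrite joined_sym.
Qed.

Lemma comp_adj S R x : conn g S -> R \subset S -> R != set0 -> x \in S :\: R ->
  adjS g (component g (S :\: R) x) R.
Proof.
move=> cS sR /set0Pn[r rR] xSR; have := xSR; rewrite inE => /andP[xR xS].
have rS := subsetP sR _ rR.
have rC : r \notin component g (S :\: R) x.
  by rewrite !inE rR.
have [p [q [/setIP[pS pC] /setDP[qS qC] gpq _]]] :=
  joined_exit (conn_joined cS xS rS) (comp_self g xSR) rC.
apply: (adjS_intro pC _ gpq).
apply: contraR qC => qR; apply: (comp_closed pC) gpq.
by rewrite inE qR qS.
Qed.

(** The other components of [S :\: R] all attach to [R], so removing one of them leaves the rest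
    connected. *)
Lemma conn_co S R x : conn g S -> conn g R -> R \subset S -> x \in S :\: R ->
  conn g (S :\: component g (S :\: R) x).
Proof.
move=> cS cR sR xSR; have /set0Pn[r rR] := conn_neq0 cR.
set C := component _ _ _.
have RC : R \subset S :\: C.
  apply/subsetP=> z zR; rewrite inE (subsetP sR) // andbT.
  by rewrite inE inE zR.
apply: (@conn_root _ r); first exact: (subsetP RC).
move=> z; rewrite inE => /andP[zC zS].
have [zR|zR] := boolP (z \in R).
  by apply: joined_sub RC _; apply: conn_joined.
have zSR : z \in S :\: R by rewrite inE zR.
have Dsub : component g (S :\: R) z \subset S :\: C.
  apply/subsetP=> w wD; rewrite in_setD.
  have /setDP[-> _] := subsetP (comp_sub _ _ _) _ wD; rewrite andbT.
  by apply: contra zC => wC; rewrite /C -(comp_eq wC) (comp_eq wD) comp_self.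
have cD := conn_comp zSR.
have R0 := conn_neq0 cR.
have cU := connU cD cR (comp_adj cS sR R0 zSR).
apply: (@joined_sub _ (component g (S :\: R) z :|: R)); first by rewrite subUset Dsub.
by apply: conn_joined; rewrite // inE ?rR ?comp_self ?orbT.
Qed.

Lemma conn_setU1 A x y : conn g A -> y \in A -> g x y -> conn g (x |: A).
Proof.
by move=> cA yA gxy; apply: connU (conn1 _ _) cA _; apply: adjS_intro gxy; rewrite ?inE.
Qed.

End Sym.

Definition minor (I : finType) (h : rel I) g U :=
  exists C : I -> {set T},
    [/\ forall i, C i \subset U /\ conn g (C i),
        forall i j, i != j -> [disjoint C i & C j]
      & forall i j, h i j -> adjS g (C i) (C j)].

Lemma minor_sub (I : finType) (h : rel I) g U U' : U \subset U' ->
  minor h g U -> minor h g U'.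
Proof.
move=> sU [C [C1 C2 C3]]; exists C; split=> // i.
by case: (C1 i) => sC cC; split=> //; apply: subset_trans sU.
Qed.

Lemma minor_subrel (I : finType) (h : rel I) g g' U : subrel g' g ->
  minor h g' U -> minor h g U.
Proof.
move=> sg [C [C1 C2 C3]]; exists C; split=> // [i|i j /C3/adjSP[a [b [aC bC /sg gab]]]].
  have [CU /connP[C0 J]] := C1 i; split=> //; apply/connP; split=> // a b aC bC.
  apply: (joined_map (phi := id)) (J a b aC bC) => p q /and3P[pC qC /sg gpq].
  by apply: connect1; apply/and3P.
exact: adjS_intro gab.
Qed.

End Connectivity.

Lemma conn_bigcup (T T' : finType) (g : rel T) (g' : rel T') (S : {set T'})
    (M : T' -> {set T}) :
  symmetric g ->
  conn g' S -> {in S, forall u, conn g (M u)} ->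
  {in S &, forall u v, g' u v -> adjS g (M u) (M v)} ->
  conn g (\bigcup_(u in S) M u).
Proof.
move=> gs /connP[/set0Pn[r rS] cS] cM aM.
have /set0Pn[x xM] := conn_neq0 (cM r rS).
have sM u : u \in S -> M u \subset \bigcup_(u in S) M u by move=> uS; apply: bigcup_sup.
apply: (conn_root gs (r := x)); first exact: (subsetP (sM r rS)).
move=> y /bigcupP[v vS yv].
have /connectP[p pp e] := cS r v rS vS.
elim: p r x rS xM pp e => [|w p IH] r x rS xM /=.
  move=> _ e; rewrite {}e in yv.
  by apply: joined_sub (sM r rS) _; apply: conn_joined => //; apply: cM.
move=> /andP[/and3P[_ wS grw] pp] e.
have /adjSP[a [b [ar bw gab]]] := aM r w rS wS grw.
apply: (@joined_trans _ _ _ b); last exact: IH wS bw pp e.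
apply: (@joined_trans _ _ _ a).
  by apply: joined_sub (sM r rS) _; apply: conn_joined => //; apply: cM.
by apply: joined1 gab; [apply: (subsetP (sM r rS)) | apply: (subsetP (sM w wS))].
Qed.

Lemma disjointP (T : finType) (A B : {set T}) :
  reflect (forall x, x \in A -> x \in B -> False) [disjoint A & B].
Proof.
apply: (iffP pred0P) => H x; last by apply/negbTE/negP=> /andP[]; apply: H.
by move=> xA xB; have := H x; rewrite /= xA xB.
Qed.

Lemma disjointsU (T : finType) (A B C : {set T}) :
  [disjoint A :|: B & C] = [disjoint A & C] && [disjoint B & C].
Proof. by rewrite !disjoints_subset subUset. Qed.

Lemma disjointsU1 (T : finType) (x : T) (A B : {set T}) :
  [disjoint x |: A & B] = (x \notin B) && [disjoint A & B].
Proof. by rewrite disjointsU disjoints1. Qed.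

(** Transitivity of minors: [M u] is the connected set that the vertex [u] stands for. Contractions,
    torsos and mergers are all undone through it. *)
Lemma minor_model (T T' : finType) (g : rel T) (U : {set T})
    (g' : rel T') (U' : {set T'}) (M : T' -> {set T}) (I : finType) (h : rel I) :
  symmetric g ->
  {in U', forall u, M u \subset U /\ conn g (M u)} ->
  {in U' &, forall u v, u != v -> [disjoint M u & M v]} ->
  {in U' &, forall u v, g' u v -> adjS g (M u) (M v)} ->
  minor h g' U' -> minor h g U.
Proof.
move=> gs M1 M2 M3 [C [C1 C2 C3]].
exists (fun i => \bigcup_(u in C i) M u); split.
- move=> i; have [sC cC] := C1 i; have sC' := subsetP sC; split.
    by apply/bigcupsP=> u uC; case: (M1 u (sC' u uC)).
  apply: (conn_bigcup gs cC) => [u uC|u v uC vC]; first by case: (M1 u (sC' u uC)).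
  by apply: M3; apply: sC'.
- move=> i j ij; apply/disjointP=> x /bigcupP[u uC xu] /bigcupP[v vC xv].
  have uv : u != v.
    by apply: contraTneq uC => ->; apply/negP=> vC'; apply: (disjointP _ _ (C2 _ _ ij) v).
  have uU := subsetP (C1 i).1 _ uC; have vU := subsetP (C1 j).1 _ vC.
  exact: (disjointP _ _ (M2 u v uU vU uv) x).
- move=> i j hij; have /adjSP[u [v [uC vC guv]]] := C3 i j hij.
  have uU := subsetP (C1 i).1 _ uC; have vU := subsetP (C1 j).1 _ vC.
  by apply: adjS_sub (M3 u v uU vU guv); apply: bigcup_sup.
Qed.

(** * Rooted triangles *)

Section RootedTriangle.
Variables (T : finType) (g : rel T).
Hypothesis gs : symmetric g.
Implicit Types (E U : {set T}) (c r u : T).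

Definition triangle U r1 r2 r3 :=
  exists C1 C2 C3 : {set T},
    [/\ [/\ C1 \subset U, C2 \subset U & C3 \subset U],
        [/\ conn g C1, conn g C2 & conn g C3],
        [/\ r1 \in C1, r2 \in C2 & r3 \in C3],
        [/\ [disjoint C1 & C2], [disjoint C1 & C3] & [disjoint C2 & C3]]
      & [/\ adjS g C1 C2, adjS g C1 C3 & adjS g C2 C3]].

(** Vacuous when [c] is [a] or [b], so that a root may itself be the separating vertex. *)
Definition separates U c a b := a != c -> b != c -> ~~ joined g (U :\ c) a b.

Definition separator3 U r1 r2 r3 :=
  exists2 c, c \in U &
    [/\ separates U c r1 r2, separates U c r1 r3 & separates U c r2 r3].

Lemma triangle_swap12 U r1 r2 r3 : triangle U r1 r2 r3 -> triangle U r2 r1 r3.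
Proof.
move=> [C1 [C2 [C3 [[? ? ?] [? ? ?] [? ? ?] [d12 ? ?] [a12 ? ?]]]]].
exists C2, C1, C3; split; split=> //; last by rewrite adjS_sym.
by rewrite disjoint_sym.
Qed.

Lemma triangle_swap23 U r1 r2 r3 : triangle U r1 r2 r3 -> triangle U r1 r3 r2.
Proof.
move=> [C1 [C2 [C3 [[? ? ?] [? ? ?] [? ? ?] [? ? d23] [? ? a23]]]]].
exists C1, C3, C2; split; split=> //; last by rewrite adjS_sym.
by rewrite disjoint_sym.
Qed.

Lemma triangle_sub U U' r1 r2 r3 : U \subset U' ->
  triangle U r1 r2 r3 -> triangle U' r1 r2 r3.
Proof.
move=> sU [C1 [C2 [C3 [[s1 s2 s3] ? ? ? ?]]]].
by exists C1, C2, C3; split=> //; split; apply: subset_trans sU.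
Qed.

Lemma separates_sym U c a b : separates U c a b -> separates U c b a.
Proof. by move=> H ac bc; rewrite joined_sym //; apply: H. Qed.

(* [u] and the separator [c] of [U :\ u] join up the two components that [u] reconnects. *)
Lemma triangle_of_reconnection U u c r1 r2 r3 :
  conn g (U :\ u) -> u \in U -> c \in U :\ u ->
  r1 \in U :\ u -> r2 \in U :\ u -> r3 \in U :\ u -> r1 != r2 ->
  r1 != c -> r2 != c ->
  separates (U :\ u) c r1 r2 -> separates (U :\ u) c r1 r3 ->
  separates (U :\ u) c r2 r3 ->
  joined g (U :\ c) r1 r2 -> triangle U r1 r2 r3.
Proof.
move=> cUu uU cU r1U r2U r3U r12 r1c r2c s12 s13 s23 J.
set W := (U :\ u) :\ c.
have WU : W \subset U by exact: (subset_trans (subsetDl _ _) (subsetDl _ _)).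
have inW r : r \in U :\ u -> r != c -> r \in W by move=> rU rc; rewrite inE inE rc.
have uW : u \notin W by rewrite !inE eqxx andbF.
have cW : c \notin W by rewrite !inE eqxx.
have ncu : c != u by move: cU; rewrite !inE => /andP[].
have reach a b : a \in W -> joined g (U :\ c) a b -> ~~ joined g W a b ->
    adjS g (component g W a) [set u].
  move=> aW Jab nab.
  have bC : b \notin component g W a by rewrite inE (negbTE nab) andbF.
  have [p [q [/setIP[pU pC] /setDP[qU qC] gpq _]]] :=
    joined_exit Jab (comp_self g aW) bC.
  have [qu|qu] := eqVneq q u; first by apply: adjS_intro pC _ gpq; rewrite qu inE.
  case/negP: qC; apply: comp_closed pC _ gpq.
  by move: qU; rewrite !inE qu => /andP[-> ->].
have toc a : a \in W -> adjS g (component g W a) [set c].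
  move=> aW; apply: comp_adj => //; first by rewrite sub1set.
  by apply/set0Pn; exists c; rewrite inE.
have r1W := inW _ r1U r1c; have r2W := inW _ r2U r2c.
have n12 := s12 r1c r2c.
have uD1 := reach _ _ r1W J n12.
have uD2 : adjS g (component g W r2) [set u].
  by apply: (reach _ r1) => //; rewrite joined_sym.
have compU a : component g W a \subset U by apply: subset_trans (comp_sub _ _ _) WU.
have notin a x : x \notin W -> x \notin component g W a.
  by apply: contra; apply: (subsetP (comp_sub _ _ _)).
pose C3 := if r3 == c then [set c] else c |: component g W r3.
have r3W : r3 != c -> r3 \in W by apply: inW.
have cC3 : c \in C3 by rewrite /C3; case: ifP => _; rewrite !inE eqxx.
have C3c : conn g C3.
  rewrite /C3; case: eqP => [_|/eqP r3c]; first exact: conn1.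
  have /adjSP[p [q [pC /set1P-> gpc]]] := toc _ (r3W r3c).
  by apply: (conn_setU1 gs (conn_comp gs (r3W r3c)) pC); rewrite gs.
have C3D a : a \in W -> (r3 != c -> ~~ joined g W a r3) -> [disjoint component g W a & C3].
  move=> aW nj; rewrite /C3; case: eqP => [_|/eqP r3c].
    by rewrite disjoint_sym disjoints1 notin.
  rewrite disjoint_sym disjointsU1 notin //= disjoint_sym.
  by apply: comp_disjoint => //; apply: nj.
exists (u |: component g W r1), (component g W r2), C3; split; split.
- by rewrite subUset sub1set uU compU.
- exact: compU.
- rewrite /C3; case: ifP => _; first by rewrite sub1set (subsetP (subsetDl _ _) _ cU).
  by rewrite subUset sub1set compU (subsetP (subsetDl _ _) _ cU).
- have /adjSP[p [q [pC /set1P-> gpu]]] := uD1.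
  by apply: (conn_setU1 gs (conn_comp gs r1W) pC); rewrite gs.
- exact: conn_comp.
- exact: C3c.
- by rewrite inE comp_self ?orbT.
- exact: comp_self.
- rewrite /C3; case: eqP => [->|/eqP r3c]; first by rewrite inE.
  by rewrite inE comp_self ?orbT ?r3W.
- rewrite disjointsU1 notin //=; exact: comp_disjoint.
- rewrite disjointsU1; apply/andP; split; last by apply: C3D => // r3c; apply: s13.
  rewrite /C3; case: ifP => _; first by rewrite inE eq_sym.
  by rewrite in_setU1 eq_sym (negbTE ncu) /= notin.
- by apply: C3D => // r3c; apply: s23.
- rewrite adjS_sym //; apply: adjS_sub uD2 => //; exact: subsetUl.
- apply: adjS_sub (toc _ r1W); first exact: subsetUr.
  by rewrite sub1set.
- by apply: adjS_sub (toc _ r2W) => //; rewrite sub1set.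
Qed.

(** [E] meets the rest of [U] only at [u], so collapsing [E] onto [u] sends walks to walks. *)
Lemma joined_retract U E u c a b : u \in U -> u \notin E -> u != c ->
  (forall p q, p \in E -> q \in U -> q \notin E -> g p q -> q = u) ->
  joined g (U :\ c) a b ->
  joined g ((U :\: E) :\ c) (if a \in E then u else a) (if b \in E then u else b).
Proof.
move=> uU uE uc H; apply: (joined_map (phi := fun z => if z \in E then u else z)).
move=> p q /and3P[/setD1P[pc pU] /setD1P[qc qU] gpq].
have [pE|pE] := boolP (p \in E); have [qE|qE] := boolP (q \in E).
- exact: connect0.
- by rewrite (H p q) //; apply: connect0.
- by rewrite (H q p) // 1?gs //; apply: connect0.
- by apply: connect1; rewrite /restr /= !inE pc qc pE qE pU qU.
Qed.

(** Induction on [U], deleting a vertex [u] that is not a root. If [U :\ u] is connected with a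
    separator [c], either [c] still separates the roots in [U] or [u] reconnects two of them, which
    makes a triangle. If [U :\ u] is disconnected, either [u] separates the roots or two of them
    share a component, and everything beyond [u] is folded onto [u]. *)
Lemma rooted_triangle U r1 r2 r3 : conn g U -> uniq [:: r1; r2; r3] ->
  r1 \in U -> r2 \in U -> r3 \in U ->
  triangle U r1 r2 r3 \/ separator3 U r1 r2 r3.
Proof.
elim: {U}_.+1 {-2}U (ltnSn #|U|) r1 r2 r3 => // n IH U leU r1 r2 r3 cU.
rewrite /= !inE negb_or !andbT => /andP[/andP[r12 r13] r23] r1U r2U r3U.
(* On the roots alone, a missing edge turns the third root into a separator. *)
have [U3|] := boolP (U \subset [set r1; r2; r3]).
  have sep a b c : c \in U -> a != b -> a != c -> b != c ->
      (forall z, z \in U -> [|| z == a, z == b | z == c]) -> ~~ g a b -> separates U c a b.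
    move=> cUc ab ac bc Uabc gab _ _; apply/negP=> J.
    have bna : b \notin [set a] by rewrite inE eq_sym.
    have [p [q []]] := joined_exit J (set11 a) bna.
    rewrite !inE => /andP[_ /eqP->] /andP[qa /andP[qc qU]] gaq _.
    by have := Uabc q qU; rewrite (negbTE qa) (negbTE qc) orbF => /eqP qb; rewrite qb (negbTE gab) in gaq.
  have UE z : z \in U -> [|| z == r1, z == r2 | z == r3].
    by move/(subsetP U3); rewrite !inE orbA.
  have triv c a : separates U c a c by move=> _ /eqP.
  have triv' c a : separates U c c a by move/eqP.
  have [g12|g12] := boolP (g r1 r2); last first.
    by right; exists r3 => //; split=> //; apply: sep.
  have [g13|g13] := boolP (g r1 r3); last first.
    right; exists r2 => //; split=> //; apply: sep => //; first by rewrite eq_sym.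
    by move=> z /UE/or3P[]->; rewrite ?orbT.
  have [g23|g23] := boolP (g r2 r3); last first.
    right; exists r1 => //; split=> //; apply: sep; rewrite // 1?eq_sym //.
    by move=> z /UE/or3P[]->; rewrite ?orbT.
  left; exists [set r1], [set r2], [set r3].
  split; split; rewrite ?sub1set ?disjoints1 ?inE //; try exact: conn1.
  - by apply: adjS_intro g12; rewrite inE.
  - by apply: adjS_intro g13; rewrite inE.
  - by apply: adjS_intro g23; rewrite inE.
case/subsetPn=> u uU; rewrite !inE !negb_or => /andP[/andP[ur1 ur2] ur3].
have inUu r : r \in U -> u != r -> r \in U :\ u by move=> rU; rewrite !inE eq_sym rU andbT.
have r1u := inUu _ r1U ur1; have r2u := inUu _ r2U ur2; have r3u := inUu _ r3U ur3.
have [cUu|ncUu] := boolP (conn g (U :\ u)).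
  have lt : #|U :\ u| < n by move: leU; rewrite (cardsD1 u U) uU add1n !ltnS.
  case: (IH _ lt r1 r2 r3) => //; first by rewrite /= !inE negb_or r12 r13 r23.
    by move=> t; left; apply: triangle_sub t; apply: subsetDl.
  case=> c cUc [s12 s13 s23].
  have cU' := subsetP (subsetDl _ _) _ cUc.
  have [n12|/negbNE j12] := boolP (~~ [&& r1 != c, r2 != c & joined g (U :\ c) r1 r2]); last first.
    case/and3P: j12 => ? ? ?; left.
    exact: (triangle_of_reconnection (c := c) cUu).
  have [n13|/negbNE j13] := boolP (~~ [&& r1 != c, r3 != c & joined g (U :\ c) r1 r3]); last first.
    case/and3P: j13 => ? ? ?; left; apply: triangle_swap23.
    by apply: (triangle_of_reconnection (c := c) cUu) => //; apply: separates_sym.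
  have [n23|/negbNE j23] := boolP (~~ [&& r2 != c, r3 != c & joined g (U :\ c) r2 r3]); last first.
    case/and3P: j23 => ? ? ?; left; apply: triangle_swap12; apply: triangle_swap23.
    by apply: (triangle_of_reconnection (c := c) cUu) => //; apply: separates_sym.
  by right; exists c => //; split=> ac bc;
    [move: n12 | move: n13 | move: n23]; rewrite ac bc.
have [J|nJ] := boolP [|| joined g (U :\ u) r1 r2, joined g (U :\ u) r1 r3 | joined g (U :\ u) r2 r3];
  last first.
  by right; exists u => //; move: nJ; rewrite !negb_or => /and3P[? ? ?]; split.
suff main s1 s2 s3 : s1 \in U :\ u -> s2 \in U :\ u -> s3 \in U :\ u ->
    s1 != s2 -> s1 != s3 -> s2 != s3 -> joined g (U :\ u) s1 s2 ->
    triangle U s1 s2 s3 \/ separator3 U s1 s2 s3.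
  case/or3P: J => J.
  - exact: main.
  - case: (main r1 r3 r2) => //; first by rewrite eq_sym.
      by move=> t; left; apply: triangle_swap23.
    by case=> c cc [s12 s13 s23]; right; exists c => //; split=> //; apply: separates_sym.
  - case: (main r2 r3 r1) => //; try by rewrite eq_sym.
      by move=> t; left; apply: triangle_swap12; apply: triangle_swap23.
    by case=> c cc [s12 s13 s23]; right; exists c => //; split=> //; apply: separates_sym.
move=> {r1 r2 r3 r12 r13 r23 r1U r2U r3U ur1 ur2 ur3 r1u r2u r3u J}.
move=> s1u s2u s3u s12 s13 s23 J.
set D := component g (U :\ u) s1; set E := U :\ u :\: D.
have DU : D \subset U :\ u by apply: comp_sub.
have s1D : s1 \in D by apply: comp_self.
have s2D : s2 \in D by rewrite inE s2u.
have cD : conn g D by apply: conn_comp.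
have uD : u \notin D by apply/negP=> /(subsetP DU); rewrite !inE eqxx.
have uE : u \notin E by rewrite !inE eqxx andbF.
have su : [set u] \subset U by rewrite sub1set.
have UE : U :\: E = u |: D.
  apply/setP=> z; rewrite /E in_setU1 !in_setD in_set1.
  have [zD|zD] := boolP (z \in D).
    by have := subsetP DU z zD; rewrite in_setD in_set1 orbT => /andP[_ ->].
  rewrite orbF andTb; have [->|zu] := eqVneq z u; first by rewrite uU.
  by rewrite /= andNb.
have cDu : conn g (U :\: E).
  have /adjSP[p [q [pD /set1P-> gpu]]] : adjS g D [set u].
    by apply: comp_adj => //; apply/set0Pn; exists u; rewrite inE.
  by rewrite UE; apply: (conn_setU1 gs cD pD); rewrite gs.
have cEu : conn g (U :\: D) by apply: conn_co => //; apply: conn1.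
have Eedge p q : p \in E -> q \in U -> q \notin E -> g p q -> q = u.
  move=> pE qU qE gpq; apply/eqP; apply: contraNT qE => qu.
  have qUu : q \in U :\ u by rewrite !inE qu.
  have /setDP[pUu pD] : p \in U :\ u :\: D by [].
  rewrite in_setD qUu andbT; apply: contra pD => qD.
  by apply: comp_closed qD pUu _; rewrite gs.
have E0 : E != set0.
  apply: contraNneq ncUu => E0.
  by rewrite (_ : U :\ u = D) //; apply/eqP; rewrite eqEsubset DU andbT -setD_eq0 -/E E0.
have ltE : #|U :\: E| < n.
  have EU : E \subset U by rewrite /E; apply: (subset_trans (subsetDl _ _) (subsetDl _ _)).
  have := subset_leq_card EU.
  by rewrite cardsDS //; move: E0 leU; rewrite -card_gt0; clear; lia.
(* A third root beyond the cut vertex [u] is represented by [u]; its set of the triangle is extended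
   by [U :\: D] afterwards. *)
pose t3 := if s3 \in E then u else s3.
have s1E : s1 \notin E by rewrite inE s1D.
have s2E : s2 \notin E by rewrite inE s2D.
have uUE : u \in U :\: E by rewrite inE uE.
have t3U : t3 \in U :\: E.
  rewrite /t3; case: ifP => // s3E; rewrite inE s3E /=; exact: (subsetP (subsetDl _ _) _ s3u).
have nu s : s \in U :\ u -> s != u by rewrite !inE => /andP[].
have s1t : s1 != t3 by rewrite /t3; case: ifP => // _; apply: nu.
have s2t : s2 != t3 by rewrite /t3; case: ifP => // _; apply: nu.
have inUE s : s \in D -> s \in U :\: E by rewrite UE => sD; rewrite inE sD orbT.
case: (IH _ ltE s1 s2 t3) => //; try exact: inUE.
- by rewrite /= !inE negb_or s12 s1t s2t.
- move=> [C1 [C2 [C3 [[sC1 sC2 sC3] [cC1 cC2 cC3] [m1 m2 m3] [d12 d13 d23] [a12 a13 a23]]]]]; left.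
  have sU := subset_trans _ (subsetDl U E).
  move: m3; rewrite /t3; case: ifP => s3E m3; last first.
    by exists C1, C2, C3; split; split=> //; apply: sU.
  have dis (C : {set T}) : C \subset U :\: E -> [disjoint C & C3] -> [disjoint C & C3 :|: (U :\: D)].
    move=> sC dC; rewrite disjoint_sym disjointsU; apply/andP; split.
      by rewrite disjoint_sym.
    apply/disjointP=> x; rewrite inE => /andP[/negbTE xD _] xC.
    have := subsetP sC _ xC; rewrite UE in_setU1 xD orbF => /eqP xu.
    by rewrite xu (disjointFl dC m3) in xC.
  exists C1, C2, (C3 :|: (U :\: D)); split; split=> //; try exact: sU.
  + by rewrite subUset sU ?subsetDl.
  + by apply: (connU_meet gs cC3 cEu m3); rewrite in_setD uD.
  + have /setDP[/setD1P[_ s3U] s3D] : s3 \in U :\ u :\: D by [].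
    by rewrite in_setU in_setD s3D s3U orbT.
  + exact: dis.
  + exact: dis.
  + by apply: adjS_sub a13 => //; apply: subsetUl.
  + by apply: adjS_sub a23 => //; apply: subsetUl.
- case=> c cUE [s12c s1t3 s2t3].
  have cu : u != c.
    apply: contraTneq J => uc; subst c.
    have := s12c (nu _ s1u) (nu _ s2u); rewrite UE setU1K // => nJ.
    by apply: contra nJ; apply: comp_joined.
  right; exists c; first exact: (subsetP (subsetDl _ _) _ cUE).
  have s3t a : separates (U :\: E) c a t3 -> a \notin E -> separates U c a s3.
    move=> S aE ac s3c; have t3c : t3 != c by rewrite /t3; case: ifP.
    apply: contra (S ac t3c) => /(joined_retract uU uE cu Eedge).
    by rewrite (negbTE aE).
  split; [|exact: s3t|exact: s3t].
  move=> ac bc; apply: contra (s12c ac bc) => /(joined_retract uU uE cu Eedge).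
  by rewrite (negbTE s1E) (negbTE s2E).
Qed.

Lemma triangle_2conn U r1 r2 r3 : conn g U -> (forall c, c \in U -> conn g (U :\ c)) ->
  uniq [:: r1; r2; r3] -> r1 \in U -> r2 \in U -> r3 \in U -> triangle U r1 r2 r3.
Proof.
move=> cU c2 ur r1U r2U r3U; case: (rooted_triangle cU ur r1U r2U r3U) => //.
case=> c cc [s12 s13 s23]; exfalso.
move: ur; rewrite /= !inE negb_or !andbT => /andP[/andP[r12 r13] r23].
have J a b : a \in U -> b \in U -> separates U c a b -> (a == c) || (b == c).
  move=> aU bU S; rewrite -[_ || _]negbK negb_or; apply/negP=> /andP[ac bc].
  by case/negP: (S ac bc); apply: conn_joined (c2 _ cc) _ _; rewrite !inE ?ac ?bc.
have := J _ _ r1U r2U s12; have := J _ _ r1U r3U s13; have := J _ _ r2U r3U s23.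
move=> /orP[]/eqP e1 /orP[]/eqP e2 /orP[]/eqP e3;
  by move: r12 r13 r23; rewrite ?e1 ?e2 ?e3 ?eqxx.
Qed.

End RootedTriangle.

(** * Fans and linkages *)

Section Linkage.
Variable T : finType.
Implicit Types (g : rel T) (B K N P Q U X : {set T}) (c r s t u w : T).

Definition fan g U s1 s2 t :=
  exists P Q : {set T}, [/\ [/\ P \subset U, Q \subset U & [disjoint P & Q]],
    [/\ conn g P, conn g Q, s1 \in P & s2 \in Q],
    t \notin P, t \notin Q & adjS g P [set t] /\ adjS g Q [set t]].

Lemma fan_sym g U s1 s2 t : fan g U s1 s2 t -> fan g U s2 s1 t.
Proof.
move=> [P [Q [[? ? dPQ] [? ? ? ?] ? ? [? ?]]]]; exists Q, P; split=> //; split=> //.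
by rewrite disjoint_sym.
Qed.

(** Moves a fan from [w] to its neighbour [t] when [t] lies on the branch [X]: this branch is cut
    short at [t], and the other one is prolonged through [w]. *)
Lemma fan_extend g U X Q s1 s2 w t : symmetric g ->
  X \subset U -> conn g X -> s1 \in X -> t \in X -> s1 != t ->
  w \in U -> Q \subset U -> conn g Q -> s2 \in Q -> adjS g Q [set w] ->
  w \notin X -> [disjoint X & Q] -> g w t -> fan g U s1 s2 t.
Proof.
move=> gs sX cX s1X tX s1t wU sQ cQ s2Q Qw wX dXQ gwt.
have s1Xt : s1 \in X :\ t by rewrite !inE s1t.
have CX : component g (X :\ t) s1 \subset X.
  exact: (subset_trans (comp_sub _ _ _) (subsetDl _ _)).
exists (component g (X :\ t) s1), (w |: Q); split.
- split; [exact: subset_trans sX | by rewrite subUset sub1set wU|].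
  rewrite disjoint_sym disjointsU1 disjoint_sym (disjointWl CX) // andbT.
  by apply: contra wX; apply: (subsetP CX).
- split; [exact: conn_comp| |exact: comp_self | by rewrite inE s2Q orbT].
  have /adjSP[q [w' [qQ /set1P-> gqw]]] := Qw.
  by apply: (conn_setU1 gs cQ qQ); rewrite gs.
- by rewrite inE !inE eqxx.
- rewrite !inE negb_or (disjointFr dXQ tX) andbT.
  by apply: contraNneq wX => <-.
- split; last by apply: adjS_intro gwt; rewrite !inE eqxx.
  apply: comp_adj => //; first by rewrite sub1set.
  by apply/set0Pn; exists t; rewrite inE.
Qed.

(** Menger's fan lemma for two paths. The fan is carried along a walk from [s1] to [t]. If the next
    vertex is off both branches, its component in the remainder touches a branch, because deleting
    the current vertex leaves the graph connected; the component is then added to that branch. *)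
Lemma fan_2conn g U s1 s2 t : symmetric g -> conn g U ->
  (forall c, c \in U -> conn g (U :\ c)) ->
  s1 \in U -> s2 \in U -> t \in U -> s1 != s2 -> t != s1 -> t != s2 ->
  fan g U s1 s2 t.
Proof.
move=> gs cU c2 s1U s2U tU s12.
suff main : forall w, joined g U s1 w -> [\/ w = s1, w = s2 | fan g U s1 s2 w].
  move=> /eqP ts1 /eqP ts2; case: (main t) => //; exact: conn_joined.
have base a b v : a \in U -> b \in U -> v \in U -> a != b -> v != a -> v != b ->
    g a v -> fan g U a b v.
  move=> aU bU vU ab va vb gav.
  have bUa : b \in U :\ a :\ v by rewrite !inE (eq_sym b v) vb (eq_sym b a) ab.
  exists [set a], (component g (U :\ a :\ v) b); split.
  - rewrite sub1set disjoints1; split=> //; last by rewrite !inE eqxx andbF.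
    by apply: (subset_trans (comp_sub _ _ _)); apply: (subset_trans (subsetDl _ _) (subsetDl _ _)).
  - by split; [exact: conn1|exact: conn_comp|rewrite inE|exact: comp_self].
  - by rewrite inE.
  - by rewrite !inE eqxx.
  - split; first by apply: adjS_intro gav; rewrite inE.
    apply: comp_adj => //; [exact: c2 | by rewrite sub1set !inE va |].
    by apply/set0Pn; exists v; rewrite inE.
move=> w /connectP[p pp ->].
suff: forall w0, [\/ w0 = s1, w0 = s2 | fan g U s1 s2 w0] -> path (restr g U) w0 p ->
    [\/ last w0 p = s1, last w0 p = s2 | fan g U s1 s2 (last w0 p)].
  by apply => //; constructor 1.
elim: p {pp} => [|v p IH] w0 Fw //= /andP[/and3P[wU vU gwv] pp].
apply: IH pp.
have [->|vs1] := eqVneq v s1; first by constructor 1.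
have [->|vs2] := eqVneq v s2; first by constructor 2.
constructor 3; case: Fw => [w1|w2|].
- by rewrite w1 in gwv; apply: base.
- by rewrite w2 in gwv; apply/fan_sym/base => //; rewrite eq_sym.
move=> [P [Q [[sP sQ dPQ] [cP cQ s1P s2Q] wP wQ [Pw Qw]]]].
have [vP|vP] := boolP (v \in P).
  by apply: (fan_extend (X := P) (Q := Q) (w := w0)) => //; rewrite eq_sym.
have [vQ|vQ] := boolP (v \in Q).
  apply/fan_sym/(fan_extend (X := Q) (Q := P) (w := w0)) => //; first by rewrite eq_sym.
  by rewrite disjoint_sym.
have [vw|vw] := eqVneq v w0; first by rewrite vw; exists P, Q; split.
have vW : v \in U :\ w0 :\: (P :|: Q) by rewrite !inE vU vw negb_or vP vQ.
set Z := component g (U :\ w0 :\: (P :|: Q)) v.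
have ZS := comp_sub g (U :\ w0 :\: (P :|: Q)) v.
have Zw : w0 \notin Z by apply/negP=> /(subsetP ZS); rewrite !inE eqxx andbF.
have ZU : Z \subset U by apply: (subset_trans ZS); apply: (subset_trans (subsetDl _ _) (subsetDl _ _)).
have Zd : [disjoint Z & P :|: Q].
  by apply/disjointP=> x /(subsetP ZS); rewrite in_setD => /andP[/negP].
have ZP : [disjoint Z & P] by apply: disjointWr Zd; apply: subsetUl.
have ZQ : [disjoint Z & Q] by apply: disjointWr Zd; apply: subsetUr.
have vZ : v \in Z by apply: comp_self.
have cZ : conn g Z by apply: conn_comp.
have : adjS g Z (P :|: Q).
  apply: comp_adj => //; first exact: c2.
    by rewrite subsetD1 subUset sP sQ inE negb_or wP wQ.
  by apply/set0Pn; exists s1; rewrite inE s1P.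
move=> /adjSP[z [x [zZ xPQ gzx]]]; case/setUP: xPQ => xX.
- apply: (fan_extend (X := P :|: Z) (Q := Q) (w := w0)) => //.
  + by rewrite subUset sP.
  + by apply: connU => //; apply: adjS_intro xX zZ _; rewrite gs.
  + by rewrite inE s1P.
  + by rewrite inE vZ orbT.
  + by rewrite eq_sym.
  + by rewrite inE negb_or wP.
  + by rewrite disjointsU dPQ.
- apply/fan_sym/(fan_extend (X := Q :|: Z) (Q := P) (w := w0)) => //.
  + by rewrite subUset sQ.
  + by apply: connU => //; apply: adjS_intro xX zZ _; rewrite gs.
  + by rewrite inE s2Q.
  + by rewrite inE vZ orbT.
  + by rewrite eq_sym.
  + by rewrite inE negb_or wQ.
  + by rewrite disjointsU disjoint_sym dPQ.
Qed.

(* [fan_2conn] for the graph obtained from [B] by attaching a vertex [t] to [N]. *)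
Lemma fan_attached g B N t s1 s2 : symmetric g -> conn g B -> t \notin B -> N \subset B ->
  (forall c v, c \in B -> v \in B :\ c -> exists2 n, n \in N :\ c & joined g (B :\ c) v n) ->
  s1 \in B -> s2 \in B -> s1 != s2 ->
  exists P Q : {set T}, [/\ [/\ P \subset B, Q \subset B & [disjoint P & Q]],
    conn g P, conn g Q, s1 \in P /\ s2 \in Q
    & (exists2 n, n \in P & n \in N) /\ (exists2 n, n \in Q & n \in N)].
Proof.
move=> gs cB tB NB H s1B s2B s12.
pose g' := [rel u v | if u == t then v \in N else if v == t then u \in N else g u v].
have nt x : x \in B -> (x == t) = false by move=> xB; apply: contraNF tB => /eqP<-.
have gs' : symmetric g'.
  by move=> u v /=; case: eqP => [eu|_]; case: eqP => [ev|_] //; rewrite ?eu ?ev.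
have jB (S : {set T}) u v : S \subset B -> joined g S u v = joined g' S u v.
  move=> /subsetP sS; apply/idP/idP; apply: (joined_map (phi := id)) => x y;
    move=> /and3P[xS yS gxy]; apply: joined1 => //; move: gxy;
    by rewrite /= (nt x (sS _ xS)) (nt y (sS _ yS)).
have cnB (S : {set T}) : S \subset B -> conn g S = conn g' S.
  move=> sS; apply/connP/connP => -[S0 J]; split=> // u v uS vS.
    by rewrite -jB // J.
  by rewrite jB // J.
have /set0Pn[b0 b0B] := conn_neq0 cB.
have [n0 n0N] : exists n, n \in N.
  have [|n] := H s1 s2 s1B; first by rewrite !inE eq_sym s12.
  by rewrite inE => /andP[_ nN] _; exists n.
have cU' : conn g' (t |: B).
  apply: (conn_setU1 gs' (y := n0)); rewrite -?cnB ?(subsetP NB) //=.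
  by rewrite eqxx.
have c2' c : c \in t |: B -> conn g' ((t |: B) :\ c).
  rewrite in_setU1 => /orP[/eqP->|cB']; first by rewrite setU1K // -cnB.
  have tS : t \in (t |: B) :\ c by rewrite !inE eqxx eq_sym nt.
  apply: (conn_root gs' tS) => x; rewrite !inE => /andP[xc /orP[/eqP->|xB]].
    exact: joined_refl.
  have [|n nN J] := H c x cB'; first by rewrite !inE xc.
  apply: (@joined_trans _ _ _ n).
    apply: joined1 => //.
      by move: nN; rewrite !inE => /andP[-> /(subsetP NB)->]; rewrite orbT.
    by rewrite /= eqxx; move: nN; rewrite inE => /andP[].
  rewrite joined_sym // ; apply: (@joined_sub _ _ (B :\ c)); first by apply: setSD; apply: subsetUr.
  by rewrite -jB // subsetDl.
have [P [Q [[sP sQ dPQ] [cP cQ s1P s2Q] tP tQ [Pt Qt]]]] : fan g' (t |: B) s1 s2 t.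
  by apply: fan_2conn; rewrite ?inE ?s1B ?s2B ?eqxx ?orbT // eq_sym nt.
have sub (S : {set T}) : S \subset t |: B -> t \notin S -> S \subset B.
  move=> sS tS; apply/subsetP=> x xS; have := subsetP sS x xS; rewrite inE => /orP[|//].
  by move/set1P=> xt; rewrite -xt xS in tS.
have sPB := sub _ sP tP; have sQB := sub _ sQ tQ.
have hit (S : {set T}) : S \subset B -> adjS g' S [set t] -> exists2 n, n \in S & n \in N.
  move=> sS /adjSP[x [y [xS /set1P-> /=]]]; rewrite eqxx (nt x) ?(subsetP sS) //.
  by exists x.
by exists P, Q; split; rewrite ?cnB //; split=> //; apply: hit.
Qed.

Definition linked g K a a' b b' :=
  exists P Q : {set T}, [/\ [/\ P \subset K, Q \subset K & [disjoint P & Q]],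
    conn g P, conn g Q, a \in P /\ a' \in P & b \in Q /\ b' \in Q].

(* A cycle minor through [a], [b], [a'], [b'], in this order. *)
Definition square g K a b a' b' :=
  exists A B A' B' : {set T}, [/\
    [/\ A \subset K, B \subset K, A' \subset K & B' \subset K],
    [/\ conn g A, conn g B, conn g A' & conn g B'],
    [/\ a \in A, b \in B, a' \in A' & b' \in B'],
    [/\ [disjoint A & B], [disjoint A & A'], [disjoint A & B'] &
        [/\ [disjoint B & A'], [disjoint B & B'] & [disjoint A' & B']]]
  & [/\ adjS g A B, adjS g B A', adjS g A' B' & adjS g A B']].

(** With [Q] contracted to one vertex, 2-connectedness gives disjoint paths to it from [a] and [b]
    inside [P]. They grow to a partition of [P]: [P2] becomes a full component of [P :\: P1], and
    what remains is still connected. *)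
Lemma split_attached g K P Q a b t : symmetric g ->
  conn g K -> (forall c, c \in K -> conn g (K :\ c)) ->
  conn g P -> [disjoint P & Q] -> P :|: Q = K -> a \in P -> b \in P -> a != b -> t \in Q ->
  exists P1 P2, [/\ P1 :|: P2 = P, [disjoint P1 & P2], conn g P1 /\ conn g P2,
    a \in P1 /\ b \in P2 & [/\ adjS g P1 P2, adjS g P1 Q & adjS g P2 Q]].
Proof.
move=> gs cK c2 cP dPQ PQ aP bP ab tQ.
pose N := [set x in P | [exists y in Q, g x y]].
have PK : P \subset K by rewrite -PQ subsetUl.
have tP : t \notin P by rewrite (disjointFl dPQ tQ).
have tK : t \in K by rewrite -PQ inE tQ orbT.
have NP : N \subset P by apply/subsetP=> x; rewrite inE => /andP[].
have [|P1 [P2 [[sP1 sP2 dP] cP1 cP2 [aP1 bP2] [[n1 n1P n1N] [n2 n2P n2N]]]]] :=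
  fan_attached gs cP tP NP _ aP bP ab.
  move=> c v cP' vPc; have cK' := subsetP PK _ cP'.
  have vP : v \in P by move: vPc; rewrite inE => /andP[].
  have tKc : t \in K :\ c by rewrite !inE tK andbT; apply: contraNneq tP => ->.
  have vKc : v \in K :\ c by apply: subsetP vPc; apply: setSD.
  have [p [q [/setIP[pKc pP] /setDP[qKc qP] gpq J]]] :=
    joined_exit (conn_joined (c2 _ cK') vKc tKc) vP tP.
  exists p.
    rewrite !inE pP; move: pKc; rewrite !inE => /andP[-> _] /=.
    apply/exists_inP; exists q => //.
    move: qKc; rewrite !inE -PQ inE (negbTE qP) => /andP[_ //].
  apply: joined_sub J; apply/subsetP=> x; rewrite !inE.
  by case/andP=> /andP[-> _] ->.
have aPP : b \in P :\: P1 by rewrite inE (disjointFl dP bP2).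
set P2' := component g (P :\: P1) b.
have s2 : P2 \subset P2'.
  apply: conn_sub_comp => //; apply/subsetP=> x xP2.
  by rewrite inE (disjointFl dP xP2) (subsetP sP2).
have s1 : P1 \subset P :\: P2'.
  apply/subsetP=> x xP1; rewrite in_setD (subsetP sP1) // andbT.
  by apply/negP=> /(subsetP (comp_sub _ _ _)); rewrite inE xP1.
have sP2' : P2' \subset P by apply: (subset_trans (comp_sub _ _ _)); apply: subsetDl.
have toQ (S : {set T}) n : n \in S -> n \in N -> adjS g S Q.
  by move=> nS; rewrite inE => /andP[_ /exists_inP[y yQ gny]]; apply: adjS_intro gny.
exists (P :\: P2'), P2'; split.
- apply/setP=> x; rewrite in_setU in_setD; case: (boolP (x \in P2')) => [xQ|_]; last by rewrite orbF.
  by rewrite (subsetP sP2').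
- by apply/disjointP=> x; rewrite in_setD => /andP[/negP].
- by split; [exact: conn_co|exact: conn_comp].
- by split; [exact: (subsetP s1)|exact: (subsetP s2)].
- split; [|exact: toQ (subsetP s1 _ n1P) n1N|exact: toQ (subsetP s2 _ n2P) n2N].
  have := comp_adj cP sP1 (conn_neq0 cP1) aPP; rewrite -/P2' adjS_sym //.
  exact: adjS_sub.
Qed.

(** [P] and [Q] grow to a partition of [K], and each class is split into two parts that both touch
    the other class. In the resulting 2 x 2 pattern every row and column has a contact: either the
    straight contacts are both present and link, or the crossed ones are and close up a square. *)
Lemma linked_or_square_aux g K P Q a a' b b' : symmetric g ->
  conn g K -> (forall c, c \in K -> conn g (K :\ c)) ->
  P \subset K -> Q \subset K -> [disjoint P & Q] -> conn g P -> conn g Q ->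
  a \in P -> b \in P -> a' \in Q -> b' \in Q -> a != b -> a' != b' ->
  linked g K a a' b b' \/ square g K a b a' b'.
Proof.
move=> gs cK c2 sP sQ dPQ cP cQ aP bP a'Q b'Q ab a'b'.
pose Q' := component g (K :\: P) a'; pose P' := K :\: Q'.
have a'KP : a' \in K :\: P by rewrite inE (disjointFl dPQ a'Q) (subsetP sQ).
have sQ' : Q \subset Q'.
  apply: conn_sub_comp => //; apply/subsetP=> x xQ.
  by rewrite inE (disjointFl dPQ xQ) (subsetP sQ).
have sP' : P \subset P'.
  apply/subsetP=> x xP; rewrite in_setD (subsetP sP) // andbT.
  by apply/negP=> /(subsetP (comp_sub _ _ _)); rewrite inE xP.
have Q'K : Q' \subset K by apply: (subset_trans (comp_sub _ _ _)); apply: subsetDl.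
have cQ' : conn g Q' by apply: conn_comp.
have cP' : conn g P' by apply: conn_co.
have d' : [disjoint P' & Q'].
  by apply/disjointP=> x; rewrite in_setD => /andP[/negP].
have PQ : P' :|: Q' = K.
  apply/setP=> x; rewrite in_setU in_setD; case: (boolP (x \in Q')) => [xQ|_]; last by rewrite orbF.
  by rewrite (subsetP Q'K).
have [P1 [P2 [P12 dP [cP1 cP2] [aP1 bP2] [aPP P1Q P2Q]]]] :=
  split_attached gs cK c2 cP' d' PQ (subsetP sP' _ aP) (subsetP sP' _ bP) ab (subsetP sQ' _ a'Q).
have d'' : [disjoint Q' & P'] by rewrite disjoint_sym.
have QP : Q' :|: P' = K by rewrite setUC.
have [Q1 [Q2 [Q12 dQ [cQ1 cQ2] [aQ1 bQ2] [aQQ Q1P Q2P]]]] :=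
  split_attached gs cK c2 cQ' d'' QP (subsetP sQ' _ a'Q) (subsetP sQ' _ b'Q) a'b' (subsetP sP' _ aP).
have adjU (A B C : {set T}) : adjS g A (B :|: C) -> adjS g A B || adjS g A C.
  move=> /adjSP[x [y [xA /setUP[yB|yC] gxy]]]; apply/orP; [left|right]; exact: adjS_intro gxy.
have PK (A : {set T}) : A \subset P' -> A \subset K by move=> sA; apply: (subset_trans sA); apply: subsetDl.
have P1K : P1 \subset P' by rewrite -P12 subsetUl.
have P2K : P2 \subset P' by rewrite -P12 subsetUr.
have Q1K : Q1 \subset Q' by rewrite -Q12 subsetUl.
have Q2K : Q2 \subset Q' by rewrite -Q12 subsetUr.
have dd (A B : {set T}) : A \subset P' -> B \subset Q' -> [disjoint A & B].
  by move=> sA sB; apply: disjointW sA sB _.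
have QK (A : {set T}) : A \subset Q' -> A \subset K by move=> sA; apply: (subset_trans sA).
have P1K' := PK _ P1K; have P2K' := PK _ P2K.
have Q1K' := QK _ Q1K; have Q2K' := QK _ Q2K.
rewrite -Q12 in P1Q P2Q; rewrite -P12 in Q1P Q2P.
have m1 := adjU _ _ _ P1Q; have m2 := adjU _ _ _ P2Q.
have := adjU _ _ _ Q1P; have := adjU _ _ _ Q2P.
rewrite ![adjS g Q1 _]adjS_sym // ![adjS g Q2 _]adjS_sym // => m3 m4.
have [/andP[m11 m22]|mm] := boolP (adjS g P1 Q1 && adjS g P2 Q2).
  left; exists (P1 :|: Q1), (P2 :|: Q2); split.
  - rewrite !subUset P1K' P2K' Q1K' Q2K'; split=> //.
    rewrite disjointsU !(disjoint_sym _ (mem (P2 :|: Q2))) !disjointsU.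
    by rewrite !(disjoint_sym (mem P2)) !(disjoint_sym (mem Q2)) dP dQ dd //= disjoint_sym dd.
  - exact: connU.
  - exact: connU.
  - by rewrite !inE aP1 aQ1 orbT.
  - by rewrite !inE bP2 bQ2 orbT.
have [m12 m21] : adjS g P1 Q2 /\ adjS g P2 Q1.
  move: m1 m2 m3 m4 mm; case: (adjS g P1 Q1); case: (adjS g P2 Q2);
    by case: (adjS g P1 Q2); case: (adjS g P2 Q1).
right; exists P1, P2, Q1, Q2; split; split=> //; try exact: dd.
by split=> //; apply: dd.
Qed.

(** Two disjoint paths from [a], [a'] to [b], [b'] exist in one of the two matchings. [t] is a name
    for the vertex attached to [b] and [b']. *)
Lemma linked_or_square g K a a' b b' t : symmetric g ->
  conn g K -> (forall c, c \in K -> conn g (K :\ c)) -> t \notin K ->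
  uniq [:: a; a'; b; b'] -> a \in K -> a' \in K -> b \in K -> b' \in K ->
  linked g K a a' b b' \/ square g K a b a' b'.
Proof.
move=> gs cK c2 tK; rewrite /= !inE !negb_or !andbT.
move=> /and3P[/and3P[aa' ab ab'] /andP[a'b a'b'] bb'] aK a'K bK b'K.
have NK : [set b; b'] \subset K by rewrite subUset !sub1set bK.
have [|P [Q [[sP sQ dPQ] cP cQ [aP a'Q] [[n1 n1P n1N] [n2 n2Q n2N]]]]] :=
  fan_attached gs cK tK NK _ aK a'K aa'.
  move=> c v cK' vKc.
  have [n nN nc] : exists2 n, n \in [set b; b'] & n != c.
    have [bc|bc] := eqVneq b c; first by exists b'; rewrite ?inE ?eqxx ?orbT // -bc eq_sym.
    by exists b; rewrite ?inE ?eqxx.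
  have nK := subsetP NK _ nN.
  exists n; first by rewrite in_setD1 nc.
  by apply: conn_joined => //; [apply: c2 | rewrite !inE nc].
have n12 : n1 != n2 by apply: contraTneq n1P => ->; rewrite (disjointFl dPQ n2Q).
case/set2P: n1N n1P n12 => -> n1P; case/set2P: n2N n2Q => -> n2Q n12; rewrite ?eqxx // in n12 *.
  exact: (linked_or_square_aux (P := P) (Q := Q)).
case: (@linked_or_square_aux g K P Q a a' b' b) => //.
  move=> [X [Y [? ? ? ? [? ?]]]]; by left; exists X, Y.
move=> [A [B [A' [B' [[? ? ? ?] [? ? ? ?] [? ? ? ?] [dAB dAA' dAB' [dBA' dBB' dA'B']] [? ? ? ?]]]]]].
right; exists A, B', A', B; split; split=> //; try by rewrite adjS_sym.
by split; rewrite // disjoint_sym.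
Qed.

End Linkage.

(** * Cycles of pairs of disjoint edges *)

Notation "\xor_ ( i | P ) F" := (\big[addb/false]_(i | P%B) F%B)
  (at level 41, F at level 41, i, P at level 50).
Notation "\xor_ i F" := (\big[addb/false]_i F%B)
  (at level 41, F at level 41, i at level 0).

(** Equal terms at [i] and [f i] cancel mod 2, and fixed points carry no weight. *)
Lemma xor_involution (I : finType) (P : pred I) (F : I -> bool) (f : I -> I) :
  involutive f -> (forall i, P i -> P (f i)) -> (forall i, P i -> F (f i) = F i) ->
  (forall i, P i -> F i -> f i != i) -> \xor_(i | P i) F i = false.
Proof.
move=> fK Pf Ff fx.
have PfE i : P (f i) = P i by apply/idP/idP=> /Pf; rewrite ?fK.
rewrite (bigID (fun i => enum_rank i < enum_rank (f i))) /= addbC.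
rewrite [X in X (+) _](_ : _ = \xor_(i | P i && (enum_rank i < enum_rank (f i))) F i).
  exact: addbb.
rewrite (reindex_inj (can_inj fK)) /= big_mkcond [RHS]big_mkcond /=.
apply: eq_bigr => i _; rewrite PfE fK.
case Pi: (P i) => //=; rewrite Ff // -leqNgt leq_eqVlt.
have [e|ne] := eqVneq (enum_rank i : nat) (enum_rank (f i)); last by [].
have fi : f i = i by apply: enum_rank_inj; apply: val_inj.
rewrite fi ltnn; case Fi: (F i) => //.
by have := fx i Pi Fi; rewrite fi eqxx.
Qed.

Lemma xor_other (I : finType) (F : I -> bool) i :
  \xor_j F j = false -> F i -> exists2 j, j != i & F j.
Proof.
rewrite (bigD1 i) //= => + Fi; rewrite Fi => H.
have [/existsP[j /andP[ji Fj]]|] := boolP [exists j, (j != i) && F j]; first by exists j.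
rewrite negb_exists => /forallP N; move: H; rewrite big1 // => j ji.
by have := N j; rewrite ji /= => /negbTE.
Qed.

Lemma xor_pred1 (I : finType) (F : I -> bool) i : \xor_j ((j == i) && F j) = F i.
Proof.
rewrite (bigD1 i) //= eqxx big1 ?addbF // => j /negbTE ->.
by [].
Qed.

Lemma xor_ex (I : finType) (P : pred I) (F : I -> bool) :
  \xor_(i | P i) F i -> exists2 i, P i & F i.
Proof.
have [/existsP[i /andP[Pi Fi]]|] := boolP [exists i, P i && F i]; first by exists i.
rewrite negb_exists => /forallP N; rewrite big1 // => i Pi.
by have := N i; rewrite Pi /= => /negbTE.
Qed.

Section EdgePairs.
Variable T : finType.
Implicit Types (g : rel T) (U : {set T}) (x y u v a b : T).

Definition quad : finType := ((T * T) * (T * T))%type.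
Implicit Types (D R : quad -> bool) (q : quad) (s : rel T).

Definition flip q : quad := (q.2, q.1).
Definition rev1 q : quad := ((q.1.2, q.1.1), q.2).
Definition rev2 q : quad := (q.1, (q.2.2, q.2.1)).

Definition symD D q := D q (+) D (flip q).

Definition disjq q :=
  [&& q.1.1 != q.2.1, q.1.1 != q.2.2, q.1.2 != q.2.1 & q.1.2 != q.2.2].

(* A family of pairs of disjoint edges whose symmetrization [symD D] is a cycle of
   the deleted product: for each edge e, the edges paired with e form an even graph. *)
Definition pair_cycle g U D :=
  [/\ forall q, D (rev1 q) = D q, forall q, D (rev2 q) = D q,
      forall q, D q -> [/\ disjq q, q.1.1 \in U /\ q.1.2 \in U, q.2.1 \in U /\ q.2.2 \in U,
        g q.1.1 q.1.2 & g q.2.1 q.2.2]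
    & forall x y u, \xor_v symD D ((x, y), (u, v)) = false].

(** The parity arguments only compare two distinct vertices, so an order enters merely as a
    tournament. *)
Definition tournament s := forall x u, s x u (+) s u x = (x != u).

(* For a linear order [s], the four terms of a pair of disjoint edges sum up to the
   parity of their crossings when the vertices are placed on a circle in that order. *)
Definition crossings s D := \xor_q (s q.1.1 q.2.1 && D q).

Definition rank_lt : rel T := fun x u => enum_rank x < enum_rank u.

Lemma rank_tournament : tournament rank_lt.
Proof.
move=> x u; rewrite /rank_lt; have [->|xu] := eqVneq x u; first by rewrite ltnn.
by case: (ltngtP (enum_rank x) (enum_rank u)) => // /val_inj/enum_rank_inj e; rewrite e eqxx in xu.
Qed.

Lemma pair_sum (J : finType) (pr : quad -> J) D (P : pred quad) :
  \xor_j \xor_(q | P q && (pr q == j)) D q = \xor_(q | P q) D q.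
Proof. by rewrite [RHS](partition_big pr predT). Qed.

Lemma quad_sum D x y u : \xor_v D ((x, y), (u, v)) =
  \xor_(q | [&& q.1.1 == x, q.1.2 == y & q.2.1 == u]) D q.
Proof.
rewrite [RHS](reindex_onto (fun v => ((x, y), (u, v)) : quad) (fun q => q.2.2)) /=.
  by apply: eq_big => v; rewrite ?eqxx.
by move=> [[a b] [c d]] /= /and3P[/eqP-> /eqP-> /eqP->].
Qed.

Lemma cyc_sum g U D x u : pair_cycle g U D ->
  \xor_(q | (q.1.1 == x) && (q.2.1 == u)) symD D q = false.
Proof.
move=> [_ _ _ cyc]; rewrite -(pair_sum (fun q => q.1.2)) big1 // => y _.
apply: etrans (cyc x y u); rewrite quad_sum; apply: eq_bigl => q.
by rewrite andbAC andbA.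
Qed.

Lemma flip_inj : involutive flip.
Proof. by move=> [[? ?] [? ?]]. Qed.

(** Independence of the drawing. The disagreement [t] of the two tournaments is symmetric, and so is
    [E x u], the parity of pairs with first ends [x] and [u], because [symD D] is a cycle. Hence the
    terms of [(x, u)] and [(u, x)] cancel, while [E x x] vanishes by disjointness. *)
Lemma crossings_tournament g U D s s' : pair_cycle g U D ->
  tournament s -> tournament s' -> crossings s D = crossings s' D.
Proof.
move=> cD ts ts'; suff : crossings s D (+) crossings s' D = false by case: crossings; case: crossings.
rewrite /crossings -big_split /=.
have [_ _ sp _] := cD.
pose t x u := s x u (+) s' x u.
have tsym x u : t x u = t u x.
  have := ts x u; have := ts' x u; rewrite /t.
  by case: (s x u); case: (s u x); case: (s' x u); case: (s' u x) => //= <-.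
pose E x u := \xor_(q | (q.1.1 == x) && (q.2.1 == u)) D q.
have Esym x u : E x u = E u x.
  suff : E x u (+) E u x = false by case: (E x u); case: (E u x).
  apply: etrans (cyc_sum x u cD); rewrite /symD big_split /=; congr addb.
  rewrite [RHS](reindex_inj (can_inj flip_inj)) /=.
  by apply: eq_big => [q|q _]; rewrite ?flip_inj // andbC.
suff -> : \xor_q (s q.1.1 q.2.1 && D q (+) s' q.1.1 q.2.1 && D q) =
    \xor_(p | predT p) (t p.1 p.2 && E p.1 p.2).
  apply: (@xor_involution _ _ _ (fun p : T * T => (p.2, p.1))).
  - by move=> [? ?].
  - by [].
  - by move=> [x u] _ /=; rewrite tsym Esym.
  - move=> [x u] _ /= /andP[_]; apply: contraTneq => -[_ ->].
    rewrite /E big1 // => q /andP[/eqP e1 /eqP e2]; apply/negP=> /sp[/and4P[]].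
    by rewrite e1 e2 eqxx.
rewrite -(pair_sum (fun q => (q.1.1, q.2.1))) /=; apply: eq_bigr => -[x u] _ /=.
rewrite /E big_distrr /=; apply: eq_big => [q|q].
  by rewrite xpair_eqE.
by rewrite xpair_eqE /t => /andP[/eqP-> /eqP->]; rewrite -andb_addl.
Qed.

(** A symmetric family counts every unordered pair twice. Exactly one of [s y v] and [s v y] holds,
    which splits each term in two: [s x u && s y v] is invariant under reversing both edges,
    [s x u && s v y] under reversing and exchanging them, and neither involution fixes a pair of the
    family. *)
Lemma crossings_sym0 D s : tournament s ->
  (forall q, D (rev1 q) = D q) -> (forall q, D (rev2 q) = D q) ->
  (forall q, D (flip q) = D q) -> (forall q, D q -> disjq q) ->
  (forall q, D q -> q.1.1 != q.1.2) -> crossings s D = false.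
Proof.
move=> ts r1 r2 fl dj ne; rewrite /crossings.
rewrite (eq_bigr (fun q => (s q.1.1 q.2.1 && s q.1.2 q.2.2 && D q) (+)
   (s q.1.1 q.2.1 && s q.2.2 q.1.2 && D q))); last first.
  move=> [[x y] [u v]] _ /=; case Dq: (D _); last by rewrite !andbF.
  have /and4P[/= _ _ _ yv] := dj _ Dq.
  have := ts y v; rewrite yv; by case: (s x u) => //=; case: (s y v); case: (s v y).
rewrite big_split /= (@xor_involution _ _ _ (fun q => rev1 (rev2 q))) //.
- apply: (@xor_involution _ _ _ (fun q => flip (rev1 (rev2 q)))) => //.
  + by move=> [[? ?] [? ?]].
  + by move=> q _; rewrite fl r1 r2; case: q => [[? ?] [? ?]] /=; congr andb; rewrite andbC.
  + move=> [[x y] [u v]] _ /= /andP[_ /dj/and4P[/= _ xv _ _]].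
    by apply: contra xv; rewrite /flip /rev1 /rev2 /= !xpair_eqE => /andP[/andP[/eqP->]].
- by move=> [[? ?] [? ?]].
- by move=> q _; rewrite r1 r2; case: q => [[? ?] [? ?]] /=; congr andb; rewrite andbC.
- move=> [[x y] [u v]] _ /= /andP[_ /ne /= xy].
  by apply: contra xy; rewrite /rev1 /rev2 /= !xpair_eqE => /andP[/andP[_ /eqP->]].
Qed.

(** An edge as a chain mod 2; the sum makes it vanish when [a = b]. *)
Definition edge_chain a b : rel T :=
  fun u v => ((v == b) && (u == a)) (+) ((v == a) && (u == b)).

Lemma edge_chain_sym a b : symmetric (edge_chain a b).
Proof. by move=> u v; rewrite /edge_chain addbC ![(v == _) && _]andbC. Qed.

Lemma edge_chain_sum a b u : \xor_v edge_chain a b u v = (u == a) (+) (u == b).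
Proof. by rewrite big_split /= !xor_pred1. Qed.

Lemma edge_chainP a b u v : edge_chain a b u v -> (u = a /\ v = b) \/ (u = b /\ v = a).
Proof.
rewrite /edge_chain => H.
have : ((v == b) && (u == a)) || ((v == a) && (u == b)).
  by case: (_ && _) H => //= ->.
by case/orP=> /andP[/eqP-> /eqP->]; [left|right].
Qed.

Lemma chain_of_joined g U a b : symmetric g -> joined g U a b ->
  exists p : rel T, [/\ symmetric p, forall u v, p u v -> [/\ u \in U, v \in U & g u v]
    & forall u, \xor_v p u v = (u == a) (+) (u == b)].
Proof.
move=> gs /connectP[l]; elim: l a => [|c l IH] a /=.
  move=> _ ->; exists (fun _ _ => false); split=> // u.
  by rewrite big1 //; case: (u == a).
move=> /andP[/and3P[aU cU gac] pl] e; have [p [ps psup psum]] := IH c pl e.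
exists (fun u v => p u v (+) edge_chain a c u v); split.
- by move=> u v; rewrite ps edge_chain_sym.
- move=> u v; case p1: (p u v) => /=; first by move=> _; apply: psup.
  by case/edge_chainP=> -[-> ->]; rewrite ?aU ?cU // gs.
- move=> u; rewrite big_split /= psum edge_chain_sum.
  by case: (u == c); case: (u == a); case: (u == b).
Qed.

Definition prodD (C C' : rel T) : quad -> bool :=
  fun q => C q.1.1 q.1.2 && C' q.2.1 q.2.2.

(** Two disjoint cycles cross evenly: the comparison [s x u] ignores the far end [v], and the values
    [C' u v] sum to zero over [v]. *)
Lemma add_product g U D (C C' : rel T) (X Y : {set T}) s :
  pair_cycle g U D -> X \subset U -> Y \subset U -> [disjoint X & Y] ->
  symmetric C -> symmetric C' ->
  (forall u v, C u v -> [/\ u \in X, v \in X & g u v]) ->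
  (forall u v, C' u v -> [/\ u \in Y, v \in Y & g u v]) ->
  (forall u, \xor_v C u v = false) -> (forall u, \xor_v C' u v = false) ->
  pair_cycle g U (fun q => D q (+) prodD C C' q) /\
  crossings s (fun q => D q (+) prodD C C' q) = crossings s D.
Proof.
move=> [D1 D2 D3 D4] XU YU dXY Cs C's Csup C'sup C0 C'0; split; last first.
  rewrite /crossings (eq_bigr (fun q : quad => (s q.1.1 q.2.1 && D q) (+)
     (s q.1.1 q.2.1 && prodD C C' q))) => [|q _]; last by rewrite andb_addr.
  rewrite big_split /= -[X in _ (+) X](pair_sum (fun q => (q.1.1, q.1.2, q.2.1))) /=.
  rewrite [X in _ (+) X]big1 ?addbF // => -[[x y] u] _ /=.
  rewrite (eq_bigl (fun q : quad => [&& q.1.1 == x, q.1.2 == y & q.2.1 == u])); last first.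
    by move=> q; rewrite !xpair_eqE andbA.
  by rewrite -(quad_sum (fun q => s q.1.1 q.2.1 && prodD C C' q)) /prodD /= -!big_distrr /= C'0 !andbF.
split.
- by move=> q; rewrite D1 /prodD /= Cs.
- by move=> q; rewrite D2 /prodD /= C's.
- move=> q; case Dq: (D q) => /=; first by move=> _; apply: D3.
  case/andP=> /Csup[x1 x2 gx] /C'sup[y1 y2 gy]; split=> //.
  + have ne x y : x \in X -> y \in Y -> x != y.
      by move=> xX yY; apply: contraTneq xX => ->; rewrite (disjointFl dXY yY).
    by apply/and4P; split; apply: ne.
  + by rewrite !(subsetP XU).
  + by rewrite !(subsetP YU).
- move=> x y u; apply: etrans (D4 x y u).
  rewrite (eq_bigr (fun v => symD D ((x, y), (u, v)) (+)
    (symD (prodD C C') ((x, y), (u, v))))); last first.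
    by move=> v _; rewrite /symD /=; case: (D _); case: (D _); case: (prodD _ _ _); case: (prodD _ _ _).
  rewrite big_split /= [X in _ (+) X](_ : _ = false) ?addbF //.
  rewrite /symD /prodD big_split /= -big_distrr -big_distrl /= C'0 C0.
  by rewrite andbF.
Qed.

End EdgePairs.

(** * Pushing an odd pair cycle through the contraction of an edge *)

Section Contraction.
Variable T : finType.
Implicit Types (g : rel T) (P U : {set T}) (x y u v a b : T) (D : quad T -> bool) (s : rel T).

Lemma closed_chain g P x a a' : symmetric g ->
  x \notin P -> a \in P -> a' \in P -> conn g P -> a != a' -> g x a -> g x a' ->
  exists C : rel T, [/\ symmetric C,
    forall u v, C u v -> [/\ u \in x |: P, v \in x |: P & g u v],
    forall u, \xor_v C u v = false
    & forall u, C x u = (u == a) || (u == a')].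
Proof.
move=> gs xP aP a'P cP aa' gxa gxa'.
have [p [ps psup psum]] := chain_of_joined gs (conn_joined cP aP a'P).
exists (fun u v => p u v (+) (edge_chain x a u v (+) edge_chain x a' u v)); split.
- by move=> u v; rewrite ps !(edge_chain_sym _ _ u v).
- move=> u v; case puv: (p u v) => /=.
    by move=> _; have [? ? ?] := psup _ _ puv; rewrite !inE; split=> //; apply/orP; right.
  have E c : c \in P -> g x c -> edge_chain x c u v -> [/\ u \in x |: P, v \in x |: P & g u v].
    by move=> cP' gxc /edge_chainP[] [-> ->]; rewrite !inE cP' eqxx ?orbT // gs.
  by case e1: (edge_chain x a u v) => /= e2; [exact: (E a)|exact: (E a')].
- move=> u; rewrite big_split /= psum big_split /= !edge_chain_sum.
  by case: (u == a); case: (u == a'); case: (u == x).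
- move=> u; have nx c : c \in P -> (x == c) = false by move=> cP'; apply: contraNF xP => /eqP->.
  rewrite /edge_chain eqxx !nx // !andbT !andbF !addbF.
  have -> : p x u = false by apply/negP=> /psup[xP']; rewrite xP' in xP.
  by rewrite /=; have [->|//] := eqVneq u a; rewrite (negbTE aa').
Qed.

(** The matrix [m] of the pairs of edges [xa], [yb] has even rows and columns. Adding the product of
    disjoint cycles through [a x a'] and [b y b'] flips a 2 x 2 minor; if three of its entries are
    1, the number of ones drops. When no such minor with four distinct indices is left, evenness
    forces three common neighbours of [x] and [y]. *)
Lemma kill_matrix g U D s x y :
  symmetric g -> irreflexive g -> pair_cycle g U D -> x \in U -> y \in U -> x != y ->
  (forall a a' b b', uniq [:: a; a'; b; b'] -> g x a -> g x a' -> g y b -> g y b' ->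
    a \in U :\ x :\ y -> a' \in U :\ x :\ y -> b \in U :\ x :\ y -> b' \in U :\ x :\ y ->
    linked g (U :\ x :\ y) a a' b b') ->
  (forall a b c, uniq [:: a; b; c] -> a \in U :\ x :\ y -> b \in U :\ x :\ y ->
    c \in U :\ x :\ y -> g x a -> g x b -> g x c -> g y a -> g y b -> g y c -> False) ->
  exists D', [/\ pair_cycle g U D', crossings s D' = crossings s D
    & forall a b, symD D' ((x, a), (y, b)) = false].
Proof.
move=> gs gi + xU yU xy link no3.
pose m D a b := symD D ((x, a), (y, b)).
pose M D := [set p : T * T | m D p.1 p.2].
elim: {D}_.+1 {-2}D (ltnSn #|M D|) => // n IH D leM cD.
have [D1 D2 D3 D4] := cD.
have [/existsP[[a0 b0] /= m0]|] := boolP [exists p : T * T, m D p.1 p.2]; last first.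
  rewrite negb_exists => /forallP N; exists D; split=> // a b.
  by have /negbTE := N (a, b).
have msup a b : m D a b -> [/\ a != b, a \in U :\ x :\ y, b \in U :\ x :\ y, g x a & g y b].
  rewrite /m /symD /flip /=; case Dq: (D (x, a, (y, b))) => /=.
    move=> _; have [/and4P[/= _ xb ay ab] [_ aU] [_ bU] gxa gyb] := D3 _ Dq.
    split=> //; rewrite !inE ?ay ?aU ?bU /= ?andbT.
      by apply: contraTneq gxa => ->; rewrite gi.
    rewrite (eq_sym b x) xb andbT.
    by apply: contraTneq gyb => ->; rewrite gi.
  move/D3=> [/and4P[/= _ ya bx ba] [_ bU] [_ aU] gyb gxa].
  split=> //; first by rewrite eq_sym.
    rewrite !inE aU (eq_sym a y) ya /= andbT.
    by apply: contraTneq gxa => ->; rewrite gi.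
  rewrite !inE bU bx !andbT.
  by apply: contraTneq gyb => ->; rewrite gi.
have row a b : m D a b -> exists2 b', b' != b & m D a b'.
  by apply: (xor_other (F := m D a)); apply: D4.
have col a b : m D a b -> exists2 a', a' != a & m D a' b.
  apply: (xor_other (F := fun a => m D a b)); apply: etrans (D4 y b x).
  by apply: eq_bigr => v _; rewrite /m /symD /flip addbC.
have [/existsP[[[a a'] [b b']] /= /and5P[mab mab' ma'b aa' /andP[bb' a'b']]]|] :=
  boolP [exists q : (T * T) * (T * T), [&& m D q.1.1 q.2.1, m D q.1.1 q.2.2,
    m D q.1.2 q.2.1, q.1.1 != q.1.2, q.2.1 != q.2.2 & q.1.2 != q.2.2]].
  have [ab aK bK gxa gyb] := msup _ _ mab.
  have [ab' _ b'K _ gyb'] := msup _ _ mab'.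
  have [a'b a'K _ gxa' _] := msup _ _ ma'b.
  have [|P [Q [[sP sQ dPQ] cP cQ [aP a'P] [bQ b'Q]]]] := link a a' b b' _ gxa gxa' gyb gyb' aK a'K bK b'K.
    by rewrite /= !inE !negb_or aa' ab ab' a'b a'b' bb'.
  have notK (S : {set T}) : S \subset U :\ x :\ y -> x \notin S /\ y \notin S.
    move=> sS; split; apply/negP=> /(subsetP sS); rewrite !inE eqxx ?andbF //.
  have [xP yP] := notK _ sP; have [xQ yQ] := notK _ sQ.
  have [C [Cs Csup C0 Cx]] := closed_chain gs xP aP a'P cP aa' gxa gxa'.
  have [C' [C's C'sup C'0 C'y]] := closed_chain gs yQ bQ b'Q cQ bb' gyb gyb'.
  have KU : U :\ x :\ y \subset U by apply: (subset_trans (subsetDl _ _) (subsetDl _ _)).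
  have sX : x |: P \subset U by rewrite subUset sub1set xU (subset_trans sP).
  have sY : y |: Q \subset U by rewrite subUset sub1set yU (subset_trans sQ).
  have dXY : [disjoint x |: P & y |: Q].
    rewrite disjointsU1 !inE negb_or xy xQ /= disjoint_sym disjointsU1 yP /=.
    by rewrite disjoint_sym.
  have [cD1 crD1] := add_product s cD sX sY dXY Cs C's Csup C'sup C0 C'0.
  set E := fun q => _ in cD1 crD1.
  have mE u v : m E u v = m D u v (+) (((u == a) || (u == a')) && ((v == b) || (v == b'))).
    rewrite /m /symD /E /flip /prodD /= Cx C'y.
    have -> : C y v = false.
      by apply/negP=> /Csup[]; rewrite !inE eq_sym (negbTE xy) (negbTE yP).
    by rewrite addbF; case: (D _); case: (D _); case: (_ && _).
  have [|D' [? cr ?]] := IH E _ cD1; last by exists D'; split; rewrite // cr crD1.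
  apply: leq_trans (_ : #|M D| <= n); last by [].
  (* Three ones are cleared, and at most the entry [(a', b')] is created. *)
  pose S3 := [set (a, b); (a, b'); (a', b)].
  have s3 : S3 \subset M D.
    by apply/subsetP=> p; rewrite !inE => /orP[/orP[]|]/eqP->.
  have c3 : #|S3| = 3.
    by rewrite /S3 -setUA !cardsU1 !inE cards1 !xpair_eqE !eqxx (negbTE bb') (negbTE aa') //=.
  have sE : M E \subset (a', b') |: (M D :\: S3).
    apply/subsetP=> -[u v]; rewrite !inE /= mE !xpair_eqE.
    have h1 : (u == a) && (v == b) -> m D u v by case/andP=> /eqP-> /eqP->.
    have h2 : (u == a) && (v == b') -> m D u v by case/andP=> /eqP-> /eqP->.
    have h3 : (u == a') && (v == b) -> m D u v by case/andP=> /eqP-> /eqP->.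
    have n1 : ~~ ((u == a) && (u == a')).
      by apply: contra aa' => /andP[/eqP<- /eqP<-].
    have n2 : ~~ ((v == b) && (v == b')).
      by apply: contra bb' => /andP[/eqP<- /eqP<-].
    move: h1 h2 h3 n1 n2; case: (m D u v); case: (u == a); case: (u == a');
      by case: (v == b); case: (v == b') => //= h1 h2 h3; do ?[by case: h1|by case: h2|by case: h3].
  apply: leq_ltn_trans (subset_leq_card sE) _.
  apply: leq_ltn_trans (leq_card_setU _ _) _; rewrite cards1 cardsDS // c3.
  by have := subset_leq_card s3; rewrite c3; clear; lia.
rewrite negb_exists => /forallP N; exfalso.
(* Three ones in a 2 x 2 minor now put its fourth entry on the diagonal. Following rows and columns
   from [(a0, b0)] closes up on the indices [a0], [b0], [a1]. *)
have tight a a' b b' : m D a b -> m D a b' -> m D a' b -> a != a' -> b != b' -> a' = b'.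
  move=> h1 h2 h3 h4 h5; have := N ((a, a'), (b, b')).
  by rewrite /= h1 h2 h3 h4 h5 /= negbK => /eqP.
have [b1 b1b m1] := row _ _ m0; have [a1 a1a m2] := col _ _ m0.
have e1 : a1 = b1 by apply: (tight a0 a1 b0 b1) => //; rewrite eq_sym.
rewrite -{}e1 in b1b m1.
have [a2 a2a m3] := col _ _ m1.
have e2 : a2 = b0 by apply: (tight a0 a2 a1 b0) => //; rewrite eq_sym.
rewrite {}e2 in a2a m3.
have [b2 b2b m4] := row _ _ m2.
have e3 : a0 = b2 by apply: (tight a1 a0 b0 b2) => //; rewrite eq_sym.
rewrite -{}e3 in b2b m4.
have [ab aK bK gxa gyb] := msup _ _ m0.
have [ac _ cK _ gyc] := msup _ _ m1.
have [cb _ _ gxc _] := msup _ _ m2.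
have [_ _ _ gxb _] := msup _ _ m3.
have [_ _ _ _ gya] := msup _ _ m4.
by apply: (no3 a0 b0 a1) => //; rewrite /= !inE negb_or ab ac eq_sym cb.
Qed.

Definition glue x y : T -> T := fun z => if z == y then x else z.

(** [y] is merged into [x]; the vertex [y] itself disappears by passing to [U :\ y]. *)
Definition contract g x y : rel T := fun u v =>
  [&& u != v & [|| g u v, (u == x) && g y v | (v == x) && g u y]].

Lemma contract_glue g x y u v :
  g u v -> glue x y u != glue x y v -> contract g x y (glue x y u) (glue x y v).
Proof.
move=> guv ne; rewrite /contract ne /=; rewrite /glue in ne *.
move: guv ne; case: (u =P y) => [->|_]; case: (v =P y) => [->|_] guv ne.
- by rewrite eqxx in ne.
- by rewrite eqxx guv orbT.
- by rewrite eqxx guv !orbT.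
- by rewrite guv.
Qed.

Lemma glue_eq x y a b : glue x y a = glue x y b -> a != b ->
  (a = x /\ b = y) \/ (a = y /\ b = x).
Proof.
rewrite /glue; case: (a =P y) => [->|_]; case: (b =P y) => [->|_] //.
- by rewrite eqxx.
- by move=> -> _; right.
- by move=> -> _; left.
- by move=> ->; rewrite eqxx.
Qed.

Definition odd_pair_cycle g U := exists2 D, pair_cycle g U D & crossings (@rank_lt T) D.

Lemma contract_cycle g U D x y :
  symmetric g -> irreflexive g -> pair_cycle g U D -> x \in U -> x != y ->
  crossings (@rank_lt T) D -> (forall a b, symD D ((x, a), (y, b)) = false) ->
  odd_pair_cycle (contract g x y) (U :\ y).
Proof.
move=> gs gi [D1 D2 D3 D4] xU xy crD D0.
pose inl z (e : T * T) := (e.1 == z) || (e.2 == z).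
pose touch (q : quad T) := (inl x q.1 && inl y q.2) || (inl y q.1 && inl x q.2).
have touchF q : touch (flip q) = touch q by rewrite /touch orbC /= andbC [X in _ || X]andbC.
have touch1 q : touch (rev1 q) = touch q by rewrite /touch /inl /= ![(q.1.2 == _) || _]orbC.
have touch2 q : touch (rev2 q) = touch q by rewrite /touch /inl /= ![(q.2.2 == _) || _]orbC.
have Df1 q : D (flip (rev1 q)) = D (flip q) by rewrite -(D2 (flip q)).
have Df2 q : D (flip (rev2 q)) = D (flip q) by rewrite -(D1 (flip q)).
have symF q : symD D (flip q) = symD D q by rewrite /symD flip_inj addbC.
have sym1 q : symD D (rev1 q) = symD D q by rewrite /symD D1 Df1.
have sym2 q : symD D (rev2 q) = symD D q by rewrite /symD D2 Df2.
have touch0 q : touch q -> symD D q = false.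
  have half r : inl x r.1 && inl y r.2 -> symD D r = false.
    case: r => [[a b] [c d]]; rewrite /inl /=.
    case/andP=> /orP[] /eqP-> /orP[] /eqP->.
    - exact: D0.
    - by rewrite -sym2 D0.
    - by rewrite -sym1 D0.
    - by rewrite -sym1 -sym2 D0.
  by case/orP=> H; [exact: half|rewrite -symF; apply: half; rewrite andbC].
pose E q := D q && ~~ touch q.
have E1 q : E (rev1 q) = E q by rewrite /E D1 touch1.
have E2 q : E (rev2 q) = E q by rewrite /E D2 touch2.
have symE q : symD E q = symD D q.
  rewrite /symD /E touchF; case t: (touch q); last by rewrite /= !andbT.
  by rewrite !andbF -/(symD D q) touch0.
have cE : pair_cycle g U E.
  split=> //; first by move=> q /andP[/D3].
  by move=> a b c; rewrite -[RHS](D4 a b c); apply: eq_bigr => v _; rewrite symE.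
have [_ _ E3 E4] := cE.
have crE s : tournament s -> crossings s E = true.
  move=> ts; rewrite (crossings_tournament cE ts (@rank_tournament T)) -[RHS]crD.
  rewrite /crossings [RHS](eq_bigr (fun q : quad T => (rank_lt q.1.1 q.2.1 && E q) (+)
      (rank_lt q.1.1 q.2.1 && (D q && touch q)))); last first.
    by move=> q _; rewrite /E -andb_addr -andb_addr addNb addbb /= andbT.
  rewrite big_split /= [X in _ = _ (+) X](_ : _ = false) ?addbF //.
  apply: (crossings_sym0 (D := fun q => D q && touch q)); first exact: rank_tournament.
  - by move=> q; rewrite D1 touch1.
  - by move=> q; rewrite D2 touch2.
  - move=> q; rewrite touchF; case t: (touch q); rewrite ?andbF // !andbT.
    by have := touch0 q t; rewrite /symD; case: (D q); case: (D (flip q)).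
  - by move=> q /andP[/D3[]].
  - by move=> q /andP[/D3[_ _ _ + _] _]; apply: contraTneq => ->; rewrite gi.
pose phi := glue x y.
pose Phi (q : quad T) : quad T := ((phi q.1.1, phi q.1.2), (phi q.2.1, phi q.2.2)).
pose D' q' := \xor_(q | Phi q == q') E q.
have rev1K : involutive (@rev1 T) by move=> [[? ?] [? ?]].
have rev2K : involutive (@rev2 T) by move=> [[? ?] [? ?]].
have Phi1 q q' : (Phi (rev1 q) == q') = (Phi q == rev1 q').
  by case: q q' => [[? ?] [? ?]] [[? ?] [? ?]]; rewrite /Phi /rev1 /= !xpair_eqE /= (andbC (_ == _) (_ == _)).
have Phi2 q q' : (Phi (rev2 q) == q') = (Phi q == rev2 q').
  by case: q q' => [[? ?] [? ?]] [[? ?] [? ?]]; rewrite /Phi /rev2 /= !xpair_eqE /=; congr andb; rewrite andbC.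
have PhiF q q' : (Phi (flip q) == q') = (Phi q == flip q').
  by case: q q' => [[? ?] [? ?]] [[? ?] [? ?]]; rewrite /Phi /flip /= !xpair_eqE /= andbC.
exists D'; last first.
  (* The order of the contracted graph is pulled back, with [x] just before [y]; no surviving pair
     compares these two. *)
  pose s : rel T := fun u v => if (u == x) && (v == y) then true else
    if (u == y) && (v == x) then false else rank_lt (phi u) (phi v).
  have ts : tournament s.
    move=> u v; rewrite /s [(v == x) && _]andbC [(v == y) && _]andbC.
    have [/andP[/eqP-> /eqP->]|n1] := boolP ((u == x) && (v == y)).
      by rewrite ?[y == x]eq_sym ?(negbTE xy) /= ?xy.
    have [/andP[/eqP-> /eqP->]|n2] := boolP ((u == y) && (v == x)).
      by rewrite ?[y == x]eq_sym ?(negbTE xy) /= ?xy.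
    rewrite rank_tournament; have [->|uv] := eqVneq u v; first by rewrite eqxx.
    apply/eqP => /glue_eq/(_ uv).
    by case=> -[eu ev]; rewrite ?eu ?ev !eqxx in n1 n2.
  apply: (etrans _ (crE s ts)); rewrite /crossings -[RHS](pair_sum Phi) /=.
  apply: eq_bigr => q' _; rewrite /D' big_distrr /=.
  apply: eq_bigr => q /eqP<-; case Eq: (E q); last by rewrite !andbF.
  rewrite !andbT /= /s; have : ~~ touch q by case/andP: Eq.
  rewrite /touch /inl !negb_or !negb_and !negb_or.
  case: ifP => [/andP[/eqP-> /eqP->]|_]; first by rewrite !eqxx.
  by case: ifP => [/andP[/eqP-> /eqP->]|_]; first by rewrite !eqxx !andbF.
split.
- move=> q'; rewrite /D' (reindex_inj (can_inj rev1K)).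
  by apply: eq_big => [q|q _]; rewrite ?Phi1 ?rev1K ?E1.
- move=> q'; rewrite /D' (reindex_inj (can_inj rev2K)).
  by apply: eq_big => [q|q _]; rewrite ?Phi2 ?rev2K ?E2.
- move=> q' D'q'.
  (* A pair containing the edge [xy] and its reversal have the same image, so loops cancel. *)
  have loop1 : q'.1.1 != q'.1.2.
    apply: contraTneq D'q' => e; rewrite /D' (@xor_involution _ _ _ (@rev1 T)) //.
      by move=> q; rewrite Phi1; case: q' e => [[? ?] ?] /= ->.
    move=> q _ /E3[_ _ _ + _]; apply: contraTneq; case: q => [[? ?] ?] [-> _].
    by rewrite gi.
  have loop2 : q'.2.1 != q'.2.2.
    apply: contraTneq D'q' => e; rewrite /D' (@xor_involution _ _ _ (@rev2 T)) //.
      by move=> q; rewrite Phi2; case: q' e {loop1} => [[? ?] [? ?]] /= ->.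
    move=> q _ /E3[_ _ _ _ +]; apply: contraTneq; case: q => [? [? ?]] [-> _].
    by rewrite gi.
  have [q /eqP e Eq] := xor_ex D'q'; move: loop1 loop2; rewrite -e => /= loop1 loop2.
  have /andP[_ nt] := Eq; have [dj [u1 u2] [u3 u4] g1 g2] := E3 q Eq.
  have inU z : z \in U -> phi z \in U :\ y.
    rewrite /phi /glue !inE; case: (z =P y) => [_ _|/eqP-> ->] //.
    by rewrite xy.
  split; rewrite ?inU //; try exact: contract_glue.
  have h a b : (q.1.1 == a) || (q.1.2 == a) -> (q.2.1 == b) || (q.2.2 == b) -> a != b -> phi a != phi b.
    move=> ha hb ab; apply/eqP => /glue_eq/(_ ab)[][ea eb]; move: nt;
      by rewrite /touch /inl -ea -eb ha hb ?orbT.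
  move/and4P: dj => [d1 d2 d3 d4].
  by rewrite /disjq /= !h ?eqxx ?orbT.
- move=> a b c.
  have symD' q' : symD D' q' = \xor_(q | Phi q == q') symD E q.
    rewrite /symD big_split /= /D'; congr addb.
    rewrite (reindex_inj (can_inj (@flip_inj T))).
    by apply: eq_bigl => q; rewrite PhiF flip_inj.
  rewrite (eq_bigr (fun v => \xor_(q | [&& phi q.1.1 == a, phi q.1.2 == b & phi q.2.1 == c]
      && (phi q.2.2 == v)) symD E q)); last first.
    by move=> v _; rewrite symD'; apply: eq_bigl => q; rewrite /Phi !xpair_eqE -!andbA.
  rewrite (pair_sum (fun q => phi q.2.2)) -(pair_sum (fun q => (q.1.1, q.1.2, q.2.1))) big1 //.
  move=> [[a0 b0] c0] _.
  have [P0|P0] := boolP [&& phi a0 == a, phi b0 == b & phi c0 == c]; last first.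
    rewrite big1 // => q /andP[Pq]; rewrite !xpair_eqE => /andP[/andP[/eqP ea /eqP eb] /eqP ec].
    by rewrite ea eb ec (negbTE P0) in Pq.
  apply: etrans (E4 a0 b0 c0); rewrite quad_sum; apply: eq_bigl => q.
  rewrite !xpair_eqE -andbA; case/and3P: P0 => Pa Pb Pc.
  case: (q.1.1 =P a0) => [->|_]; case: (q.1.2 =P b0) => [->|_];
    by case: (q.2.1 =P c0) => [->|_]; rewrite ?Pa ?Pb ?Pc /= ?andbF.
Qed.

End Contraction.

(** * Three-connected graphs *)

Definition k5 : rel 'I_5 := fun i j => i != j.
Definition k33 : rel 'I_6 := fun i j => (i < 3) != (j < 3).

(** * Minors certified by computation *)

Section ListMinor.
Variable T : finType.
Implicit Types (g : rel T) (U : {set T}) (es : seq (nat * nat)) (Ms : seq {set T}).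

Definition linked_by es (i j : nat) := ((i, j) \in es) || ((j, i) \in es).

(* [l] lists a connected part of the graph with edge list [es], each item having a
   neighbour among the previous ones, starting from [acc]. *)
Fixpoint grows es (acc l : seq nat) :=
  if l is i :: l' then has (linked_by es i) acc && grows es (i :: acc) l' else true.

Definition minor_check n es (cl : seq (seq nat)) (h : nat -> nat -> bool) :=
  [&& uniq (flatten cl), all (fun i => i < n) (flatten cl),
    all (fun c => if c is i :: l then grows es [:: i] l else false) cl
    & all (fun i => all (fun j => h i j ==>
        has (fun a => has (linked_by es a) (nth [::] cl j)) (nth [::] cl i))
      (iota 0 (size cl))) (iota 0 (size cl))].

(** Reduces a minor to a finite computation: the sets [Ms] are the vertices of an abstract graph,
    [es] records known contacts between them, and [cl] gives the branch sets as lists of indices.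
    [hn] bounds [h] on natural numbers, so that the check evaluates. *)
Lemma list_minor g U Ms es cl k (h : rel 'I_k) (hn : nat -> nat -> bool) :
  symmetric g ->
  all (fun A : {set T} => (A \subset U) && conn g A) Ms ->
  pairwise (fun A B : {set T} => [disjoint A & B]) Ms ->
  all (fun e => adjS g (nth set0 Ms e.1) (nth set0 Ms e.2)) es ->
  size cl = k -> (forall i j : 'I_k, h i j -> hn i j) ->
  minor_check (size Ms) es cl hn -> minor h g U.
Proof.
move=> gs /(all_nthP set0) M1' /(pairwiseP set0) M2' /allP M3 sz hh /and4P[un lt gr ad].
have M1 i : i < size Ms -> nth set0 Ms i \subset U /\ conn g (nth set0 Ms i).
  by move/M1'/andP.
have M2 i j : i < j < size Ms -> [disjoint nth set0 Ms i & nth set0 Ms j].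
  by move/andP=> [ij jM]; apply: M2'; rewrite ?inE // (ltn_trans ij).
pose B (c : seq nat) := \bigcup_(i <- c) nth set0 Ms i.
have adjB i j : linked_by es i j -> adjS g (nth set0 Ms i) (nth set0 Ms j).
  by case/orP=> /M3 //=; rewrite adjS_sym.
have inB c i : i \in c -> nth set0 Ms i \subset B c.
  by move=> ic; rewrite /B (big_rem i) //= subsetUl.
have Bx c x : x \in B c -> exists2 i, i \in c & x \in nth set0 Ms i.
  rewrite /B; elim: c => [|i c IH]; first by rewrite big_nil inE.
  rewrite big_cons inE => /orP[xi|/IH[j jc xj]]; first by exists i; rewrite ?mem_head.
  by exists j; rewrite // inE jc orbT.
have grow acc l : conn g (B acc) -> all (fun i => i < size Ms) l -> grows es acc l ->
    conn g (B (rev l ++ acc)).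
  elim: l acc => [|i l IH] acc //= cacc /andP[iM lM] /andP[/hasP[j ja ij] gl].
  rewrite rev_cons cat_rcons; apply: IH => //; rewrite /B big_cons.
  apply: connU => //; first by case: (M1 i iM).
  exact: adjS_sub (subxx _) (inB _ _ ja) (adjB _ _ ij).
have Bperm c c' : c =i c' -> B c = B c'.
  by move=> e; apply/setP=> x; apply/idP/idP=> /Bx[i ic xi];
     apply: (subsetP (inB _ i _)) xi; rewrite ?e // -?e.
have clmem (i : 'I_k) : nth [::] cl i \in cl by rewrite mem_nth // sz.
have sub c i : c \in cl -> i \in c -> i < size Ms.
  by move=> ccl ic; apply: (allP lt); apply/flattenP; exists c.
exists (fun i : 'I_k => B (nth [::] cl i)); split.
- move=> i; split.
    apply/subsetP=> x /Bx[j ji xj]; have jM := sub _ _ (clmem i) ji.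
    by case: (M1 j jM) => /subsetP sj _; apply: sj.
  have := allP gr _ (clmem i); case e: (nth _ _ _) => [//|j l] gl.
  have all_lt z : z \in j :: l -> z < size Ms by move=> zl; apply: (sub (nth [::] cl i)); rewrite // e.
  rewrite (Bperm _ (rev l ++ [:: j])); last first.
    by move=> z; rewrite mem_cat mem_rev !inE orbC.
  apply: grow => //; last by apply/allP=> z zl; apply: all_lt; rewrite inE zl orbT.
  by rewrite /B big_seq1; case: (M1 j); rewrite ?all_lt ?mem_head.
- move=> i j ij; apply/disjointP=> x /Bx[a ai xa] /Bx[b bj xb].
  have ab : a != b.
    apply: contraNneq ij => ab; apply/eqP/val_inj => /=.
    have ip : i < size cl by rewrite sz. have jp : j < size cl by rewrite sz.
    rewrite -ab in bj; apply/eqP; rewrite -[_ == _]negbK; apply/negP=> nij.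
    move: un; rewrite -(cat_take_drop (maxn i j) cl) flatten_cat cat_uniq => /and3P[_ /hasP n _].
    apply: n; have mp : maxn i j < size cl by rewrite gtn_max ip.
    have mlt : minn i j < maxn i j by move: nij; clear; lia.
    exists a.
      apply/flattenP; exists (nth [::] cl (maxn i j)).
        by rewrite (drop_nth [::]) // mem_head.
      by rewrite /maxn; case: ifP.
    apply/flattenP; exists (nth [::] cl (minn i j)).
      by rewrite -(nth_take _ mlt) mem_nth // size_take mp.
    by rewrite /minn; case: ifP.
  have aM := sub _ _ (clmem i) ai; have bM := sub _ _ (clmem j) bj.
  move: ab; rewrite neq_ltn => /orP[l|l].
    by apply: (disjointP _ _ (M2 a b _) x) => //; rewrite l.
  by apply: (disjointP _ _ (M2 b a _) x) => //; rewrite l.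
- move=> i j hij.
  have ip : (i : nat) \in iota 0 (size cl) by rewrite mem_iota sz /= add0n.
  have jp : (j : nat) \in iota 0 (size cl) by rewrite mem_iota sz /= add0n.
  have := allP (allP ad _ ip) _ jp; rewrite (hh _ _ hij) /=.
  case/hasP=> a ai /hasP[b bj /adjB]; apply: adjS_sub; exact: inB.
Qed.

Definition hk5 (i j : nat) := i != j.
Definition hk33 (i j : nat) := (i < 3) != (j < 3).

End ListMinor.

Section Kuratowski.
Variable T : finType.
Implicit Types (g : rel T) (U : {set T}) (x y z u v : T).

Definition kconn k g U :=
  k < #|U| /\ forall S : {set T}, S \subset U -> #|S| < k -> conn g (U :\: S).

Lemma setD2 U x y : U :\: [set x; y] = U :\ x :\ y.
Proof. by rewrite setDDl. Qed.

Lemma setD1C U x y : U :\ x :\ y = U :\ y :\ x.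
Proof. by rewrite !setDDl setUC. Qed.

Lemma kconn_del2 g U x y : kconn 3 g U -> x \in U -> y \in U -> conn g (U :\ x :\ y).
Proof.
move=> [_ H] xU yU; rewrite -setD2; apply: H; first by rewrite subUset !sub1set xU.
by rewrite cards2; case: (_ != _).
Qed.

Lemma kconn_conn k g U : 0 < k -> kconn k g U -> conn g U.
Proof.
by move=> k0 [_ H]; rewrite -(setD0 U); apply: H; rewrite ?sub0set ?cards0.
Qed.

(* Tutte: a 3-connected graph other than K4 has an edge whose contraction leaves it
   3-connected. *)
Lemma contractible_edge g U : symmetric g -> irreflexive g -> kconn 3 g U -> 4 < #|U| ->
  exists x y, [/\ x \in U, y \in U, x != y, g x y &
    forall z, z \in U :\ x :\ y -> conn g (U :\ x :\ y :\ z)].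
Proof.
move=> gs gi k3 U5; apply: NNPP => no.
have bad x y : x \in U -> y \in U -> g x y ->
    exists2 z, z \in U :\ x :\ y & ~~ conn g (U :\ x :\ y :\ z).
  move=> xU yU gxy; apply: NNPP => nz; case: no; exists x, y; split=> //.
    by apply: contraTneq gxy => ->; rewrite gi.
  by move=> z zU; apply/negPn/negP=> nc; case: nz; exists z.
have cU := kconn_conn (isT : 0 < 3) k3.
have card3 a b c : 1 < #|U :\ a :\ b :\ c|.
  have := cardsD1 c (U :\ a :\ b); have := cardsD1 b (U :\ a); have := cardsD1 a U.
  by move: (a \in U) (b \in _) (c \in _) => [] [] []; move: U5; clear; lia.
(* Descent on the size of a component [C] behind a bad triple [x], [y], [z]: the edge from [z] to a
   vertex [v'] of [C] is bad as well, and its triple leaves a component inside [C :\ v']. *)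
suff main n : forall x y z v, x \in U -> y \in U -> g x y -> z \in U :\ x :\ y ->
    v \in U :\ x :\ y :\ z -> ~~ conn g (U :\ x :\ y :\ z) ->
    #|component g (U :\ x :\ y :\ z) v| < n -> False.
  have /set0Pn[x xU] := conn_neq0 cU.
  have /set0Pn[w wU] : U :\ x != set0.
    by rewrite -card_gt0; have := cardsD1 x U; rewrite xU; move: U5; clear; lia.
  move: wU; rewrite !inE => /andP[wx wU].
  have wx' : w \notin [set x] by rewrite inE.
  have [p [y [/setIP[_ /set1P->] /setDP[yU _] gxy _]]] :=
    joined_exit (conn_joined cU xU wU) (set11 x) wx'.
  have [z zU ncW] := bad x y xU yU gxy.
  have /set0Pn[v vW] : U :\ x :\ y :\ z != set0 by rewrite -card_gt0 (ltn_trans _ (card3 x y z)).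
  exact: (main _ x y z v).
elim: n => // n IH x y z v xU yU gxy zU.
set W := U :\ x :\ y :\ z => vW ncW; set C := component g W v => leC.
have mem2 a b c : c \in U :\ a :\ b -> [/\ c \in U, c != a & c != b].
  by rewrite !inE => /and3P[].
have [zU' zx zy] := mem2 _ _ _ zU.
have zS : [set z] \subset U :\ x :\ y by rewrite sub1set.
have z0 a : [set a] != set0 :> {set T} by apply/set0Pn; exists a; rewrite inE.
have /adjSP[v' [z' [v'C /set1P-> gv'z]]] := comp_adj (kconn_del2 k3 xU yU) zS (z0 z) vW.
have v'W := subsetP (comp_sub _ _ _) _ v'C.
have [v'U v'x v'y v'z] : [/\ v' \in U, v' != x, v' != y & v' != z].
  by move: v'W; rewrite !inE => /and4P[].
have gzv : g z v' by rewrite gs.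
have [w wU ncW'] := bad z v' zU' v'U gzv.
have [wU' wz wv] := mem2 _ _ _ wU.
set W' := U :\ z :\ v' :\ w in ncW'.
(* [x] and [y] are adjacent, hence meet at most one component; [d] lies in another. *)
have [d dW' [xd yd]] : exists2 d, d \in W' & x \notin component g W' d /\ y \notin component g W' d.
  have nxy r : r \in W' -> (forall c, c \in W' -> c \in [set x; y] -> joined g W' r c) ->
      exists2 d, d \in W' & x \notin component g W' d /\ y \notin component g W' d.
    move=> rW Hr; have [/existsP[d /andP[dW nrd]]|] := boolP [exists d, (d \in W') && ~~ joined g W' r d].
      exists d => //; split; rewrite inE; apply/negP=> /andP[cW jd]; case/negP: nrd;
        by apply: joined_trans (Hr _ cW _) _; rewrite ?inE ?eqxx ?orbT // joined_sym.
    rewrite negb_exists => /forallP N; case/negP: ncW'; apply: (conn_root gs rW) => c cW.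
    by have := N c; rewrite cW negbK.
  have [xW|xW] := boolP (x \in W').
    apply: (nxy x xW) => c cW; rewrite !inE => /orP[]/eqP e; first by rewrite e; apply: joined_refl.
    by apply: joined1; rewrite // e.
  have [yW|yW] := boolP (y \in W').
    apply: (nxy y yW) => c cW; rewrite !inE => /orP[]/eqP e; last by rewrite e; apply: joined_refl.
    by rewrite e (negbTE xW) in cW.
  have /set0Pn[d dW] : W' != set0 by rewrite -card_gt0 (ltn_trans _ (card3 z v' w)).
  by exists d => //; split; apply/negP=> /(subsetP (comp_sub _ _ _)); apply/negP.
set D := component g W' d in xd yd.
have DW' : D \subset W' by apply: comp_sub.
have DW : D \subset W.
  apply/subsetP=> c cD; have := subsetP DW' c cD; rewrite !inE => /and4P[_ _ -> ->].
  by rewrite andbT /=; apply/andP; split; [apply: contraNneq yd|apply: contraNneq xd] => <-.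
have cD : conn g D by apply: conn_comp.
have [u uD guv] : exists2 u, u \in D & g u v'.
  have E : W' = U :\ z :\ w :\ v' by rewrite /W' setD1C.
  have vS : [set v'] \subset U :\ z :\ w by rewrite sub1set !inE v'U v'z eq_sym wv.
  have dW2 : d \in U :\ z :\ w :\ v' by rewrite -E.
  have := comp_adj (kconn_del2 k3 zU' wU') vS (z0 v') dW2.
  by rewrite -E => /adjSP[u [c [uD /set1P-> guv]]]; exists u.
have uC : u \in C by apply: comp_closed v'C (subsetP DW _ uD) _; rewrite gs.
have DC : D \subset C.
  by rewrite /C -(comp_eq gs uC); apply: conn_sub_comp.
have v'D : v' \notin D by apply/negP=> /(subsetP DW'); rewrite !inE eqxx /= andbF.
apply: (IH z v' w d) => //.
apply: (@leq_ltn_trans #|C :\ v'|); first by apply: subset_leq_card; rewrite subsetD1 DC.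
by move: leC; rewrite (cardsD1 v' C) v'C add1n ltnS.
Qed.

Lemma contract_sym g x y : symmetric g -> symmetric (contract g x y).
Proof.
move=> gs u v; rewrite /contract eq_sym gs (gs y v) (gs u y); congr andb; congr orb.
by rewrite orbC.
Qed.

Lemma contract_irrefl g x y : irreflexive (contract g x y).
Proof. by move=> u; rewrite /contract eqxx. Qed.

Lemma minor_contract (I : finType) (h : rel I) g U x y : symmetric g -> g x y ->
  x \in U -> y \in U -> minor h (contract g x y) (U :\ y) -> minor h g U.
Proof.
move=> gs gxy xU yU.
pose M u := if u == x then [set x; y] else [set u].
have uM u : u \in M u by rewrite /M; case: eqP => [->|_]; rewrite !inE eqxx.
apply: (minor_model (M := M)) => //.
- move=> u; rewrite !inE => /andP[uy uU]; rewrite /M; case: eqP => _.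
    split; first by rewrite subUset !sub1set xU.
    by apply: connU (conn1 _ _) (conn1 _ _) _ => //; apply: adjS_intro gxy; rewrite inE.
  by split; [rewrite sub1set|apply: conn1].
- move=> u v; rewrite !inE => /andP[uy uU] /andP[vy vU] uv; rewrite /M.
  case: eqP => [ux|_]; case: eqP => [vx|_].
  + by rewrite ux vx eqxx in uv.
  + by rewrite disjointsU !disjoints1 !inE -ux uv eq_sym.
  + by rewrite disjoints1 !inE negb_or -vx uv uy.
  + by rewrite disjoints1 inE.
- move=> u v _ _ /andP[_ /or3P[guv|/andP[/eqP-> gyv]|/andP[/eqP-> guy]]].
  + exact: adjS_intro (uM u) (uM v) guv.
  + by apply: adjS_intro (uM v) gyv; rewrite /M eqxx !inE eqxx orbT.
  + by apply: adjS_intro (uM u) _ guy; rewrite /M eqxx !inE eqxx orbT.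
Qed.

Lemma conn_contract g W x y : conn g W -> conn (contract g x y) (glue x y @: W).
Proof.
move=> /connP[/set0Pn[w wW] H]; apply/connP; split.
  by apply/set0Pn; exists (glue x y w); apply: imset_f.
move=> _ _ /imsetP[u uW ->] /imsetP[v vW ->].
apply: joined_map (H u v uW vW) => a b /and3P[aW bW gab].
have [->|ne] := eqVneq (glue x y a) (glue x y b); first exact: connect0.
apply: joined1; rewrite ?imset_f //; exact: contract_glue.
Qed.

Lemma kconn_contract g U x y : kconn 3 g U -> 4 < #|U| -> x \in U -> y \in U -> x != y ->
  (forall z, z \in U :\ x :\ y -> conn g (U :\ x :\ y :\ z)) ->
  kconn 3 (contract g x y) (U :\ y).
Proof.
move=> k3 U5 xU yU xy good; split; first by have := cardsD1 y U; rewrite yU; move: U5; clear; lia.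
move=> S sS cS; have [yS SU] : y \notin S /\ S \subset U.
  by move: sS; rewrite subsetD1 => /andP[].
have glueN z : z != y -> glue x y z = z by rewrite /glue => /negbTE->.
have [xS|xS] := boolP (x \in S); last first.
  have -> : U :\ y :\: S = glue x y @: (U :\: S).
    apply/setP=> z; apply/idP/imsetP.
      by rewrite !inE => /and3P[zS zy zU]; exists z; rewrite ?inE ?zS // glueN.
    case=> w; rewrite inE => /andP[wS wU] ->; rewrite /glue; case: eqP => [_|/eqP wy].
      by rewrite !inE xS xy xU.
    by rewrite !inE wS wy wU.
  by apply: conn_contract; case: k3 => _; apply.
have -> : U :\ y :\: S = glue x y @: (U :\ y :\: S).
  apply/setP=> z; apply/idP/imsetP.
    by move=> zU; exists z => //; rewrite glueN //; move: zU; rewrite !inE => /and3P[].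
  by case=> w wU ->; rewrite glueN //; move: wU; rewrite !inE => /and3P[].
apply: conn_contract; have := cardsD1 x S; rewrite xS => cS'.
have Sx : S = x |: (S :\ x) by rewrite setD1K.
have [/eqP|] := posnP #|S :\ x|.
  rewrite cards_eq0 => /eqP S0; rewrite Sx S0 setU0 (setD1C U y x); exact: kconn_del2.
rewrite card_gt0 => /set0Pn[z zS].
have Sz : S = [set x; z].
  rewrite Sx; congr (_ |: _); apply/eqP; rewrite eq_sym eqEcard sub1set zS cards1.
  by move: cS cS'; clear; lia.
rewrite Sz setD2 (setD1C U y x); apply: good.
move: zS; rewrite !inE => /andP[zx zS]; rewrite zx (subsetP SU) // !andbT.
by apply: contraNneq yS => <-.
Qed.

(** The sides are [x], [B], [B'] and [y], [A], [A']; the square supplies the four contacts away from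
    [x] and [y]. *)
Lemma square_k33 g U x y a a' b b' : symmetric g -> x \in U -> y \in U -> x != y -> g x y ->
  g x a -> g x a' -> g y b -> g y b' -> square g (U :\ x :\ y) a b a' b' ->
  minor k33 g U.
Proof.
move=> gs xU yU xy gxy gxa gxa' gyb gyb'.
move=> [A [B [A' [B' [[sA sB sA' sB'] [cA cB cA' cB'] [aA bB a'A b'B]
  [dAB dAA' dAB' [dBA' dBB' dA'B']] [aAB aBA' aA'B' aAB']]]]]].
have sub (S : {set T}) : S \subset U :\ x :\ y -> [/\ S \subset U, x \notin S & y \notin S].
  by rewrite !subsetD1 => /andP[/andP[? ?] ?].
have [uA xA yA] := sub _ sA; have [uB xB yB] := sub _ sB.
have [uA' xA' yA'] := sub _ sA'; have [uB' xB' yB'] := sub _ sB'.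
apply: (@list_minor _ g U [:: [set x]; B; B'; [set y]; A; A']
  [:: (0,3); (0,4); (0,5); (1,3); (1,4); (1,5); (2,3); (2,4); (2,5)]
  [:: [:: 0]; [:: 1]; [:: 2]; [:: 3]; [:: 4]; [:: 5]] _ _ hk33) => //.
- by rewrite /= !sub1set xU yU uA uB uA' uB' cA cB cA' cB' !conn1.
- rewrite /= !disjoints1 !(disjoint_sym _ (mem [set y])) !disjoints1 dBB' dAA' xB xB' xA xA' yB yB' yA yA'.
  by rewrite inE xy dBA' !(disjoint_sym (mem B)) !(disjoint_sym (mem B')) dAB dAB' dA'B'.
- have e1 : adjS g [set x] [set y] by apply: adjS_intro gxy; rewrite inE.
  have e3 z (Z : {set T}) : g y z -> z \in Z -> adjS g Z [set y].
    by move=> gyz zZ; apply: adjS_intro zZ _ _; rewrite ?inE // gs.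
  by rewrite /= e1 (adjS_set1 gxa) // (adjS_set1 gxa') // (e3 _ _ gyb) // (e3 _ _ gyb') // (adjS_sym gs B A)
    aAB aBA' (adjS_sym gs B' A) aAB' (adjS_sym gs B' A') aA'B'.
Qed.

Lemma triangle_k5 g U x y a b c : symmetric g -> x \in U -> y \in U -> x != y -> g x y ->
  g x a -> g x b -> g x c -> g y a -> g y b -> g y c -> triangle g (U :\ x :\ y) a b c ->
  minor k5 g U.
Proof.
move=> gs xU yU xy gxy gxa gxb gxc gya gyb gyc.
move=> [A [B [C [[sA sB sC] [cA cB cC] [aA bB cC'] [dAB dAC dBC] [aAB aAC aBC]]]]].
have sub (S : {set T}) : S \subset U :\ x :\ y -> [/\ S \subset U, x \notin S & y \notin S].
  by rewrite !subsetD1 => /andP[/andP[? ?] ?].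
have [uA xA yA] := sub _ sA; have [uB xB yB] := sub _ sB; have [uC xC yC] := sub _ sC.
apply: (@list_minor _ g U [:: [set x]; [set y]; A; B; C]
  [:: (0,1); (0,2); (0,3); (0,4); (1,2); (1,3); (1,4); (2,3); (2,4); (3,4)]
  [:: [:: 0]; [:: 1]; [:: 2]; [:: 3]; [:: 4]] _ _ hk5) => //.
- by rewrite /= !sub1set xU yU uA uB uC cA cB cC !conn1.
- by rewrite /= !disjoints1 inE xy xA xB xC yA yB yC dAB dAC dBC.
- have e1 : adjS g [set x] [set y] by apply: adjS_intro gxy; rewrite inE.
  by rewrite /= e1 (adjS_set1 gxa) // (adjS_set1 gxb) // (adjS_set1 gxc) // (adjS_set1 gya) //
    (adjS_set1 gyb) // (adjS_set1 gyc) // aAB aAC aBC.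
Qed.

(* Hanani-Tutte in contrapositive form. *)
Theorem odd_cycle_minor g U : symmetric g -> irreflexive g -> kconn 3 g U ->
  odd_pair_cycle g U -> minor k5 g U \/ minor k33 g U.
Proof.
elim: {U}_.+1 {-2}U (ltnSn #|U|) g => // n IH U leU g gs gi k3 [D cD crD].
have [D1 D2 D3 D4] := cD.
(* A pair of disjoint edges fills four vertices, while evenness asks for a fifth. So [symD D]
   vanishes, [D] is symmetric and has no crossings mod 2. *)
have [U4|U5] := leqP #|U| 4.
  have sup q : symD D q -> [/\ disjq q, q.1.1 \in U /\ q.1.2 \in U, q.2.1 \in U /\ q.2.2 \in U,
        g q.1.1 q.1.2 & g q.2.1 q.2.2].
    rewrite /symD; case Dq: (D q) => /=; first by move=> _; apply: D3.
    move=> /D3; rewrite /disjq /= => -[/and4P[h1 h2 h3 h4] ? ? ? ?]; split=> //.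
    by rewrite ![_ == q.2.1]eq_sym ![_ == q.2.2]eq_sym; apply/and4P.
  have sym0 q : symD D q = false.
    apply/negP=> Dq; have [dj [x1 x2] [u1 u2] g1 g2] := sup q Dq.
    case: q => [[x y] [u v]] /= in Dq dj x1 x2 u1 u2 g1 g2.
    have [v' v'v Dv'] := xor_other (F := fun v => symD D ((x, y), (u, v))) (D4 x y u) Dq.
    have [dj' _ [_ u2'] _ g2'] := sup _ Dv'; rewrite /= in dj' u2' g2'.
    case/and4P: dj => /= xu xv yu yv; case/and4P: dj' => /= _ xv' _ yv'.
    have ne a b : g a b -> a != b by apply: contraTneq => ->; rewrite gi.
    have : #|[set x; y; u; v; v']| <= #|U|.
      by apply: subset_leq_card; rewrite !subUset !sub1set x1 x2 u1 u2 u2'.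
    rewrite -!setUA !cardsU1 !inE cards1 !negb_or (ne x y) // (ne u v) // (ne u v') //.
    by rewrite xu xv xv' yu yv yv' eq_sym v'v /=; move: U4; clear; lia.
  have : crossings (@rank_lt T) D = false.
    apply: crossings_sym0 => //; first exact: rank_tournament.
    - by move=> q; have := sym0 q; rewrite /symD; case: (D q); case: (D _).
    - by move=> q /D3[].
    - by move=> q /D3[_ _ _ + _]; apply: contraTneq => ->; rewrite gi.
  by rewrite crD.
have [x [y [xU yU xy gxy good]]] := contractible_edge gs gi k3 U5.
have cK := kconn_del2 k3 xU yU.
have xK : x \notin U :\ x :\ y by rewrite !inE eqxx andbF.
have [m33|n33] := classic (minor k33 g U); first by right.
have [m5|n5] := classic (minor k5 g U); first by left.
(* A square in place of a linkage gives K33; three common neighbours give K5, by a triangle rooted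
   at them in the 2-connected graph [U :\ x :\ y]. *)
have [] := @kill_matrix T g U D (@rank_lt T) x y gs gi cD xU yU xy.
- move=> a a' b b' un gxa gxa' gyb gyb' aK a'K bK b'K.
  case: (linked_or_square gs cK good xK un aK a'K bK b'K) => // sq.
  by case: n33; apply: square_k33 sq.
- move=> a b c un aK bK cK' gxa gxb gxc gya gyb gyc; apply: n5.
  by apply: (triangle_k5 gs xU yU xy gxy gxa gxb gxc gya gyb gyc); apply: triangle_2conn.
move=> D' [cD' crD' D'0]; rewrite -crD' in crD.
have od := contract_cycle gs gi cD' xU xy crD D'0.
have lt : #|U :\ y| < n by move: leU; rewrite (cardsD1 y U) yU add1n ltnS.
have [] := IH _ lt _ (contract_sym x y gs) (@contract_irrefl g x y) (kconn_contract k3 U5 xU yU xy good) od.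
  by move/(minor_contract gs gxy xU yU); left.
by move/(minor_contract gs gxy xU yU); right.
Qed.

End Kuratowski.

(** * Kempe colourings *)

Section Kempe.
Variables (T I : finType) (h : rel I).
Hypothesis hs : symmetric h.
Implicit Types (g : rel T) (U : {set T}) (c : T -> I) (f : I -> T) (x y : T).

Definition two_coloured U c i j := [set x in U | (c x == i) || (c x == j)].

(* An [H]-scheme in disguise: [c] sends a vertex to a common end of the edges whose
   paths contain it, so the path of [ij] becomes a Kempe chain in the colours [i], [j]. *)
Definition kempe g U c f :=
  (forall i, f i \in U /\ c (f i) = i) /\
  forall i j, h i j -> joined g (two_coloured U c i j) (f i) (f j).

Definition minor_below g U := forall g' U' c' f', symmetric g' -> irreflexive g' ->
  #|U'| < #|U| -> kempe g' U' c' f' -> minor h g' U'.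

Definition nb g U c x j := [set y in U | g x y && (c y == j)].

(** With at most one neighbour [w] of [x] in [S], replacing [x] by [w] turns walks into walks. *)
Lemma joined_avoid g S a b x : symmetric g -> joined g S a b -> a != x -> b != x ->
  #|[set y in S | g x y]| <= 1 -> joined g (S :\ x) a b.
Proof.
move=> gs J ax bx N1.
have [w Hw] : exists w, forall y, y \in S -> g x y -> y = w.
  have [/eqP|/card_gt0P[w wN]] := posnP #|[set y in S | g x y]|.
    rewrite cards_eq0 => /eqP N0; exists x => y yS gxy.
    by have := in_set0 y; rewrite -N0 inE yS gxy.
  exists w => y yS gxy; apply/eqP; rewrite -[_ == _]negbK; apply/negP=> yw.
  have : #|[set y; w]| <= 1.
    apply: leq_trans N1; apply: subset_leq_card; rewrite subUset !sub1set wN.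
    by rewrite inE yS gxy.
  by rewrite cards2 yw.
pose phi z := if z == x then w else z.
have -> : a = phi a by rewrite /phi (negbTE ax).
have -> : b = phi b by rewrite /phi (negbTE bx).
apply: joined_map J => u v /and3P[uS vS guv]; rewrite /phi.
case: eqP => [ux|/eqP ux]; case: eqP => [vx|/eqP vx].
- exact: connect0.
- by rewrite -(Hw v) -?ux // connect0.
- by rewrite -(Hw u) -?vx 1?gs // connect0.
- by apply: joined1; rewrite ?inE ?ux ?vx.
Qed.

Lemma kempe_contract g U c f x y : x \in U -> y \in U -> x != y -> c x = c y ->
  kempe g U c f -> kempe (contract g x y) (U :\ y) c (fun i => glue x y (f i)).
Proof.
move=> xU yU xy cxy [F K].
have cg z : c (glue x y z) = c z by rewrite /glue; case: eqP => // ->.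
have gU z : z \in U -> glue x y z \in U :\ y.
  by rewrite /glue; case: eqP => [_ _|/eqP zy zU]; rewrite !inE ?xy ?zy.
split=> [i|i j hij]; first by have [fU ci] := F i; rewrite gU // cg.
apply: joined_map (K i j hij) => u v /and3P[].
rewrite !inE => /andP[uU cu] /andP[vU cv] guv.
have [->|ne] := eqVneq (glue x y u) (glue x y v); first exact: connect0.
by apply: joined1 (contract_glue guv ne); rewrite inE cg gU.
Qed.

Section Minimal.
Variables (g : rel T) (U : {set T}).
Hypotheses (gs : symmetric g) (gi : irreflexive g).
Hypotheses (below : minor_below g U) (nominor : ~ minor h g U).

Lemma kempe_proper c f x y : kempe g U c f -> x \in U -> y \in U -> g x y -> c x != c y.
Proof.
move=> K xU yU gxy; apply/eqP=> cxy; apply: nominor.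
have xy : x != y by apply: contraTneq gxy => ->; rewrite gi.
apply: (minor_contract gs gxy xU yU).
apply: (below (contract_sym _ _ gs) (contract_irrefl _ _ _)) (kempe_contract xU yU xy cxy K).
by rewrite (cardsD1 y U) yU add1n ltnS.
Qed.

Lemma kempe_terminal c f i j : kempe g U c f -> h i j -> i != j -> 0 < #|nb g U c (f i) j|.
Proof.
move=> K hij ij; have [F J] := K; have [fiU ci] := F i; have [fjU cj] := F j.
have ne : f j \notin [set f i].
  by rewrite inE; apply: contraNneq ij => e; rewrite -ci -cj e.
have [p [q []]] := joined_exit (J i j hij) (set11 (f i)) ne.
rewrite !inE => /andP[_ /eqP->] /andP[qi /andP[qU cq]] gfq _.
apply/card_gt0P; exists q; rewrite inE qU gfq /=.
have := kempe_proper K fiU qU gfq; rewrite ci.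
by case/orP: cq => /eqP->; rewrite ?eqxx.
Qed.

Lemma kempe_chain_nbrs c f x i j : kempe g U c f -> x \in two_coloured U c i j -> h i j ->
  1 < #|[set y in two_coloured U c i j | g x y]| ->
  exists2 k, h (c x) k && (1 < #|nb g U c x k|) & (i = c x /\ j = k) \/ (i = k /\ j = c x).
Proof.
move=> K; rewrite inE => /andP[xU cx] hij; case/orP: cx => /eqP cx lt.
  exists j; last by left.
  rewrite cx hij /=; apply: leq_trans lt _; apply: subset_leq_card.
  apply/subsetP=> y; rewrite !inE => /andP[/andP[yU cy] gxy]; rewrite yU gxy.
  by have := kempe_proper K xU yU gxy; rewrite cx; case/orP: cy => /eqP-> //; rewrite eqxx.
exists i; last by right.
rewrite cx hs hij /=; apply: leq_trans lt _; apply: subset_leq_card.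
apply/subsetP=> y; rewrite !inE => /andP[/andP[yU cy] gxy]; rewrite yU gxy.
by have := kempe_proper K xU yU gxy; rewrite cx; case/orP: cy => /eqP-> //; rewrite eqxx.
Qed.

(** Suppose that among the colours adjacent to [c x] only [j0] occurs twice around [x]. Chains in
    which [x] has at most one neighbour can avoid [x], and all others through [x] use the colours
    [c x] and [j0], so [x] may be recoloured [j0]; this violates properness at a neighbour of colour
    [j0]. If no colour occurs twice, [x] may be deleted. *)
Lemma kempe_interior c f x : kempe g U c f -> x \in U -> x != f (c x) ->
  exists j k, [/\ j != k, h (c x) j, h (c x) k, 1 < #|nb g U c x j| & 1 < #|nb g U c x k|].
Proof.
move=> K xU xf; apply: NNPP => no; have [F J] := K.
have fx i : f i != x by apply: contraNneq xf => e; rewrite -e (F i).2.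
have avoid i j : h i j -> #|[set y in two_coloured U c i j | g x y]| <= 1 ->
    joined g (two_coloured U c i j :\ x) (f i) (f j).
  by move=> hij; apply: joined_avoid => //; apply: J.
have [/existsP[j0 /andP[hj0 lt0]]|] := boolP [exists j, h (c x) j && (1 < #|nb g U c x j|)].
  pose c' z := if z == x then j0 else c z.
  have K' : kempe g U c' f.
    split=> [i|i j hij]; first by have [? ?] := F i; rewrite /c' (negbTE (fx i)).
    have [le1|gt1] := leqP #|[set y in two_coloured U c i j | g x y]| 1.
      apply: joined_sub (avoid i j hij le1); apply/subsetP=> y.
      by rewrite !inE /c' => /andP[/negbTE->].
    have [xS|xS] := boolP (x \in two_coloured U c i j); last first.
      apply: joined_sub (J i j hij); apply/subsetP=> y yS; move: (yS); rewrite !inE /c'.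
      by have [e|_] := eqVneq y x; first by rewrite e (negbTE xS) in yS.
    have [k /andP[hk ltk] E] := kempe_chain_nbrs K xS hij gt1.
    have kj : k = j0.
      apply/eqP; rewrite -[_ == _]negbK; apply/negP=> kj; case: no.
      by exists k, j0; split.
    apply: joined_sub (J i j hij); apply/subsetP=> y; rewrite !inE /c'.
    have [_|_] := eqVneq y x; last by [].
    by case/andP=> -> _ /=; case: E => -[-> ->]; rewrite kj eqxx ?orbT.
  have /card_gt0P[y] := ltn_trans (isT : 0 < 1) lt0; rewrite inE => /and3P[yU gxy cy].
  have := kempe_proper K' xU yU gxy; rewrite /c' eqxx.
  have [yx|_] := eqVneq y x; first by rewrite yx gi in gxy.
  by rewrite eq_sym cy.
rewrite negb_exists => /forallP none.
have K' : kempe g (U :\ x) c f.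
  split=> [i|i j hij]; first by have [? ?] := F i; rewrite !inE fx.
  have -> : two_coloured (U :\ x) c i j = two_coloured U c i j :\ x.
    by apply/setP=> y; rewrite !inE andbA.
  have [le1|gt1] := leqP #|[set y in two_coloured U c i j | g x y]| 1; first exact: avoid.
  have [xS|xS] := boolP (x \in two_coloured U c i j); last first.
    apply: joined_sub (J i j hij); by rewrite subsetD1 xS subxx.
  have [k hk _] := kempe_chain_nbrs K xS hij gt1.
  by have := none k; rewrite hk.
apply: nominor; apply: (minor_sub (subsetDl U [set x])); apply: below K' => //.
by rewrite (cardsD1 x U) xU add1n ltnS.
Qed.

Lemma kempe_interior_degree c f x : kempe g U c f -> x \in U -> x != f (c x) ->
  3 < #|[set y in U | g x y && h (c x) (c y)]|.
Proof.
move=> K xU xf; have [j [k [jk hj hk j2 k2]]] := kempe_interior K xU xf.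
apply: (@leq_trans #|nb g U c x j :|: nb g U c x k|).
  rewrite cardsU (_ : _ :&: _ = set0) ?cards0 ?subn0; first by rewrite (leq_add j2 k2).
  apply/setP=> y; rewrite !inE; apply: contraNF jk.
  by move=> /andP[/and3P[_ _ /eqP<-] /and3P[_ _ /eqP<-]].
by apply: subset_leq_card; apply/subsetP=> y; rewrite !inE => /orP[]/and3P[-> -> /eqP->].
Qed.

End Minimal.
End Kempe.

(** * The odd pair cycle of a Kempe colouring for K5 *)

Section KempeOdd.
Variable T : finType.
Implicit Types (g : rel T) (U : {set T}) (s : rel T).

(** Inner vertices drop out by the boundary conditions. What remains is the parity with which the
    ends [a], [b] and [a'], [b'] interleave. *)
Lemma crossings_prodD (C C' : rel T) s a b a' b' :
  (forall u, \xor_v C u v = (u == a) (+) (u == b)) ->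
  (forall u, \xor_v C' u v = (u == a') (+) (u == b')) ->
  crossings s (prodD C C') = (s a a' (+) s a b') (+) (s b a' (+) s b b').
Proof.
move=> C0 C'0; rewrite /crossings -(pair_sum (fun q => (q.1.1, q.1.2, q.2.1))) /=.
rewrite (eq_bigr (fun p : T * T * T =>
  C p.1.1 p.1.2 && (s p.1.1 p.2 && ((p.2 == a') (+) (p.2 == b'))))); last first.
  move=> [[x y] u] _ /=.
  rewrite (eq_bigl (fun q : quad T => [&& q.1.1 == x, q.1.2 == y & q.2.1 == u])); last first.
    by move=> q; rewrite !xpair_eqE andbA.
  rewrite -(quad_sum (fun q => s q.1.1 q.2.1 && prodD C C' q)) /prodD /= -!big_distrr /= C'0.
  by rewrite andbCA.
rewrite -(pair_bigA _ (fun (p : T * T) u => C p.1 p.2 && (s p.1 u && ((u == a') (+) (u == b'))))) /=.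
rewrite (eq_bigr (fun p : T * T => C p.1 p.2 && (s p.1 a' (+) s p.1 b'))); last first.
  move=> p _; rewrite -big_distrr /=; congr andb.
  rewrite (eq_bigr (fun u => ((u == a') && s p.1 u) (+) ((u == b') && s p.1 u))); last first.
    by move=> u _; rewrite andb_addr ![_ && s p.1 u]andbC.
  by rewrite big_split /= !xor_pred1.
rewrite -(pair_bigA _ (fun x y => C x y && (s x a' (+) s x b'))) /=.
rewrite (eq_bigr (fun x => ((x == a) && (s x a' (+) s x b')) (+) ((x == b) && (s x a' (+) s x b')))).
  by rewrite big_split /= !xor_pred1.
by move=> x _; rewrite -big_distrl /= C0 andb_addl.
Qed.

Definition o5 (i : nat) : 'I_5 := inord i.
(* The 15 pairs of disjoint edges of K5, each in one of its two orders. *)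
Definition k5_pairs : seq (('I_5 * 'I_5) * ('I_5 * 'I_5)) :=
  [seq ((o5 e.1.1, o5 e.1.2), (o5 e.2.1, o5 e.2.2)) | e <-
  [:: ((0,1),(2,3)); ((0,1),(2,4)); ((0,1),(3,4)); ((0,2),(1,3)); ((0,2),(1,4));
      ((0,2),(3,4)); ((0,3),(1,2)); ((0,3),(1,4)); ((0,3),(2,4)); ((0,4),(1,2));
      ((0,4),(1,3)); ((0,4),(2,3)); ((1,2),(3,4)); ((1,3),(2,4)); ((1,4),(2,3))]].

(** Puts sums mod 2 in the form that [ring] understands. *)
Lemma addbE a b : a (+) b = xorb a b.
Proof. by case: a; case: b. Qed.

(** Any four of the five terminals carry three pairs of disjoint edges, exactly one of which
    interleaves on a circle: five crossings, an odd number. The sum is a cycle because the three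
    edges of K5 disjoint from a given one form a triangle, so the boundaries of their chains
    cancel. *)
Lemma kempe_k5_odd g U (c : T -> 'I_5) f : symmetric g -> kempe k5 g U c f ->
  odd_pair_cycle g U.
Proof.
move=> gs [F J].
have H : forall e : 'I_5 * 'I_5, exists p : rel T, e.1 != e.2 ->
    [/\ symmetric p, forall u v, p u v ->
        [/\ u \in two_coloured U c e.1 e.2, v \in two_coloured U c e.1 e.2 & g u v]
      & forall u, \xor_v p u v = (u == f e.1) (+) (u == f e.2)].
  move=> [i j] /=; have [->|ij] := eqVneq i j; first by exists (fun _ _ => false).
  by have [p Hp] := chain_of_joined gs (J i j ij); exists p.
have [P HP] := fin_all_exists H.
pose D q := \big[addb/false]_(e <- k5_pairs) prodD (P e.1) (P e.2) q.
have dist e : e \in k5_pairs -> [/\ e.1.1 != e.1.2, e.2.1 != e.2.2,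
    (e.1.1 != e.2.1) && (e.1.1 != e.2.2) & (e.1.2 != e.2.1) && (e.1.2 != e.2.2)].
  have : all (fun e : ('I_5 * 'I_5) * ('I_5 * 'I_5) => [&& e.1.1 != e.1.2, e.2.1 != e.2.2,
    (e.1.1 != e.2.1) && (e.1.1 != e.2.2) & (e.1.2 != e.2.1) && (e.1.2 != e.2.2)]) k5_pairs.
    have oE i j : i < 5 -> j < 5 -> (o5 i == o5 j) = (i == j).
      by move=> i5 j5; rewrite -(inj_eq val_inj) /= !inordK.
    by rewrite /k5_pairs /= !oE.
  by move/allP=> H' /H' /and4P.
have P1 e : e \in k5_pairs -> [/\ symmetric (P e.1), forall u v, P e.1 u v ->
        [/\ u \in two_coloured U c e.1.1 e.1.2, v \in two_coloured U c e.1.1 e.1.2 & g u v]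
      & forall u, \xor_v P e.1 u v = (u == f e.1.1) (+) (u == f e.1.2)].
  by case/dist=> d1 _ _ _; apply: HP.
have P2 e : e \in k5_pairs -> [/\ symmetric (P e.2), forall u v, P e.2 u v ->
        [/\ u \in two_coloured U c e.2.1 e.2.2, v \in two_coloured U c e.2.1 e.2.2 & g u v]
      & forall u, \xor_v P e.2 u v = (u == f e.2.1) (+) (u == f e.2.2)].
  by case/dist=> _ d2 _ _; apply: HP.
exists D; last first.
  have -> : crossings (@rank_lt T) D =
      \big[addb/false]_(e <- k5_pairs) crossings (@rank_lt T) (prodD (P e.1) (P e.2)).
    rewrite /crossings exchange_big /=; apply: eq_bigr => q _.
    by rewrite /D big_distrr.
  pose s i j := rank_lt (f (o5 i)) (f (o5 j)).
  have sN i j : i < j < 5 -> s j i = true (+) s i j.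
    move=> /andP[ij j5]; have i5 := ltn_trans ij j5; have := rank_tournament (f (o5 i)) (f (o5 j)).
    rewrite -/(s i j) -/(s j i).
    have -> : f (o5 i) != f (o5 j).
      apply: contraTneq ij => e; have : o5 i = o5 j by rewrite -[LHS](F _).2 -[RHS](F _).2 e.
      move/(congr1 val); rewrite /= !inordK //.
      by move->; rewrite ltnn.
    by case: (s i j); case: (s j i).
  rewrite (eq_big_seq (fun e : ('I_5 * 'I_5) * ('I_5 * 'I_5) =>
    (rank_lt (f e.1.1) (f e.2.1) (+) rank_lt (f e.1.1) (f e.2.2)) (+)
    (rank_lt (f e.1.2) (f e.2.1) (+) rank_lt (f e.1.2) (f e.2.2)))); last first.
    by move=> e ek; apply: crossings_prodD; [case: (P1 e ek)|case: (P2 e ek)].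
  rewrite /k5_pairs big_map !big_cons big_nil /= -![rank_lt (f (o5 _)) (f (o5 _))]/(s _ _).
  rewrite (sN 1 2) // (sN 1 3) // (sN 1 4) // (sN 2 3) // (sN 2 4) // (sN 3 4) //.
  rewrite /is_true !addbE.
  move: (s 0 1) (s 0 2) (s 0 3) (s 0 4) (s 1 2) (s 1 3) (s 1 4) (s 2 3) (s 2 4) (s 3 4) => *.
  ring.
split.
- move=> q; apply: eq_big_seq => e /P1[Ps _ _]; by rewrite /prodD /= Ps.
- move=> q; apply: eq_big_seq => e /P2[Ps _ _]; by rewrite /prodD /= Ps.
- move=> q Dq.
  have [e ek pe] : exists2 e, e \in k5_pairs & prodD (P e.1) (P e.2) q.
    apply/hasP; apply: contraTT Dq => /hasPn N; rewrite /D big1_seq // => e /andP[_ ek].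
    exact/negbTE/N.
  case/andP: pe => pe1 pe2.
  have [_ H1 _] := P1 e ek; have [_ H2 _] := P2 e ek.
  have [a1 a2 g1] := H1 _ _ pe1; have [b1 b2 g2] := H2 _ _ pe2.
  have [_ _ /andP[d1 d2] /andP[d3 d4]] := dist e ek.
  (* The chains of disjoint edges use disjoint pairs of colours. *)
  have ne a b : a \in two_coloured U c e.1.1 e.1.2 -> b \in two_coloured U c e.2.1 e.2.2 -> a != b.
    rewrite !inE => /andP[_ ca] /andP[_ cb]; apply: contraTneq ca => ->.
    by case/orP: cb => /eqP->; rewrite negb_or ![_ == e.1.1]eq_sym ![_ == e.1.2]eq_sym ?d1 ?d2 ?d3 ?d4.
  have inU a i j : a \in two_coloured U c i j -> a \in U by rewrite inE => /andP[].
  split=> //; first by apply/and4P; split; apply: ne.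
    by split; [apply: inU a1|apply: inU a2].
  by split; [apply: inU b1|apply: inU b2].
- move=> x y u; pose t i := u == f i; pose w i j := P (o5 i, o5 j) x y.
  have -> : \xor_v symD D ((x, y), (u, v)) = \big[addb/false]_(e <- k5_pairs)
      ((P e.1 x y && (t e.2.1 (+) t e.2.2)) (+) ((t e.1.1 (+) t e.1.2) && P e.2 x y)).
    rewrite /symD /D; under eq_bigr do rewrite -big_split /=.
    rewrite exchange_big /=; apply: eq_big_seq => e ek.
    have [_ _ b1] := P1 e ek; have [_ _ b2] := P2 e ek.
    by rewrite /prodD /= big_split /= -big_distrr -big_distrl /= b1 b2.
  rewrite /k5_pairs big_map !big_cons big_nil /= -![P (o5 _, o5 _) x y]/(w _ _).
  rewrite !addbE.
  move: (t (o5 0)) (t (o5 1)) (t (o5 2)) (t (o5 3)) (t (o5 4)) => *.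
  move: (w 0 1) (w 0 2) (w 0 3) (w 0 4) (w 1 2) (w 1 3) (w 1 4) (w 2 3) (w 2 4) (w 3 4) => *.
  ring.
Qed.

End KempeOdd.

(** * Small separators *)

Section Torso.
Variable T : finType.
Implicit Types (g : rel T) (S U W Z : {set T}) (u v x y z : T).

Definition torso g S : rel T :=
  fun u v => (u != v) && (g u v || (u \in S) && (v \in S)).

Definition nbrs g U x := [set y in U | g x y].

Lemma torso_sym g S : symmetric g -> symmetric (torso g S).
Proof. by move=> gs u v; rewrite /torso eq_sym gs [(v \in S) && _]andbC. Qed.

Lemma torso_irrefl g S : irreflexive (torso g S).
Proof. by move=> u; rewrite /torso eqxx. Qed.

(** Deleting only [S :\ s] keeps the graph connected, so the component must attach to [s]. *)
Lemma separator_adj g U S s z : kconn #|S| g U -> S \subset U -> s \in S ->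
  z \in U :\: S -> adjS g (component g (U :\: S) z) [set s].
Proof.
move=> [_ k] sS sS' zU.
have E : U :\: S = (U :\: (S :\ s)) :\ s by rewrite setDDl setUC setD1K.
have cU : conn g (U :\: (S :\ s)).
  apply: k; first by apply: subset_trans sS; apply: subsetDl.
  by rewrite [X in _ < X](cardsD1 s) sS'.
rewrite E; apply: comp_adj => //; last by rewrite -E.
  by rewrite sub1set !inE eqxx (subsetP sS).
by apply/set0Pn; exists s; rewrite inE.
Qed.

(** A vertex [c] separating the roots in [Z :|: S] is impossible. It is not in [S], since [Z] joins
    the two other roots; it is not all of [Z], by the degree condition; and from another vertex [w]
    of [Z], 3-connectedness reaches two different roots off [c]. *)
Lemma separator_triangle g U S z s1 s2 s3 : symmetric g -> irreflexive g -> kconn 3 g U ->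
  (forall x, x \in U -> 3 < #|nbrs g U x|) -> S \subset U -> uniq [:: s1; s2; s3] ->
  S = [set s1; s2; s3] -> z \in U :\: S ->
  triangle g (component g (U :\: S) z :|: S) s1 s2 s3.
Proof.
move=> gs gi k3 deg sS un ES zU; set Z := component g _ z.
have cardS : #|S| = 3.
  move: un; rewrite ES -setUA !cardsU1 !inE cards1 /= !inE andbT negb_or.
  by case/andP=> /andP[/negbTE-> /negbTE->] /negbTE->.
have adjZ s : s \in S -> adjS g Z [set s] by move=> sS'; apply: separator_adj; rewrite ?cardS.
have cZ : conn g Z by apply: conn_comp.
have ZU : Z \subset U :\: S by apply: comp_sub.
have ZS s : s \in S -> s \notin Z by move=> sS'; apply/negP=> /(subsetP ZU); rewrite inE sS'.
have closed p q : p \in Z -> q \in U -> g p q -> q \in Z :|: S.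
  move=> pZ qU gpq; rewrite inE; case: (boolP (q \in S)) => qS; first by rewrite orbT.
  by rewrite (comp_closed pZ _ gpq) // inE qS.
have S1 : s1 \in S by rewrite ES !inE eqxx.
have S2 : s2 \in S by rewrite ES !inE eqxx orbT.
have S3 : s3 \in S by rewrite ES !inE eqxx orbT.
have inZS s : s \in S -> s \in Z :|: S by move=> sS'; rewrite inE sS' orbT.
have cZS : conn g (Z :|: S).
  have zZ : z \in Z by apply: comp_self.
  apply: (@conn_root _ _ gs _ z); first by rewrite inE zZ.
  have JZ x : x \in Z -> joined g (Z :|: S) z x.
    by move=> xZ; apply: joined_sub (subsetUl Z S) _; apply: conn_joined zZ xZ.
  move=> x /setUP[/JZ//|xS]; have /adjSP[p [x' [pZ /set1P-> gpx]]] := adjZ x xS.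
  by apply: joined_trans (JZ _ pZ) _; apply: joined1; rewrite // inE ?pZ ?xS ?orbT.
case: (rooted_triangle gs cZS un (inZS _ S1) (inZS _ S2) (inZS _ S3)) => // -[c cZ' [s12 s13 s23]].
exfalso.
have sep p q : p \in S -> q \in S -> p != q -> separates g (Z :|: S) c p q.
  have mem r : r \in S -> [|| r == s1, r == s2 | r == s3] by rewrite ES !inE orbA.
  move=> /mem/or3P[]/eqP-> /mem/or3P[]/eqP->; rewrite ?eqxx // => _ //; exact: separates_sym.
have cZc : c \in Z.
  apply: contraT => ncZ; have cS : c \in S by move: cZ'; rewrite inE (negbTE ncZ).
  have [p [q [pS qS pq pc qc]]] : exists p q, [/\ p \in S, q \in S, p != q, p != c & q != c].
    move: un cS; rewrite /= !inE negb_or !andbT => /andP[/andP[n12 n13] n23].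
    rewrite {1}ES !inE -orbA => /or3P[]/eqP->.
    - by exists s2, s3; rewrite ![_ == s1]eq_sym.
    - by exists s1, s3; rewrite [s3 == s2]eq_sym.
    - by exists s1, s2.
  have /adjSP[a [p' [aZ /set1P-> gap]]] := adjZ p pS.
  have /adjSP[b [q' [bZ /set1P-> gbq]]] := adjZ q qS.
  have sub : Z \subset (Z :|: S) :\ c by rewrite subsetD1 ncZ subsetUl.
  have inS r : r \in S -> r != c -> r \in (Z :|: S) :\ c.
    by move=> rS rc; rewrite in_setD1 in_setU rc rS orbT.
  case/negP: (sep p q pS qS pq pc qc).
  apply: (@joined_trans _ _ _ a).
    by apply: joined1; [exact: inS|exact: (subsetP sub)|rewrite gs].
  apply: (@joined_trans _ _ _ b); first by apply: joined_sub sub _; apply: conn_joined.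
  by apply: joined1; [exact: (subsetP sub)|exact: inS|].
have [/existsP[w /andP[wZ wc]]|] := boolP [exists w, (w \in Z) && (w != c)]; last first.
  rewrite negb_exists => /forallP N.
  have := deg c (subsetP (subsetDl _ _) _ (subsetP ZU _ cZc)).
  rewrite ltnNge -cardS => /negP; apply; apply: subset_leq_card.
  apply/subsetP=> y; rewrite inE => /andP[yU gcy].
  have := closed c y cZc yU gcy; rewrite inE => /orP[yZ|//].
  by have := N y; rewrite yZ /= negbK => /eqP yc; rewrite yc gi in gcy.
have reach s : s \in S -> exists2 q, q \in S & q != s /\ joined g ((Z :|: S) :\ c) w q.
  move=> sS'.
  have [t tS ts] : exists2 t, t \in S & t != s.
    have [->|ss1] := eqVneq s s1; last by exists s1; rewrite // eq_sym.
    by exists s2 => //; move: un; rewrite /= !inE negb_or eq_sym => /andP[/andP[]].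
  have sU := subsetP sS _ sS'.
  have cc : conn g (U :\: [set c; s]).
    case: k3 => _; apply; last by rewrite cards2; case: (_ != _).
    by rewrite subUset !sub1set sU (subsetP (subsetDl _ _) _ (subsetP ZU _ cZc)).
  have nZ x : x \in S -> x \notin Z :\ c by move=> xS; rewrite in_setD1 negb_and ZS ?orbT.
  have wU : w \in U :\: [set c; s].
    rewrite in_setD in_set2 negb_or wc (subsetP (subsetDl _ _) _ (subsetP ZU _ wZ)) andbT /=.
    by apply: contraTneq wZ => ->; apply: ZS.
  have tU : t \in U :\: [set c; s].
    rewrite !inE negb_or ts (subsetP sS) // !andbT.
    by apply: contraTneq cZc => <-; apply: ZS.
  have wZc : w \in Z :\ c by rewrite in_setD1 wc.
  have [p [q [/setIP[_ pZ] /setDP[qU qZ] gpq J]]] :=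
    joined_exit (conn_joined cc wU tU) wZc (nZ t tS).
  have pZ' := subsetP (subsetDl _ _) _ pZ.
  move: qU; rewrite !inE negb_or => /andP[/andP[qc qs] qU].
  have qS : q \in S.
    have := closed p q pZ' qU gpq; rewrite inE => /orP[qZ'|//].
    by rewrite in_setD1 qc qZ' in qZ.
  exists q => //; split=> //; apply: (@joined_trans _ _ _ p).
    apply: joined_sub J; apply/subsetP=> x; rewrite in_setI => /andP[_].
    by rewrite !in_setD1 in_setU => /andP[-> ->].
  apply: joined1 => //; rewrite in_setD1 in_setU ?qc ?qS ?orbT //.
  by move: pZ; rewrite in_setD1 => /andP[-> ->].
have [q1 q1S [_ J1]] := reach s1 S1.
have [q2 q2S [q21 J2]] := reach q1 q1S.
have nc q : q \in S -> q != c by move=> qS; apply: contraTneq cZc => <-; apply: ZS.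
case/negP: (sep q2 q1 q2S q1S q21 (nc _ q2S) (nc _ q1S)).
by apply: joined_trans J1; rewrite joined_sym.
Qed.

(** The component behind [S] realizes the clique on [S]: by a rooted triangle if [S] has three
    vertices, by being absorbed into one of them if it has two. *)
Lemma torso_minor (I : finType) (h : rel I) g U S z : symmetric g -> irreflexive g ->
  kconn #|S| g U ->
  #|S| <= 3 -> (forall x, x \in U -> 3 < #|nbrs g U x|) -> S \subset U -> z \in U :\: S ->
  minor h (torso g S) (U :\: component g (U :\: S) z) -> minor h g U.
Proof.
move=> gs gi kS S3 deg sS zU; set Z := component g _ z.
have ZU : Z \subset U :\: S by apply: comp_sub.
have cZ : conn g Z by apply: conn_comp.
have ZS s : s \in S -> s \notin Z by move=> sS'; apply/negP=> /(subsetP ZU); rewrite inE sS'.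
have ZU' : Z \subset U by apply: subset_trans ZU _; apply: subsetDl.
suff [C [C1 C2 C3 C4]] : exists C : T -> {set T}, [/\ forall s, s \in S -> s \in C s,
    forall s, s \in S -> C s \subset Z :|: S /\ conn g (C s),
    {in S &, forall s t, s != t -> [disjoint C s & C t]}
    & {in S &, forall s t, s != t -> adjS g (C s) (C t)}].
  apply: (minor_model (M := fun u => if u \in S then C u else [set u])) => //.
  - move=> u; rewrite in_setD => /andP[uZ uU]; case: ifP => uS.
      by have [sC cC] := C2 u uS; split=> //; apply: (subset_trans sC); rewrite subUset ZU' sS.
    by rewrite sub1set; split=> //; apply: conn1.
  - have out u s : u \notin Z -> u \notin S -> s \in S -> u \notin C s.
      move=> uZ uS sS'; apply/negP=> /(subsetP (C2 s sS').1).
      by rewrite inE (negbTE uZ) (negbTE uS).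
    move=> u v; rewrite !in_setD => /andP[uZ uU] /andP[vZ vU] uv.
    case: ifP => uS; case: ifP => vS.
    + exact: C3.
    + by rewrite disjoint_sym disjoints1; apply: out; rewrite ?vS.
    + by rewrite disjoints1; apply: out; rewrite ?uS.
    + by rewrite disjoints1 inE.
  - move=> u v _ _ /andP[uv /orP[guv|/andP[uS vS]]].
      by apply: adjS_intro guv; case: ifP => // *; rewrite ?C1 ?inE.
    by rewrite uS vS C4.
move: S3; rewrite leq_eqVlt => /orP[/eqP S3|S3].
  have [s1 [s2 [s3 [un ES]]]] : exists s1 s2 s3, uniq [:: s1; s2; s3] /\ S = [set s1; s2; s3].
    have /card_gt0P[s1 s1S] : 0 < #|S| by rewrite S3.
    have /cards2P[s2 [s3 [n23 E]]] : #|S :\ s1| == 2.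
      by have := cardsD1 s1 S; rewrite S3 s1S add1n => -[<-].
    exists s1, s2, s3; split; last by rewrite -setUA -E setD1K.
    have : s2 \in S :\ s1 by rewrite E !inE eqxx.
    have : s3 \in S :\ s1 by rewrite E !inE eqxx orbT.
    by rewrite /= !inE negb_or !(eq_sym s1) n23 => /andP[-> _] /andP[-> _].
  rewrite S3 in kS.
  have [C1 [C2 [C3 [[u1 u2 u3] [c1 c2 c3] [m1 m2 m3] [d12 d13 d23] [a12 a13 a23]]]]] :=
    separator_triangle gs gi kS deg sS un ES zU.
  move: un; rewrite /= !inE negb_or !andbT => /andP[/andP[n12 n13] n23].
  exists (fun s => if s == s1 then C1 else if s == s2 then C2 else C3).
  have E1 : s2 == s1 = false by rewrite eq_sym (negbTE n12).
  have E2 : s3 == s1 = false by rewrite eq_sym (negbTE n13).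
  have E3 : s3 == s2 = false by rewrite eq_sym (negbTE n23).
  have mem s : s \in S -> [\/ s = s1, s = s2 | s = s3].
    by rewrite ES !inE -orbA => /or3P[]/eqP->; [constructor 1|constructor 2|constructor 3].
  split.
  - by move=> s /mem[]->; rewrite ?eqxx ?E1 ?E2 ?E3.
  - by move=> s /mem[]->; rewrite ?eqxx ?E1 ?E2 ?E3.
  - by move=> s t /mem[]-> /mem[]->; rewrite ?eqxx ?E1 ?E2 ?E3 // disjoint_sym.
  - by move=> s t /mem[]-> /mem[]->; rewrite ?eqxx ?E1 ?E2 ?E3 // adjS_sym.
have [S1|S2] := leqP #|S| 1.
  exists (fun s => [set s]); split.
  - by move=> s; rewrite inE.
  - by move=> s sS'; rewrite sub1set inE sS' orbT; split=> //; apply: conn1.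
  - by move=> s t _ _ st; rewrite disjoints1 inE.
  - move=> s t sS' tS st; have := S1; rewrite leqNgt => /negP[].
    by rewrite (cardsD1 s) sS' (cardsD1 t) !inE eq_sym st tS.
have /cards2P[s [t [st ES]]] : #|S| == 2 by rewrite eqn_leq S2 -ltnS S3.
have sS' : s \in S by rewrite ES !inE eqxx.
have tS' : t \in S by rewrite ES !inE eqxx orbT.
have ts : (t == s) = false by rewrite eq_sym (negbTE st).
have /adjSP[p [p' [pZ /set1P-> gp]]] := separator_adj kS sS sS' zU.
have at' := separator_adj kS sS tS' zU.
have cs : conn g (s |: Z) by apply: (conn_setU1 gs cZ pZ); rewrite gs.
have mem r : r \in S -> r = s \/ r = t.
  by rewrite ES !inE => /orP[]/eqP->; auto.
exists (fun r => if r == s then s |: Z else [set r]); split.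
- by move=> r /mem[]->; rewrite ?eqxx ?ts ?inE ?eqxx.
- move=> r /mem[]->; rewrite ?eqxx ?ts.
    by rewrite subUset sub1set inE sS' orbT subsetUl.
  by rewrite sub1set inE tS' orbT; split=> //; apply: conn1.
- have d : [disjoint s |: Z & [set t]].
    by rewrite disjointsU1 inE st /= disjoint_sym disjoints1 ZS.
  by move=> a b /mem[]-> /mem[]->; rewrite ?eqxx ?ts // disjoint_sym.
- have a : adjS g (s |: Z) [set t] by apply: adjS_sub at' => //; apply: subsetUr.
  by move=> b b' /mem[]-> /mem[]->; rewrite ?eqxx ?ts // adjS_sym.
Qed.

Section KempeTorso.
Variables (g : rel T) (U : {set T}).
Hypotheses (gs : symmetric g) (gi : irreflexive g).

(** A chain enters and leaves [W] through [S], where the clique gives a shortcut: [W] is collapsed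
    onto a vertex [s0] of [S] in the colours of the chain. A terminal lost in [W] is replaced by a
    vertex of [S] of its colour. *)
Lemma kempe_torso_side (c : T -> 'I_5) f S W : kempe k5 g U c f -> S \subset U -> W \subset U ->
  [disjoint W & S] -> (forall p q, p \in W -> q \in U -> g p q -> q \in W :|: S) ->
  (forall i, f i \in W -> exists2 s, s \in S & c s = i) ->
  exists f', kempe k5 (torso g S) (U :\: W) c f'.
Proof.
move=> [F J] sS sW dWS closed H.
have [sg Hsg] : exists sg : 'I_5 -> T, forall i, f i \in W -> sg i \in S /\ c (sg i) = i.
  apply: (fin_all_exists (P := fun i s => f i \in W -> s \in S /\ c s = i)) => i.
  have [/H[s sS' cs]|/negP nW] := boolP (f i \in W); first by exists s.
  by exists (f i).
have SW s : s \in S -> s \notin W by move=> sS'; rewrite (disjointFl dWS sS').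
exists (fun i => if f i \in W then sg i else f i); split.
  move=> i; have [fU cf] := F i; case: ifP => [/Hsg[sS' cs]|fW]; last by rewrite inE fW fU.
  by rewrite inE SW // (subsetP sS).
move=> i j ij; set X := two_coloured (U :\: W) c i j.
have Xin s : s \in S -> (c s == i) || (c s == j) -> s \in X.
  by move=> sS' cs; rewrite !inE SW // (subsetP sS).
have clique s t : s \in S -> t \in S -> s \in X -> t \in X -> joined (torso g S) X s t.
  move=> sS' tS' sX tX; have [->|st] := eqVneq s t; first exact: joined_refl.
  by apply: joined1; rewrite // /torso st sS' tS' orbT.
(* Without a vertex of [S] in the two colours, no edge of the chain leaves [W], and [s0] is
   arbitrary. *)
have [s0 Hs0] : exists s0, forall q, q \in S -> q \in X -> s0 \in S /\ s0 \in X.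
  have [/existsP[s /andP[? ?]]|] := boolP [exists s, (s \in S) && (s \in X)]; first by exists s.
  by rewrite negb_exists => /forallP N; exists (f i) => q qS qX; have := N q; rewrite qS qX.
pose phi z := if z \in W then s0 else z.
have J' : joined (torso g S) X (phi (f i)) (phi (f j)).
  apply: joined_map (J i j ij) => u v /and3P[]; rewrite !inE => /andP[uU cu] /andP[vU cv] guv.
  have uv : u != v by apply: contraTneq guv => ->; rewrite gi.
  have half p q : p \in W -> q \notin W -> q \in U -> (c q == i) || (c q == j) -> g p q ->
      joined (torso g S) X s0 q.
    move=> pW qW qU cq gpq; have qS : q \in S.
      by have := closed p q pW qU gpq; rewrite inE (negbTE qW).
    have qX := Xin q qS cq; have [s0S s0X] := Hs0 q qS qX; exact: clique.
  rewrite /phi; case: (boolP (u \in W)) => uW; case: (boolP (v \in W)) => vW.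
  - exact: connect0.
  - exact: half uW vW vU cv guv.
  - rewrite -/(joined _ _ _ _) joined_sym; last exact: torso_sym.
    by apply: half vW uW uU cu _; rewrite gs.
  - by apply: joined1; rewrite ?inE ?uW ?vW ?uU ?vU // /torso uv guv.
have start k : (k == i) || (k == j) -> joined (torso g S) X (phi (f k)) (if f k \in W then sg k else f k).
  move=> kij; rewrite /phi; case: ifP => fW; last exact: joined_refl.
  have [sS' cs] := Hsg k fW; have sX : sg k \in X by apply: Xin; rewrite // cs.
  have [? ?] := Hs0 _ sS' sX; exact: clique.
apply: (@joined_trans _ _ _ (phi (f i))).
  by rewrite joined_sym ?start ?eqxx //; apply: torso_sym.
by apply: joined_trans J' _; apply: start; rewrite eqxx orbT.
Qed.

Hypotheses (below : minor_below k5 g U) (nominor : ~ minor k5 g U).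
Variables (c : T -> 'I_5) (f : 'I_5 -> T).
Hypothesis K : kempe k5 g U c f.

Let k5s : symmetric k5. Proof. by move=> i j; rewrite /k5 eq_sym. Qed.

Lemma kempe_degree x : x \in U -> 3 < #|nbrs g U x|.
Proof.
move=> xU; have [fx|xf] := eqVneq x (f (c x)).
  apply: leq_trans (leq_imset_card c _).
  apply: (@leq_trans #|[set~ c x]|); first by rewrite cardsC1 card_ord.
  apply: subset_leq_card; apply/subsetP=> j; rewrite !inE => jx.
  have jx' : k5 (c x) j by rewrite /k5 eq_sym.
  have /card_gt0P[y] := kempe_terminal gs gi below nominor K jx' jx'.
  rewrite inE -fx => /and3P[yU gxy /eqP<-]; apply: imset_f.
  by rewrite inE yU.
apply: leq_trans (kempe_interior_degree k5s gs gi below nominor K xU xf) _.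
by apply: subset_leq_card; apply/subsetP=> y; rewrite !inE => /and3P[-> ->].
Qed.

Lemma kempe_card5 : 4 < #|U|.
Proof.
have [F _] := K; have fi : injective f by move=> i j e; rewrite -(F i).2 -(F j).2 e.
rewrite -[5](card_ord 5) -(card_imset _ fi); apply: subset_leq_card.
by apply/subsetP=> _ /imsetP[i _ ->]; case: (F i).
Qed.

(** A smallest separator [S] splits off a component [Z], with [W] on the other side. If every
    terminal in [Z] has its colour on [S], the torso without [Z] inherits the colouring. Otherwise
    some [f i0] in [Z] has a colour absent from [S]; its chain to any terminal [f j] in [W] then
    crosses [S] in colour [j], so [W] can be removed instead. *)
Lemma kempe_4conn : kconn 4 g U.
Proof.
have U5 := kempe_card5.
suff main m : m <= 4 -> kconn m g U by apply: main.
elim: m => [|m IH] m4; first by split=> //; apply: leq_trans U5.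
have km := IH (ltnW m4); split; first exact: leq_ltn_trans m4 U5.
move=> S sS; rewrite ltnS leq_eqVlt => /orP[/eqP Sm|]; last by case: km => _; apply.
apply: contraT => nc; case: nominor.
have kS : kconn #|S| g U by rewrite Sm.
have S3 : #|S| <= 3 by rewrite Sm.
have /set0Pn[z zU] : U :\: S != set0.
  by rewrite -card_gt0 cardsDS // subn_gt0; apply: leq_ltn_trans S3 _; apply: ltn_trans U5.
set Z := component g (U :\: S) z.
have ZU : Z \subset U :\: S by apply: comp_sub.
have ZU' : Z \subset U by apply: subset_trans ZU _; apply: subsetDl.
have zZ : z \in Z by apply: comp_self.
pose W := U :\: S :\: Z.
have /set0Pn[z' z'W] : W != set0.
  apply: contraNneq nc => W0; have -> : U :\: S = Z.
    by apply/eqP; rewrite eqEsubset ZU andbT -setD_eq0 -/W W0.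
  exact: conn_comp.
have z'U : z' \in U :\: S by move: z'W; rewrite inE => /andP[].
have deg := kempe_degree.
have fin f' z0 : z0 \in U :\: S -> kempe k5 (torso g S) (U :\: component g (U :\: S) z0) c f' ->
    minor k5 g U.
  move=> z0U K'; apply: (torso_minor gs gi kS S3 deg sS z0U).
  have z0C := comp_self g z0U.
  have C0U : component g (U :\: S) z0 \subset U.
    by apply: subset_trans (comp_sub _ _ _) _; apply: subsetDl.
  apply: below K' => //; [exact: torso_sym|exact: torso_irrefl|].
  rewrite cardsDS // ltn_subrL !card_gt0; apply/andP; split; apply/set0Pn; exists z0 => //.
  exact: (subsetP C0U).
have closed p q : p \in Z -> q \in U -> g p q -> q \in Z :|: S.
  move=> pZ qU gpq; rewrite inE; case: (boolP (q \in S)) => qS; first by rewrite orbT.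
  by rewrite (comp_closed pZ _ gpq) // inE qS.
have dZS : [disjoint Z & S].
  by apply/disjointP=> s /(subsetP ZU); rewrite inE => /andP[/negP].
have [/forallP all|] := boolP [forall i, (f i \in Z) ==> [exists s in S, c s == i]].
  have [f' K'] : exists f', kempe k5 (torso g S) (U :\: Z) c f'.
    apply: kempe_torso_side K _ _ _ closed _ => // i fZ.
    by have /implyP/(_ fZ)/exists_inP[s sS' /eqP cs] := all i; exists s.
  exact: fin K'.
rewrite negb_forall => /existsP[i0]; rewrite negb_imply => /andP[fi0 /exists_inP none].
have WU : W \subset U by apply: subset_trans (subsetDl _ _) _; apply: subsetDl.
have [f' K'] : exists f', kempe k5 (torso g S) (U :\: W) c f'.
  apply: kempe_torso_side K _ _ _ _ _ => //.
  - by apply/disjointP=> s; rewrite !inE => /and3P[_ /negP].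
  - move=> p q; rewrite in_setD => /andP[pZ]; rewrite in_setD => /andP[pS pU] qU gpq.
    rewrite in_setU /W !in_setD qU andbT; case: (boolP (q \in S)) => qS; rewrite ?orbT //= orbF andbT.
    apply: contra pZ => qZ; apply: (comp_closed qZ); last by rewrite gs.
    by rewrite in_setD pS.
  - move=> j; rewrite in_setD => /andP[fjZ fjU].
    have ij : k5 i0 j by apply: contraNneq fjZ => <-.
    have [p [q [/setIP[_ pZ] /setDP[qX qZ] gpq _]]] := joined_exit (K.2 i0 j ij) fi0 fjZ.
    move: qX; rewrite inE => /andP[qU cq].
    have qS : q \in S by have := closed p q pZ qU gpq; rewrite inE (negbTE qZ).
    exists q => //; case/orP: cq => /eqP // e; case: none; by exists q; rewrite ?e.
have lt : #|U :\: W| < #|U|.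
  by rewrite cardsDS // ltn_subrL !card_gt0 andbC; apply/andP; split; apply/set0Pn;
    [exists z|exists z'] => //; apply: (subsetP ZU').
have m5 := below (torso_sym S gs) (torso_irrefl g S) lt K'.
apply: (torso_minor gs gi kS S3 deg sS z'U); apply: minor_sub m5.
apply/subsetP=> u; rewrite !in_setD => /andP[uW uU]; rewrite uU andbT.
apply: contra uW => uC; have := subsetP (comp_sub _ _ _) _ uC.
rewrite in_setD => /andP[uS _]; rewrite uS uU /= andbT.
apply: contraTN z'W => uZ; rewrite in_setD negb_and negbK; apply/orP; left.
by rewrite /Z -(comp_eq gs uZ) (comp_eq gs uC) comp_self.
Qed.

End KempeTorso.
End Torso.

(** * Topological minors *)

Section Skeleton.
Variables (T : finType) (g : rel T) (U : {set T}).
Hypothesis gs : symmetric g.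
Implicit Types (A B C P Q Z : {set T}) (x y z : T) (es : seq (nat * nat)) (i j k l n : nat).

(** The interior [A] need not be a path: any connected set touching both ends will do. The empty
    interior stands for an edge. *)
Definition leg A x y :=
  if A == set0 then g x y else [&& conn g A, adjS g A [set x] & adjS g A [set y]].

(** A path from [c] to [x] without its end [c]; it is empty exactly when [x = c]. *)
Definition spoke C c x P :=
  P \subset C :\ c /\ if P == set0 then x = c else [/\ conn g P, x \in P & adjS g P [set c]].

Lemma spoke0 C c x : x = c -> spoke C c x set0.
Proof. by move=> ->; split; rewrite ?sub0set ?eqxx. Qed.

Lemma spoke_comp C c x : conn g C -> c \in C -> x \in C :\ c ->
  spoke C c x (component g (C :\ c) x).
Proof.
move=> cC cC' xC; split; first exact: comp_sub.
have xK := comp_self g xC; case: eqP => [e|_]; first by rewrite e inE in xK.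
split=> //; first exact: conn_comp.
by apply: comp_adj; rewrite ?sub1set //; apply/set0Pn; exists c; rewrite inE.
Qed.

(** [x1] is the centre if it equals one of the others or separates them. Otherwise both lie in one
    component of [C :\ x1]; recurse there from a neighbour of [x1] and prolong its spoke by [x1]. *)
Lemma tripod C x1 x2 x3 : conn g C -> x1 \in C -> x2 \in C -> x3 \in C ->
  exists c P1 P2 P3, [/\ c \in C, spoke C c x1 P1, spoke C c x2 P2, spoke C c x3 P3
    & [/\ [disjoint P1 & P2], [disjoint P1 & P3] & [disjoint P2 & P3]]].
Proof.
have [m] := ubnP #|C|; elim: m C x1 => // m IH C x1; rewrite ltnS => Cm cC m1 m2 m3.
have d0 (A : {set T}) : [disjoint set0 & A] by rewrite disjoints_subset sub0set.
have d1 (A : {set T}) : [disjoint A & set0] by rewrite disjoint_sym.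
have [e12|n12] := eqVneq x2 x1.
  have [e13|n13] := eqVneq x3 x1.
    by exists x1, set0, set0, set0; split; rewrite ?d0 //; apply: spoke0.
  exists x1, set0, set0, (component g (C :\ x1) x3); rewrite !d0.
  by split=> //; do ?apply: spoke0 => //; apply: spoke_comp; rewrite // in_setD1 n13.
have x2C : x2 \in C :\ x1 by rewrite in_setD1 n12.
have S2 := spoke_comp cC m1 x2C; set K := component _ _ _ in S2.
have x2K : x2 \in K by apply: comp_self.
have [x3K|n3K] := boolP (x3 \in K); last first.
  have [e13|n13] := eqVneq x3 x1.
    by exists x1, set0, K, set0; rewrite !d0 !d1; split=> //; apply: spoke0.
  have x3C : x3 \in C :\ x1 by rewrite in_setD1 n13.
  exists x1, set0, K, (component g (C :\ x1) x3); rewrite !d0; split=> //.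
  - exact: spoke0.
  - exact: spoke_comp.
  split=> //; apply: comp_disjoint => //.
  by move: n3K; rewrite inE x3C.
have [sK] := S2; case: eqP => [e|_ [cK _ /adjSP[y [_ [yK /set1P-> gy1]]]]].
  by rewrite e inE in x2K.
have KC : K \subset C by apply: subset_trans sK _; apply: subsetDl.
have x1K : x1 \notin K by apply/negP=> /(subsetP sK); rewrite in_setD1 eqxx.
have ltK : #|K| < m.
  apply: leq_trans Cm; apply: proper_card; rewrite properE KC.
  by apply/subsetPn; exists x1.
have [c [P1 [P2 [P3 [cK' [s1 H1] [s2 H2] [s3 H3] [d12 d13 d23]]]]]] := IH K y ltK cK yK x2K x3K.
have up (P : {set T}) : P \subset K :\ c -> P \subset C :\ c.
  by move=> sP; apply: subset_trans sP _; apply: setSD.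
have nP (P : {set T}) : P \subset K :\ c -> x1 \notin P.
  by move=> sP; apply/negP=> /(subsetP sP); rewrite in_setD1 (negbTE x1K) andbF.
exists c, (x1 |: P1), P2, P3; split; do ?[by split; [exact: up|]].
- exact: (subsetP KC).
- split.
    rewrite subUset (up _ s1) sub1set in_setD1 m1 !andbT.
    by apply: contraNneq x1K => ->.
  case: eqP => [e|_]; first by have := setU11 x1 P1; rewrite e inE.
  move: H1; case: eqP => [-> yc|_ [c1 y1 a1]].
    rewrite setU0; split; [exact: conn1|by rewrite inE|].
    by apply: (@adjS_intro _ _ _ _ x1 c); rewrite ?inE // gs -yc.
  split; [|by rewrite setU11|by apply: adjS_sub a1 => //; apply: subsetUr].
  by apply: (conn_setU1 gs c1 y1); rewrite gs.
by rewrite !disjointsU1 !nP.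
Qed.

Lemma leg_sym A x y : leg A x y = leg A y x.
Proof. by rewrite /leg gs; case: ifP => //; rewrite [X in _ && X]andbC. Qed.

Lemma leg_join C D a c x y P Q : spoke C a x P -> spoke D c y Q -> g x y ->
  leg (P :|: Q) a c.
Proof.
move=> [_ HP] [_ HQ] gxy; rewrite /leg; move: HP HQ.
case: eqP => [->|nP]; case: eqP => [->|nQ].
- by rewrite set0U eqxx => <- <-.
- rewrite set0U (negbTE (introN eqP nQ)) => <- [cQ yQ ->]; rewrite cQ andbT /=.
  by apply: adjS_intro yQ _ _; rewrite ?inE // gs.
- rewrite setU0 (negbTE (introN eqP nP)) => -[cP xP ->] <-; rewrite cP /=.
  by apply: adjS_intro xP _ gxy; rewrite inE.
- move=> [cP xP aP] [cQ yQ aQ]; case: eqP => [e|_].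
    by have := subsetP (subsetUl P Q) x xP; rewrite e inE.
  apply/and3P; split.
  + by apply: connU => //; apply: adjS_intro gxy.
  + by apply: adjS_sub aP => //; apply: subsetUl.
  + by apply: adjS_sub aQ => //; apply: subsetUr.
Qed.

Definition ends es k := nth (0, 0) es k.

(* [phi] places the vertices [0, ..., n-1] of the graph with edge list [es]; [L k] is the
   interior of a path replacing the [k]-th edge. *)
Definition skel n es (phi : nat -> T) (L : nat -> {set T}) :=
  [/\ forall i j, i < n -> j < n -> phi i = phi j -> i = j,
      forall i, i < n -> phi i \in U,
      forall k, k < size es -> [/\ L k \subset U, forall i, i < n -> phi i \notin L k
        & leg (L k) (phi (ends es k).1) (phi (ends es k).2)]
    & forall k l, k < size es -> l < size es -> k != l -> [disjoint L k & L l]].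

Definition body n m (phi : nat -> T) (L : nat -> {set T}) :=
  [set x | [exists i : 'I_n, x == phi i] || [exists k : 'I_m, x \in L k]].

Lemma bodyP n m phi (L : nat -> {set T}) x :
  reflect ((exists2 i, i < n & x = phi i) \/ (exists2 k, k < m & x \in L k))
  (x \in body n m phi L).
Proof.
rewrite inE; apply: (iffP orP).
  case=> /existsP[i]; first by move/eqP; left; exists i.
  by right; exists i.
case=> -[i lt e]; [left|right]; apply/existsP; exists (Ordinal lt) => //=; exact/eqP.
Qed.

Lemma skel_max n es phi L : skel n es phi L -> exists L', skel n es phi L' /\
  forall Z k, conn g Z -> Z \subset U :\: body n (size es) phi L' -> k < size es ->
    L' k != set0 -> ~~ adjS g Z (L' k).
Proof.
have [m] := ubnP #|U :\: body n (size es) phi L|; elim: m L => // m IH L.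
rewrite ltnS => Lm sk; have [p1 p2 p3 p4] := sk.
have [[Z [k [cZ sZ km Lk aZ]]]|N] := classic (exists Z k, [/\ conn g Z,
    Z \subset U :\: body n (size es) phi L, k < size es, L k != set0 & adjS g Z (L k)]); last first.
  exists L; split=> // Z k cZ sZ km Lk; apply/negP=> aZ; case: N.
  by exists Z, k.
have nZ x : x \in Z -> x \in U /\ x \notin body n (size es) phi L.
  by move/(subsetP sZ); rewrite in_setD => /andP[].
have nL x l : x \in Z -> l < size es -> x \notin L l.
  by move=> /nZ[_ xb] lm; apply: contra xb => xl; apply/bodyP; right; exists l.
pose L' l := if l == k then L k :|: Z else L l.
have sub l : L l \subset L' l by rewrite /L'; case: eqP => [->|_] //; apply: subsetUl.
apply: (IH L').
  apply: leq_trans Lm; apply: proper_card; rewrite properE; apply/andP; split.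
    apply: setDS; apply/subsetP=> x /bodyP[[i im ->]|[l lm xl]]; apply/bodyP; [left|right].
      by exists i.
    by exists l => //; apply: (subsetP (sub l)).
  have /set0Pn[z zZ] := conn_neq0 cZ; apply/subsetPn; exists z; first exact: (subsetP sZ).
  rewrite in_setD negb_and negbK; apply/orP; left; apply/bodyP; right; exists k => //.
  by rewrite /L' eqxx in_setU zZ orbT.
split=> // [l lm|l l' lm lm' ll'].
  have [l1 l2 l3] := p3 l lm; rewrite /L'; have [e|_] := eqVneq l k; last by split.
  rewrite {}e in l1 l2 l3 *; split.
  - by rewrite subUset l1 (subset_trans sZ) ?subsetDl.
  - move=> i im; rewrite in_setU negb_or l2 //=; apply/negP=> /nZ[_ /bodyP[]].
    by left; exists i.
  move: l3; rewrite /leg (negbTE Lk) => /and3P[cL a1 a2].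
  case: eqP => [e|_].
    by case/set0Pn: Lk => x /(subsetP (subsetUl _ Z)); rewrite e inE.
  apply/and3P; split; first by apply: connU => //; rewrite adjS_sym.
    by apply: adjS_sub a1 => //; apply: subsetUl.
  by apply: adjS_sub a2 => //; apply: subsetUl.
have dZ j : j < size es -> [disjoint Z & L j].
  by move=> jm; apply/disjointP=> x xZ; apply/negP; apply: nL.
rewrite /L'; case: eqP => [e|_]; case: eqP => [e'|_].
- by rewrite e e' eqxx in ll'.
- by rewrite disjointsU dZ // andbT -e p4.
- by rewrite disjoint_sym disjointsU dZ // andbT -e' p4 // eq_sym.
- exact: p4.
Qed.

Section Nodes.
Variables (n : nat) (es : seq (nat * nat)) (phi : nat -> T) (L : nat -> {set T}).
Hypothesis sk : skel n es phi L.
Hypothesis wf : all (fun e => [&& e.1 < n, e.2 < n & e.1 != e.2]) es.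

(** [o k] names the end that absorbs the [k]-th leg. A value [o k >= n] leaves the leg out, free to
    serve as a set of its own. *)
Definition node (o : nat -> nat) i := phi i |: \bigcup_(k < size es | o k == i) L k.

Definition assigned (o : nat -> nat) := forall k, k < size es -> o k < n ->
  o k = (ends es k).1 \/ o k = (ends es k).2.

Lemma wfP k : k < size es ->
  [/\ (ends es k).1 < n, (ends es k).2 < n & (ends es k).1 != (ends es k).2].
Proof. by move=> km; apply/and3P/(allP wf)/mem_nth. Qed.

Lemma nodeP o i x : reflect (x = phi i \/ exists k, [/\ k < size es, o k = i & x \in L k])
  (x \in node o i).
Proof.
rewrite in_setU1; apply: (iffP orP).
  by case=> [/eqP|/bigcupP[k /eqP ok xk]]; [left|right; exists k].
case=> [->|[k [km ok xk]]]; first by left.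
by right; apply/bigcupP; exists (Ordinal km) => //=; apply/eqP.
Qed.

Lemma node_branch o i : phi i \in node o i. Proof. exact: setU11. Qed.

Lemma node_conn o i : assigned o -> i < n -> node o i \subset U /\ conn g (node o i).
Proof.
have [_ p2 p3 _] := sk; move=> ho im; split.
  apply/subsetP=> x /nodeP[->|[k [km _ xk]]]; first exact: p2.
  by case: (p3 k km) => /subsetP s _ _; apply: s.
apply: (conn_root gs (node_branch o i)) => x /nodeP[->|[k [km ok xk]]].
  exact: joined_refl.
have [_ _] := p3 k km; rewrite /leg; case: eqP => [e|_ /and3P[cL a1 a2]].
  by rewrite e inE in xk.
have aL : adjS g (L k) [set phi i] by have := ho k km; rewrite ok => /(_ im)[]->.
have /adjSP[y [_ [yL /set1P-> gy]]] := aL.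
have inN z : z \in L k -> z \in node o i by move=> zk; apply/nodeP; right; exists k.
apply: (@joined_trans _ _ _ y).
  by apply: joined1; rewrite ?node_branch ?inN // gs.
by apply: joined_sub (conn_joined cL yL xk); apply/subsetP.
Qed.

Lemma node_disjoint o i j : i < n -> j < n -> i != j -> [disjoint node o i & node o j].
Proof.
have [p1 _ p3 p4] := sk; move=> im jm ij.
apply/disjointP=> x /nodeP[->|[k [km ok xk]]] /nodeP[e|[l [lm ol xl]]].
- by rewrite (p1 _ _ im jm e) eqxx in ij.
- by case: (p3 l lm) => _ /(_ i im); rewrite xl.
- by case: (p3 k km) => _ /(_ j jm); rewrite -e xk.
- have kl : k != l by apply: contraNneq ij => e; rewrite -ok -ol e.
  exact: (disjointP _ _ (p4 k l km lm kl) x).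
Qed.

Lemma node_leg_disjoint o i k : i < n -> k < size es -> o k != i -> [disjoint node o i & L k].
Proof.
have [_ _ p3 p4] := sk; move=> im km ok; apply/disjointP=> x /nodeP[->|[l [lm ol xl]]].
  by case: (p3 k km) => _ /(_ i im)/negP.
have lk : l != k by apply: contraNneq ok => <-; rewrite ol.
exact: (disjointP _ _ (p4 l k lm km lk) x).
Qed.

Lemma node_adj o k : assigned o -> k < size es -> o k < n ->
  adjS g (node o (ends es k).1) (node o (ends es k).2).
Proof.
move=> ho km okn; have [_ _ p3 _] := sk; have [_ _] := p3 k km; rewrite /leg.
case: eqP => [_ gxy|_ /and3P[_ a1 a2]].
  by apply: adjS_intro gxy; apply: node_branch.
have inN i : o k = i -> L k \subset node o i.
  by move=> ok; apply/subsetP=> x xk; apply/nodeP; right; exists k.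
have inB i : [set phi i] \subset node o i by rewrite sub1set node_branch.
case: (ho k km okn) => /inN oke; first exact: adjS_sub a2.
by rewrite adjS_sym //; apply: adjS_sub a1.
Qed.

Lemma nth_nodes o Zs i : nth set0 ([seq node o i | i <- iota 0 n] ++ Zs) i =
  if i < n then node o i else nth set0 Zs (i - n).
Proof.
rewrite nth_cat size_map size_iota; case: ifP => // im.
by rewrite (nth_map 0) ?size_iota // nth_iota.
Qed.

(** Certificates number the nodes [0, ..., n-1] and the sets of [Zs] from [n] on; [ex] lists the
    contacts beyond the skeleton. *)
Lemma skel_minor k (h : rel 'I_k) (hn : nat -> nat -> bool) o Zs ex certs : assigned o ->
  all (fun Z : {set T} => (Z \subset U) && conn g Z) Zs ->
  pairwise (fun A B : {set T} => [disjoint A & B]) Zs ->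
  (forall i Z, i < n -> Z \in Zs -> [disjoint node o i & Z]) ->
  all (fun e => adjS g (nth set0 ([seq node o i | i <- iota 0 n] ++ Zs) e.1)
                       (nth set0 ([seq node o i | i <- iota 0 n] ++ Zs) e.2)) ex ->
  (forall i j : 'I_k, h i j -> hn i j) ->
  has (fun cl => (size cl == k) && minor_check (n + size Zs)
        ([seq ends es k | k <- iota 0 (size es) & o k < n] ++ ex) cl hn) certs ->
  minor h g U.
Proof.
move=> ho Z1 Z2 Z3 aex hh /hasP[cl _ /andP[/eqP sz chk]].
set Ms := [seq node o i | i <- iota 0 n] ++ Zs in aex.
have sMs : size Ms = n + size Zs by rewrite size_cat size_map size_iota.
have nM i : i < n -> nth set0 Ms i = node o i.
  by move=> im; rewrite nth_cat size_map size_iota im (nth_map 0) ?size_iota // nth_iota.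
apply: (list_minor (Ms := Ms)) sz hh _; rewrite ?sMs; first exact: gs; last exact: chk.
- rewrite all_cat Z1 andbT all_map; apply/allP=> i; rewrite mem_iota add0n => /andP[_ im] /=.
  by apply/andP; apply: node_conn.
- rewrite pairwise_cat Z2 andbT; apply/andP; split.
    apply/allrelP=> A Z /mapP[i]; rewrite mem_iota add0n => /andP[_ im] -> ZZ; exact: Z3.
  rewrite pairwise_map; apply/(pairwiseP 0) => a b; rewrite !inE size_iota => am bm ab /=.
  by rewrite !nth_iota // !add0n node_disjoint // ltn_eqF.
- rewrite all_cat aex andbT all_map; apply/allP=> l.
  rewrite mem_filter mem_iota add0n => /and3P[ol _ lm] /=.
  have [l1 l2 _] := wfP lm; rewrite !nM //; exact: node_adj.
Qed.

(** By maximality [Z] touches no leg, so fewer than four branch vertices next to [Z] would cut it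
    off from another one. *)
Lemma leftover Z : kconn 4 g U -> 4 < n ->
  (forall Z k, conn g Z -> Z \subset U :\: body n (size es) phi L -> k < size es ->
    L k != set0 -> ~~ adjS g Z (L k)) ->
  conn g Z -> Z \subset U :\: body n (size es) phi L ->
  (forall x y, x \in Z -> y \in U :\: body n (size es) phi L -> g x y -> y \in Z) ->
  4 <= count (fun i => adjS g Z [set phi i]) (iota 0 n).
Proof.
move=> [_ k4] n4 mx cZ sZ closed; have [p1 p2 p3 p4] := sk.
rewrite leqNgt; apply/negP=> lt.
pose f i := adjS g Z [set phi i].
pose S := [set x in [seq phi i | i <- iota 0 n & f i]].
have cS : #|S| < 4.
  by apply: leq_ltn_trans lt; rewrite cardsE (leq_trans (card_size _)) // size_map size_filter.
have SU : S \subset U.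
  apply/subsetP=> x; rewrite inE => /mapP[i]; rewrite mem_filter mem_iota => /and3P[_ _ im] ->.
  exact: p2.
have [j jn fj] : exists2 j, j < n & ~~ f j.
  have : ~~ all f (iota 0 n).
    by rewrite all_count size_iota neq_ltn (leq_ltn_trans _ (ltn_trans lt n4)).
  by case/allPn=> j; rewrite mem_iota => /andP[_ jn] fj; exists j.
have /set0Pn[z zZ] := conn_neq0 cZ.
have nb x : x \in Z -> x \in U /\ x \notin body n (size es) phi L.
  by move/(subsetP sZ); rewrite in_setD => /andP[].
have phib i : i < n -> phi i \in body n (size es) phi L by move=> im; apply/bodyP; left; exists i.
have nphi i : i < n -> phi i \notin Z by move=> im; apply/negP=> /nb[_ /negP[]]; apply: phib.
have zS : z \in U :\: S.
  rewrite in_setD (nb _ zZ).1 andbT inE; apply/mapP=> -[i].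
  by rewrite mem_filter mem_iota => /and3P[_ _ im] e; rewrite e (negbTE (nphi i im)) in zZ.
have jS : phi j \in U :\: S.
  rewrite in_setD p2 // andbT inE; apply/mapP=> -[i].
  rewrite mem_filter mem_iota => /and3P[fi _ im] /(p1 _ _ jn im) e.
  by rewrite e fi in fj.
have [p [q [/setIP[pU pZ] /setDP[qU qZ] gpq _]]] :=
  joined_exit (conn_joined (k4 S SU cS) zS jS) zZ (nphi j jn).
move: qU; rewrite in_setD => /andP[qS qU].
have : q \in body n (size es) phi L.
  by apply: contraNT qZ => qb; apply: closed pZ _ gpq; rewrite in_setD qb.
case/bodyP=> [[i im e]|[k km qk]].
  have fi : f i by apply: adjS_intro pZ _ gpq; rewrite e inE.
  by case/negP: qS; rewrite inE e map_f // mem_filter mem_iota im fi.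
have Lk : L k != set0 by apply/set0Pn; exists q.
by case/negP: (mx Z k cZ sZ km Lk); apply: adjS_intro gpq.
Qed.

End Nodes.

End Skeleton.

(** * The Wagner graph *)

(* The edges of K33, and of the Wagner graph obtained from it by subdividing the edges 03
   and 14 and joining the two new vertices 6 and 7. *)
Definition es33 := [:: (0,3); (0,4); (0,5); (1,3); (1,4); (1,5); (2,3); (2,4); (2,5)].
Definition es8 := [:: (0,6); (0,4); (0,5); (1,3); (1,7); (1,5); (2,3); (2,4); (2,5);
                      (6,3); (7,4); (6,7)].

Definition perms3 := [:: [:: 0; 1; 2]; [:: 0; 2; 1]; [:: 1; 0; 2]; [:: 1; 2; 0];
                         [:: 2; 0; 1]; [:: 2; 1; 0]].
Definition perms33 := [seq s ++ map (addn 3) t | s <- perms3, t <- perms3].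

(** The default [6] fixes the vertex added to K33. *)
Definition rename (s : seq nat) := map (map (nth 6 s)).

(* Contractions to K5 of K33 plus a vertex 6 adjacent to 0, 1, 3, 4 (also when 03 is missing),
   to 0, 1, 2, 3 or to 0, 3, 4, 5, and of K33 plus the edges 01 and 34. *)
Definition base33 :=
  [:: [:: [:: 0; 5]; [:: 1]; [:: 2; 3]; [:: 4]; [:: 6]];
      [:: [:: 0; 4]; [:: 1; 5]; [:: 2]; [:: 3]; [:: 6]];
      [:: [:: 3; 1]; [:: 4; 2]; [:: 5]; [:: 0]; [:: 6]];
      [:: [:: 0]; [:: 1]; [:: 2; 5]; [:: 3]; [:: 4]]].
Definition certs33 := [seq rename s cl | s <- perms33, cl <- base33].

(* One contraction to K5 for each edge missing from the Wagner graph. *)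
Definition certs8 :=
  [:: [:: [::0];[::1];[::2;5];[::3;6];[::4;7]];
      [:: [::0];[::1;5];[::2];[::3;6];[::4;7]];
      [:: [::0];[::1;5];[::2;4];[::3];[::6;7]];
      [:: [::0];[::1;5];[::2;4];[::3;6];[::7]];
      [:: [::0;5];[::1];[::2];[::3;6];[::4;7]];
      [:: [::0;5];[::1];[::2;3];[::4];[::6;7]];
      [:: [::0;5];[::1];[::2;3];[::4;7];[::6]];
      [:: [::0;5];[::1;3];[::2];[::4;7];[::6]];
      [:: [::0;4];[::1;5];[::2];[::3;6];[::7]];
      [:: [::0;6];[::1;7];[::2;5];[::3];[::4]];
      [:: [::0;6];[::1;7];[::2;4];[::3];[::5]];
      [:: [::0;6];[::1;5];[::2;4];[::3];[::7]];
      [:: [::0;6];[::1;7];[::2;3];[::4];[::5]];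
      [:: [::0;5];[::1;7];[::2;3];[::4];[::6]];
      [:: [::0;4];[::1;7];[::2;3];[::5];[::6]];
      [:: [::0;6];[::1;3];[::2;4];[::5];[::7]]].
(* Vertex 8 joins one of the branch sets. *)
Definition certs9 := [seq set_nth [::] cl b (rcons (nth [::] cl b) 8) | cl <- certs8, b <- iota 0 5].

Definition nonadj8 p q := [&& p < 8, q < 8, p != q & ~~ linked_by es8 p q].

(* [has], but evaluated lazily by [vm_compute]. *)
Fixpoint search (A : Type) (p : A -> bool) s :=
  if s is x :: s' then if p x then true else search p s' else false.

Lemma searchE (A : Type) (p : A -> bool) s : search p s = has p s.
Proof. by elim: s => //= x s ->. Qed.

Definition certified n es certs :=
  search (fun cl : seq (seq nat) => (size cl == 5) && minor_check n es cl hk5) certs.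

Fixpoint bits n : seq (seq bool) :=
  if n is m.+1 then [seq b :: s | b <- [:: true; false], s <- bits m] else [:: [::]].

Lemma mem_bits s : s \in bits (size s).
Proof.
elim: s => //= b s IH.
by case: b; rewrite !mem_cat !mem_map ?IH ?orbT // => ? ? [].
Qed.

(* The [k]-th edge of K33 joins [side false k] to [side true k]. *)
Definition side (t : bool) k := if t then 3 + k %% 3 else k %/ 3.

(** [bs] marks the branch vertices touched by an uncovered piece, which is numbered 6. *)
Lemma table33_leftover : all (fun bs => if 4 <= count id bs then
  certified 7 (es33 ++ [seq (6, i) | i <- iota 0 6 & nth false bs i]) certs33 else true) (bits 6).
Proof. by vm_compute. Qed.

Lemma table33_two_edges : all (fun p => all (fun q => all (fun r => all (fun s =>
    if (p != q) && (r != s) then certified 6 (es33 ++ [:: (p, q); (3 + r, 3 + s)]) certs33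
    else true)
  (iota 0 3)) (iota 0 3)) (iota 0 3)) (iota 0 3).
Proof. by vm_compute. Qed.

(** The leg [k] has become the vertex 6: adjacent to its two ends, which lose their edge, and to one
    more vertex on each side. *)
Lemma table33_split_edge : all (fun k => all (fun q => all (fun r =>
    if (q != side false k) && (3 + r != side true k) then certified 7
      ([seq ends es33 m | m <- iota 0 9 & m != k] ++
      [:: (6, side false k); (6, side true k); (6, q); (6, 3 + r)]) certs33
    else true) (iota 0 3)) (iota 0 3)) (iota 0 9).
Proof. by vm_compute. Qed.

Lemma table8_edge : all (fun p => all (fun q => if nonadj8 p q then
  certified 8 (es8 ++ [:: (p, q)]) certs8 else true) (iota 0 8)) (iota 0 8).
Proof. by vm_compute. Qed.

(** The Wagner graph contains no K4; a piece touching four branch vertices therefore bridges a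
    missing edge. *)
Lemma table8_independent : all (fun bs => if 4 <= count id bs then
  has (fun p => has (fun q => [&& nth false bs p, nth false bs q & nonadj8 p q]) (iota 0 8))
    (iota 0 8) else true) (bits 8).
Proof. by vm_compute. Qed.

Lemma table8_bypass : all (fun p => all (fun q => if nonadj8 p q then
  certified 9 (es8 ++ [:: (8, p); (8, q)]) certs9 else true) (iota 0 8)) (iota 0 8).
Proof. by vm_compute. Qed.

(** Two touching legs can thus be assigned to ends that realize a missing edge. *)
Lemma table8_legs : all (fun k => all (fun l => (k != l) ==>
    has (fun p => has (fun q => nonadj8 p q) [:: (ends es8 l).1; (ends es8 l).2])
      [:: (ends es8 k).1; (ends es8 k).2]) (iota 0 12)) (iota 0 12).
Proof. by vm_compute. Qed.

(** Holds because the Wagner graph has no triangle. *)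
Lemma table8_leg_branch : all (fun k => all (fun r =>
    (r != (ends es8 k).1) && (r != (ends es8 k).2) ==>
    has (fun p => nonadj8 p r) [:: (ends es8 k).1; (ends es8 k).2]) (iota 0 8)) (iota 0 12).
Proof. by vm_compute. Qed.

Definition reindex_ok n es n' es' (al be : seq nat) :=
  [&& size al == n', uniq al, all (fun i => i < n) al, size be == size es', uniq be,
    all (fun k => k < size es) be & all (fun j => let e := ends es' j in
      let e' := (nth 0 al e.1, nth 0 al e.2) in let f := ends es (nth 0 be j) in
      [&& e.1 < n', e.2 < n' & (e' == f) || ((e'.2, e'.1) == f)]) (iota 0 (size es'))].

Definition edge_perm (al : seq nat) :=
  [seq index (nth 0 al e.1, nth 0 al e.2) es33 | e <- es33].

(** Any two disjoint edges of K33 can be moved to 03 and 14, the edges numbered 0 and 4. *)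
Lemma table33_perm : all (fun k => all (fun l =>
    if (side false k != side false l) && (side true k != side true l) then
    search (fun al => [&& reindex_ok 6 es33 6 es33 al (edge_perm al), nth 0 (edge_perm al) 0 == k
      & nth 0 (edge_perm al) 4 == l]) perms33 else true) (iota 0 9)) (iota 0 9).
Proof. by vm_compute. Qed.

(** * Subdivisions of the Wagner graph in 4-connected graphs *)

Section FourConnected.
Variables (T : finType) (g : rel T) (U : {set T}).
Hypotheses (gs : symmetric g).
Implicit Types (x y z : T) (Z : {set T}) (phi : nat -> T) (L : nat -> {set T}).

Lemma skel_reindex n es n' es' al be phi L : reindex_ok n es n' es' al be ->
  skel g U n es phi L -> skel g U n' es' (fun i => phi (nth 0 al i)) (fun k => L (nth 0 be k)).
Proof.
case/and5P=> /eqP sa ua /allP la /eqP sb /and3P[ub /allP lb /allP E] [p1 p2 p3 p4].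
have A i : i < n' -> nth 0 al i < n by move=> im; apply/la/mem_nth; rewrite sa.
have B k : k < size es' -> nth 0 be k < size es by move=> km; apply/lb/mem_nth; rewrite sb.
split.
- move=> i j im jm /(p1 _ _ (A i im) (A j jm)) /eqP.
  by rewrite nth_uniq ?sa // => /eqP.
- by move=> i /A/p2.
- move=> k km; have [l1 l2 l3] := p3 _ (B k km); split=> //; first by move=> i /A/l2.
  have /E/and3P[_ _] : k \in iota 0 (size es') by rewrite mem_iota.
  by case/orP=> /eqP e; move: l3; rewrite -e //= leg_sym.
- move=> k l km lm kl; apply: p4; rewrite ?B // nth_uniq ?sb //.
Qed.

Lemma skel_k5 n es phi L o Zs ex es' certs : skel g U n es phi L ->
  all (fun e => [&& e.1 < n, e.2 < n & e.1 != e.2]) es -> assigned n es o ->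
  all (fun Z : {set T} => (Z \subset U) && conn g Z) Zs -> size Zs <= 1 ->
  (forall i Z, i < n -> Z \in Zs -> [disjoint node es phi L o i & Z]) ->
  (forall e, e \in ex -> adjS g
     (nth set0 ([seq node es phi L o i | i <- iota 0 n] ++ Zs) e.1)
     (nth set0 ([seq node es phi L o i | i <- iota 0 n] ++ Zs) e.2)) ->
  [seq ends es k | k <- iota 0 (size es) & o k < n] = es' ->
  certified (n + size Zs) (es' ++ ex) certs -> minor k5 g U.
Proof.
move=> sk wf ho Z1 Zs1 Z2 E e'; rewrite /certified searchE -e'.
apply: (skel_minor gs sk wf ho Z1) => //; last exact/allP.
by case: Zs Zs1 {Z1 Z2 E} => [|? []].
Qed.

Lemma ends_all n es (o : nat -> nat) : (forall k, k < size es -> o k < n) ->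
  [seq ends es k | k <- iota 0 (size es) & o k < n] = es.
Proof.
move=> H; rewrite (@eq_in_filter _ _ predT) ?filter_predT; last first.
  by move=> k; rewrite mem_iota => /andP[_ km]; rewrite H.
by apply: (@eq_from_nth _ (0, 0)); rewrite size_map size_iota // => i im;
   rewrite (nth_map 0) ?size_iota // nth_iota.
Qed.

Hypothesis k4 : kconn 4 g U.

Definition maximal n (es : seq (nat * nat)) phi L := forall Z k, conn g Z ->
  Z \subset U :\: body n (size es) phi L -> k < size es -> L k != set0 -> ~~ adjS g Z (L k).

Lemma skel_leftover n es phi L : skel g U n es phi L -> maximal n es phi L -> 4 < n ->
  U \subset body n (size es) phi L \/
  exists Z, [/\ conn g Z, Z \subset U :\: body n (size es) phi L &
    4 <= count id [seq adjS g Z [set phi i] | i <- iota 0 n]].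
Proof.
move=> sk mx n4; have [|/subsetPn[z zU zb]] := boolP (U \subset body n (size es) phi L).
  by left.
have zB : z \in U :\: body n (size es) phi L by rewrite in_setD zb.
have cZ := conn_comp gs zB; have sZ := comp_sub g (U :\: body n (size es) phi L) z.
right; exists (component g (U :\: body n (size es) phi L) z); split=> //.
rewrite count_map; apply: (leftover sk k4 n4 mx cZ sZ) => x y; exact: comp_closed.
Qed.

Lemma node_body n (es : seq (nat * nat)) phi L o i : i < n -> node es phi L o i \subset body n (size es) phi L.
Proof.
move=> im; apply/subsetP=> x /nodeP[->|[k [km _ xk]]]; apply/bodyP; [left|right]; first by exists i.
by exists k.
Qed.

Definition wf n es := all (fun e : nat * nat => [&& e.1 < n, e.2 < n & e.1 != e.2]) es.

Lemma skel_attached n es phi L o Z js certs : skel g U n es phi L -> wf n es ->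
  assigned n es o -> (forall k, k < size es -> o k < n) -> conn g Z ->
  Z \subset U :\: body n (size es) phi L ->
  (forall i, i \in js -> i < n /\ adjS g Z [set phi i]) ->
  certified n.+1 (es ++ [seq (n, i) | i <- js]) certs -> minor k5 g U.
Proof.
move=> sk wfe ho on cZ sZ aZ; rewrite -addn1.
apply: (skel_k5 (Zs := [:: Z]) sk wfe ho) => //; last exact: ends_all.
- by rewrite /= cZ (subset_trans sZ) // subsetDl.
- move=> i Z' im; rewrite inE => /eqP->; apply/disjointP=> x /(subsetP (node_body _ _ _ _ im)) xb.
  by move/(subsetP sZ); rewrite in_setD xb.
- move=> _ /mapP[i /aZ[im ai] ->]; rewrite !nth_nodes /= ltnn subnn im /=.
  by apply: adjS_sub ai; rewrite // sub1set node_branch.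
Qed.

Lemma skel_edge n es phi L o p q certs : skel g U n es phi L -> wf n es ->
  assigned n es o -> (forall k, k < size es -> o k < n) -> p < n -> q < n ->
  adjS g (node es phi L o p) (node es phi L o q) ->
  certified n (es ++ [:: (p, q)]) certs -> minor k5 g U.
Proof.
move=> sk wfe ho on pm qm apq; rewrite -[in certified _](addn0 n).
apply: (skel_k5 (Zs := [::]) sk wfe ho) => //; last exact: ends_all.
by move=> e; rewrite inE => /eqP->; rewrite !nth_nodes pm qm.
Qed.

Lemma avoid2 a b : exists r, [/\ r < 3, r != a & r != b].
Proof.
case: (boolP ((0 != a) && (0 != b))) => [/andP[? ?]|h0]; first by exists 0.
case: (boolP ((1 != a) && (1 != b))) => [/andP[? ?]|h1]; first by exists 1.
by exists 2; split=> //; move: h0 h1; clear; lia.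
Qed.

(** Any contact beyond the edges of the Wagner graph yields a certified K5, and 4-connectedness
    enforces one: an uncovered piece touches four branch vertices, a nonempty leg has a neighbour
    other than its ends, and if all legs are edges the vertex 0, of degree 3, needs a fourth
    neighbour. *)
Lemma es8_k5 phi L : skel g U 8 es8 phi L -> minor k5 g U.
Proof.
move=> /skel_max[//|{}L [sk mx]]; apply: NNPP => NM; have [p1 p2 p3 p4] := sk.
have wf8 : wf 8 es8 by [].
have H8 (o : nat -> nat) : (forall k, k < 12 -> o k = (ends es8 k).1 \/ o k = (ends es8 k).2) ->
    assigned 8 es8 o /\ forall k, k < 12 -> o k < 8.
  move=> ho; split=> [k km _|k km]; first exact: ho.
  by have [? ? _] := wfP wf8 km; case: (ho k km) => ->.
have adj8 o p q : (forall k, k < 12 -> o k = (ends es8 k).1 \/ o k = (ends es8 k).2) ->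
    nonadj8 p q -> ~ adjS g (node es8 phi L o p) (node es8 phi L o q).
  move=> /H8[ho on] npq apq; apply: NM; have := npq; rewrite /nonadj8 => /and4P[pm qm _ _].
  apply: (skel_edge sk wf8 ho on pm qm apq).
  have := allP (allP table8_edge p _) q; rewrite !mem_iota pm qm npq; exact.
have [sU|[Z [cZ sZ c4]]] := skel_leftover sk mx isT; last first.
  have := allP table8_independent _ (mem_bits [seq adjS g Z [set phi i] | i <- iota 0 8]).
  rewrite c4 => /hasP[p].
  rewrite mem_iota => /andP[_ pm] /hasP[q]; rewrite mem_iota => /andP[_ qm] /and3P[].
  rewrite !(nth_map 0) ?size_iota // !nth_iota // !add0n => ap aq npq.
  have [ho on] := H8 (fun k => (ends es8 k).1) (fun k _ => or_introl (erefl _)).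
  apply/NM/(skel_attached (js := [:: p; q]) sk wf8 ho on cZ sZ).
    by move=> i; rewrite !inE => /orP[]/eqP->.
  have := allP (allP table8_bypass p _) q; rewrite !mem_iota pm qm npq; exact.
have piece y : y \in U -> (exists2 i, i < 8 & y = phi i) \/ (exists2 k, k < 12 & y \in L k).
  by move/(subsetP sU)/bodyP.
have L0 k : k < 12 -> L k = set0.
  move=> km; apply/eqP; rewrite -[_ == _]negbK; apply/negP=> /set0Pn[x xk].
  have [l1 l2 _] := p3 k km; have [e1 e2 _] := wfP wf8 km.
  (* A branch vertex off the leg, to be reached without passing the two ends. *)
  have [r [r3 re1 re2]] := avoid2 (ends es8 k).1 (ends es8 k).2.
  have rm : r < 8 by apply: leq_trans r3 _.
  set S := [set phi (ends es8 k).1; phi (ends es8 k).2].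
  have cS : conn g (U :\: S).
    case: k4 => _; apply; first by rewrite subUset !sub1set !p2.
    by rewrite cards2; case: (_ != _).
  have xS : x \in U :\: S.
    rewrite in_setD in_set2 negb_or (subsetP l1) // andbT.
    by apply/andP; split; apply: contraTneq xk => ->; apply: l2.
  have rS : phi r \in U :\: S.
    rewrite in_setD in_set2 negb_or p2 // andbT.
    by apply/andP; split; [apply: contraNneq re1|apply: contraNneq re2] => /p1->.
  have [p [q [/setIP[_ pk] /setDP[qS qk] gpq _]]] :=
    joined_exit (conn_joined cS xS rS) xk (l2 r rm).
  move: qS; rewrite in_setD in_set2 negb_or => /andP[/andP[q1 q2] qU].
  have [[i im e]|[l lm ql]] := piece q qU.
    have ie1 : i != (ends es8 k).1 by apply: contraNneq q1 => <-; rewrite e.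
    have ie2 : i != (ends es8 k).2 by apply: contraNneq q2 => <-; rewrite e.
    have := allP (allP table8_leg_branch k _) i; rewrite !mem_iota km im ie1 ie2.
    case/(_ isT isT)/hasP => j jk nji.
    apply: (adj8 (fun m => if m == k then j else (ends es8 m).1) j i _ nji).
      move=> m _; have [->|_] := eqVneq m k; last by left.
      by move: jk; rewrite !inE => /orP[]/eqP->; [left|right].
    apply: adjS_intro gpq; apply/nodeP; last by left.
    by right; exists k; rewrite eqxx.
  have kl : k != l by apply: contraNneq qk => ->.
  have := allP (allP table8_legs k _) l; rewrite !mem_iota km lm kl.
  case/(_ isT isT)/hasP => j jk /hasP[j' jl njj].
  apply: (adj8 (fun m => if m == k then j else if m == l then j' else (ends es8 m).1) j j' _ njj).
    move=> m _; have [->|_] := eqVneq m k.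
      by move: jk; rewrite !inE => /orP[]/eqP->; [left|right].
    have [->|_] := eqVneq m l; last by left.
    by move: jl; rewrite !inE => /orP[]/eqP->; [left|right].
  apply: adjS_intro gpq; apply/nodeP; right; first by exists k; rewrite eqxx.
  by exists l; rewrite eqxx eq_sym (negbTE kl).
(* The neighbours of 0 in the Wagner graph. *)
set S := phi 4 |: [set phi 5; phi 6].
have cS : conn g (U :\: S).
  case: k4 => _; apply; first by rewrite !subUset !sub1set !p2.
  by rewrite cardsU1 cards2; case: (phi 4 \notin _); case: (phi 5 != _).
have inS i : i < 8 -> i \notin [:: 4; 5; 6] -> phi i \in U :\: S.
  move=> im; rewrite !inE !negb_or => /and3P[i4 i5 i6].
  rewrite p2 // andbT; apply/and3P.
  by split; [apply: contraNneq i4|apply: contraNneq i5|apply: contraNneq i6] => e;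
    apply/eqP; exact: p1 e.
have n10 : phi 1 \notin [set phi 0] by rewrite inE; apply/eqP=> /p1; move=> /(_ isT isT).
have [p [q [/setIP[_ /set1P->] /setDP[qS q0] gpq _]]] :=
  joined_exit (conn_joined cS (inS 0 isT isT) (inS 1 isT isT)) (set11 _) n10.
have qU : q \in U by case/setDP: qS.
have [[i im e]|[l lm ql]] := piece q qU; last by rewrite L0 // inE in ql.
rewrite {}e in qS q0 gpq qU.
apply: (adj8 (fun k => (ends es8 k).1) 0 i); first by left.
  move: im q0 qS; rewrite !inE !negb_or => im q0 /andP[/and3P[q4 q5 q6] _].
  have : i \notin [:: 0; 4; 5; 6].
    rewrite !inE !negb_or; apply/and4P; split;
      [move: q0|move: q4|move: q5|move: q6]; by apply: contraNneq => ->.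
  by move: im; clear; do 8?case: i => [//|i].
by apply: adjS_intro gpq; apply: node_branch.
Qed.

End FourConnected.

(** * From a K33 minor to a subdivision, and on to the Wagner graph *)

Section Tripods.
Variables (T : finType) (g : rel T) (U : {set T}).
Hypothesis gs : symmetric g.
Implicit Types (x y z : T) (A Z : {set T}) (phi : nat -> T) (L : nat -> {set T}).

Lemma nat_choice (A : Type) (a0 : A) n (P : nat -> A -> Prop) :
  (forall i, i < n -> exists a, P i a) -> exists f, forall i, i < n -> P i (f i).
Proof.
elim: n => [|n IH] H; first by exists (fun=> a0).
have [f Hf] := IH (fun i im => H i (ltnW im)); have [a Pa] := H n (ltnSn n).
exists (fun i => if i == n then a else f i) => i; rewrite ltnS leq_eqVlt.
by case: eqP => [->//|_] /= /Hf.
Qed.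

Lemma ends33 k : k < 9 -> ends es33 k = (side false k, side true k).
Proof. by move: k; do 9!case=> [//|]. Qed.

Lemma leg_tripod A x y w : conn g A -> adjS g A [set x] -> adjS g A [set y] -> w \in A ->
  exists z P1 P2 P3, [/\ z \in A, leg g P1 x z, leg g P2 z y, spoke g A z w P3
    & [/\ [disjoint P1 & P2], [disjoint P1 & P3], [disjoint P2 & P3]
        & [/\ P1 \subset A :\ z, P2 \subset A :\ z & P3 \subset A :\ z]]].
Proof.
move=> cA /adjSP[x' [_ [x'A /set1P-> gx]]] /adjSP[y' [_ [y'A /set1P-> gy]]] wA.
have [z [P1 [P2 [P3 [zA s1 s2 s3 [d12 d13 d23]]]]]] := tripod gs cA x'A y'A wA.
have s0 v : spoke g [set v] v v set0 by apply: spoke0.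
exists z, P1, P2, P3; split=> //.
- by rewrite leg_sym // -(setU0 P1); apply: (leg_join gs s1 (s0 x)).
- by rewrite -(setU0 P2); apply: (leg_join gs s2 (s0 y)).
by split=> //; split; [case: s1|case: s2|case: s3].
Qed.

(** Legs 0 and 4 join 0 to 3 and 1 to 4. Each of them branches towards the point of contact, at the
    new vertices 6 and 7; the two spokes and the edge between them form the leg 67. *)
Lemma crosslink phi L : skel g U 6 es33 phi L -> adjS g (L 0) (L 4) ->
  exists phi' L', skel g U 8 es8 phi' L'.
Proof.
move=> [p1 p2 p3 p4] /adjSP[v [w [vL wL gvw]]].
have [_ _] := p3 0 isT; rewrite /leg; case: eqP => [e|_ /and3P[c0 a0 a3]]; first by rewrite e inE in vL.
have [_ _] := p3 4 isT; rewrite /leg; case: eqP => [e|_ /and3P[c4 a1 a4]]; first by rewrite e inE in wL.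
have [z [P1 [P2 [P3 [zA lP1 lP2 sP3 [dP12 dP13 dP23 [uP1 uP2 uP3]]]]]]] := leg_tripod c0 a0 a3 vL.
have [y [Q1 [Q2 [Q3 [yA lQ1 lQ2 sQ3 [dQ12 dQ13 dQ23 [uQ1 uQ2 uQ3]]]]]]] := leg_tripod c4 a1 a4 wL.
have lPQ := leg_join gs sP3 sQ3 gvw.
pose phi' (i : nat) := if i == 6 then z else if i == 7 then y else phi i.
pose L' (k : nat) := if k == 0 then P1 else if k == 4 then Q1 else if k == 9 then P2
  else if k == 10 then Q2 else if k == 11 then P3 :|: Q3 else L k.
have in0 (P : {set T}) x : P \subset L 0 :\ z -> x \in P -> x \in L 0 /\ x != z.
  by move=> s /(subsetP s); rewrite in_setD1 => /andP[].
have in4 (P : {set T}) x : P \subset L 4 :\ y -> x \in P -> x \in L 4 /\ x != y.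
  by move=> s /(subsetP s); rewrite in_setD1 => /andP[].
have dis k l x : k < 9 -> l < 9 -> x \in L k -> x \in L l -> k = l.
  move=> km lm xk xl; apply/eqP; rewrite -[_ == _]negbK; apply/negP=> kl.
  exact: (disjointP _ _ (p4 k l km lm kl) x).
have inL k x : k < 12 -> x \in L' k -> [\/ x \in L 0 /\ x != z, x \in L 4 /\ x != y
    | [/\ k < 9, k != 0, k != 4 & x \in L k]].
  move=> km; rewrite /L'; case: eqP => [_ /(in0 _ _ uP1)|k0]; first by constructor 1.
  case: eqP => [_ /(in4 _ _ uQ1)|k4]; first by constructor 2.
  case: eqP => [_ /(in0 _ _ uP2)|k9]; first by constructor 1.
  case: eqP => [_ /(in4 _ _ uQ2)|k10]; first by constructor 2.
  case: eqP => [_ /setUP[/(in0 _ _ uP3)|/(in4 _ _ uQ3)]|k11]; [by constructor 1|by constructor 2|].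
  move=> xk; constructor 3; split=> //; try exact/eqP.
  by move: km k9 k10 k11; clear; lia.
have sub k x : k < 12 -> x \in L' k -> exists2 m, m < 9 & x \in L m.
  by move=> km /(inL _ _ km)[[? _]|[? _]|[? _ _ ?]]; [exists 0|exists 4|exists k].
have nz k : k < 12 -> z \notin L' k.
  move=> km; apply/negP=> /(inL _ _ km)[[_]|[z4 _]|[k9 k0 _ zk]]; first by rewrite eqxx.
    by have := dis 0 4 z isT isT zA z4.
  by rewrite (dis 0 k z isT k9 zA zk) eqxx in k0.
have ny k : k < 12 -> y \notin L' k.
  move=> km; apply/negP=> /(inL _ _ km)[[y0 _]|[_]|[k9 _ k4 yk]]; last 1 first.
  - by rewrite (dis 4 k y isT k9 yA yk) eqxx in k4.
  - by have := dis 0 4 y isT isT y0 yA.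
  - by rewrite eqxx.
have nphi m i : m < 9 -> i < 6 -> phi i \notin L m by move=> mm; case: (p3 m mm) => _ /(_ i).
have small (i : nat) : i < 8 -> i != 6 -> i != 7 -> i < 6 by clear; lia.
exists phi', L'; split.
- have yz : y != z by apply: contraTneq zA => <-; apply/negP=> /(dis 4 0 y isT isT yA).
  have np (A : {set T}) (i : nat) : (forall j, j < 6 -> phi j \notin A) -> i < 6 ->
      forall x, x \in A -> phi i = x -> False.
    by move=> H im x xA e; case/negP: (H i im); rewrite e.
  have z0 i : i < 6 -> phi i <> z by move=> im; apply: (np (L 0)) zA => // j; apply: nphi.
  have y0 i : i < 6 -> phi i <> y by move=> im; apply: (np (L 4)) yA => // j; apply: nphi.
  move=> i j im jm; rewrite /phi'.
  have [->|i6] := eqVneq i 6; have [->|j6] := eqVneq j 6 => //.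
  + have [->|j7] := eqVneq j 7; first by move=> e; rewrite e eqxx in yz.
    by move=> e; case: (z0 j (small j jm j6 j7)).
  + have [->|i7] := eqVneq i 7; first by move=> e; rewrite e eqxx in yz.
    by move=> e; case: (z0 i (small i im i6 i7)).
  have [->|i7] := eqVneq i 7; have [->|j7] := eqVneq j 7 => //.
  + by move=> e; case: (y0 j (small j jm j6 j7)).
  + by move=> e; case: (y0 i (small i im i6 i7)).
  by apply: p1; apply: small.
- have LU m x : m < 9 -> x \in L m -> x \in U.
    by move=> mm; case: (p3 m mm) => s _ _; apply: (subsetP s).
  move=> i im; rewrite /phi'; have [_|i6] := eqVneq i 6; first exact: LU zA.
  have [_|i7] := eqVneq i 7; first exact: LU yA.
  by apply: p2; apply: small.
- move=> k km; split.
  + apply/subsetP=> x /(sub _ _ km)[m mm xm]; case: (p3 m mm) => s _ _.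
    exact: (subsetP s).
  + move=> i im; rewrite /phi'; have [_|i6] := eqVneq i 6; first exact: nz.
    have [_|i7] := eqVneq i 7; first exact: ny.
    apply/negP=> /(sub _ _ km)[m mm]; apply/negP; apply: nphi => //; exact: small.
  + case: k km => [|[|[|[|[|[|[|[|[|[|[|[|k]]]]]]]]]]]] //= _; rewrite /L' /phi' /ends /=; try assumption;
      match goal with |- context [L ?m] => by case: (p3 m isT) end.
- have d (P Q : {set T}) x : [disjoint P & Q] -> x \in P -> x \in Q -> False by move/disjointP; apply.
  have d04 x : x \in L 0 -> x \in L 4 -> False by move=> a /(dis 0 4 x isT isT a).
  (* Records in which piece of which old leg a point lies; disjointness then becomes a matter of
     cases. *)
  pose tag (k : nat) x := [\/ [/\ k = 0, x \in P1 & x \in L 0], [/\ k = 4, x \in Q1 & x \in L 4],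
     [/\ k = 9, x \in P2 & x \in L 0] | [/\ k = 10, x \in Q2 & x \in L 4]]
     \/ [\/ [/\ k = 11, x \in P3 & x \in L 0], [/\ k = 11, x \in Q3 & x \in L 4]
     | [/\ k < 9, k != 0, k != 4 & x \in L k]].
  have Ht k x : k < 12 -> x \in L' k -> tag k x.
    move=> km; rewrite /L' /tag; case: eqP => [-> xP|k0].
      by left; constructor 1; split=> //; case: (in0 _ _ uP1 xP).
    case: eqP => [-> xP|k4]; first by left; constructor 2; split=> //; case: (in4 _ _ uQ1 xP).
    case: eqP => [-> xP|k9]; first by left; constructor 3; split=> //; case: (in0 _ _ uP2 xP).
    case: eqP => [-> xP|k10]; first by left; constructor 4; split=> //; case: (in4 _ _ uQ2 xP).
    case: eqP => [-> /setUP[]xP|k11].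
    - by right; constructor 1; split=> //; case: (in0 _ _ uP3 xP).
    - by right; constructor 2; split=> //; case: (in4 _ _ uQ3 xP).
    move=> xk; right; constructor 3; split=> //; try exact/eqP.
    by move: km k9 k10 k11; clear; lia.
  move=> k l km lm kl; apply/disjointP=> x /(Ht _ _ km) hk /(Ht _ _ lm) hl.
  have no0 m : m < 9 -> m != 0 -> x \in L m -> x \in L 0 -> False.
    by move=> mm m0 xm x0; rewrite (dis m 0 x mm isT xm x0) in m0.
  have no4 m : m < 9 -> m != 4 -> x \in L m -> x \in L 4 -> False.
    by move=> mm m0 xm x0; rewrite (dis m 4 x mm isT xm x0) in m0.
  have {}d04 := d04 x.
  have D12 := d P1 P2 x dP12. have D13 := d P1 P3 x dP13. have D23 := d P2 P3 x dP23.
  have E12 := d Q1 Q2 x dQ12. have E13 := d Q1 Q3 x dQ13. have E23 := d Q2 Q3 x dQ23.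
  case: hk => [[[ek m1 m2]|[ek m1 m2]|[ek m1 m2]|[ek m1 m2]]|[[ek m1 m2]|[ek m1 m2]|[k9 k0 k4 xk]]];
  case: hl => [[[el n1 n2]|[el n1 n2]|[el n1 n2]|[el n1 n2]]|[[el n1 n2]|[el n1 n2]|[l9 l0 l4 xl]]];
  first [by rewrite ek el in kl | exact (d04 m2 n2) | exact (d04 n2 m2)
    | exact (D12 m1 n1) | exact (D12 n1 m1) | exact (D13 m1 n1) | exact (D13 n1 m1)
    | exact (D23 m1 n1) | exact (D23 n1 m1) | exact (E12 m1 n1) | exact (E12 n1 m1)
    | exact (E13 m1 n1) | exact (E13 n1 m1) | exact (E23 m1 n1) | exact (E23 n1 m1)
    | exact (no0 _ k9 k0 xk n2) | exact (no4 _ k9 k4 xk n2)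
    | exact (no0 _ l9 l0 xl m2) | exact (no4 _ l9 l4 xl m2)
    | by case/eqP: kl; apply: dis xk xl].
Qed.

(** K33 is cubic, so a minor is a topological minor: choose an edge between any two adjacent bags,
    and join its three ends in each bag by a tripod. *)
Lemma k33_skel : minor k33 g U -> exists phi L, skel g U 6 es33 phi L.
Proof.
move=> [C [C1 C2 C3]].
pose A i := C (inord i).
have cA i : conn g (A i) by case: (C1 (inord i)).
have sA i : A i \subset U by case: (C1 (inord i)).
have dA i j : i < 6 -> j < 6 -> i != j -> [disjoint A i & A j].
  by move=> im jm ij; apply: C2; apply: contraNneq ij => /(congr1 val) /=; rewrite !inordK // => ->.
have [x0 _] : exists x0, x0 \in A 0 by apply/set0Pn/conn_neq0.
have [xy Hxy] : exists xy : nat -> T * T, forall k, k < 9 ->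
    [/\ (xy k).1 \in A (side false k), (xy k).2 \in A (side true k) & g (xy k).1 (xy k).2].
  apply: (nat_choice (P := fun k xy => [/\ xy.1 \in A (side false k),
    xy.2 \in A (side true k) & g xy.1 xy.2]) (x0, x0)) => k km.
  have /adjSP[x [y [xA yA gxy]]] : adjS g (A (side false k)) (A (side true k)).
    by apply: C3; rewrite /k33 !inordK /side; move: km; clear; lia.
  by exists (x, y).
(* For each bag [i], its centre and its spokes, indexed by the legs [k] at [i]. *)
have [cP HcP] : exists cP : nat -> T * (nat -> {set T}), forall i, i < 6 -> (cP i).1 \in A i /\
    (forall k t, k < 9 -> side t k = i ->
       spoke g (A i) (cP i).1 (if t then (xy k).2 else (xy k).1) ((cP i).2 k)) /\
    (forall k l t, k < 9 -> l < 9 -> side t k = i -> side t l = i -> k != l ->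
       [disjoint (cP i).2 k & (cP i).2 l]).
  apply: (nat_choice (P := fun i (cP : T * (nat -> {set T})) => cP.1 \in A i /\
    (forall k t, k < 9 -> side t k = i ->
       spoke g (A i) cP.1 (if t then (xy k).2 else (xy k).1) (cP.2 k)) /\
    (forall k l t, k < 9 -> l < 9 -> side t k = i -> side t l = i -> k != l ->
       [disjoint cP.2 k & cP.2 l])) (x0, fun=> set0)) => i im.
  pose t := 2 < i.
  (* The numbers of the three edges of K33 at the vertex [i]. *)
  pose kk j := if t then 3 * j + (i - 3) else 3 * i + j.
  pose v j := if t then (xy (kk j)).2 else (xy (kk j)).1.
  have kk9 j : j < 3 -> kk j < 9 by rewrite /kk /t => j3; case: (ltnP 2 i) => h; move: im h j3; clear; lia.
  have sk j : j < 3 -> side t (kk j) = i.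
    by rewrite /kk /t /side => j3; case: (ltnP 2 i) => h; move: im h j3; clear; lia.
  have vA j : j < 3 -> v j \in A i.
    move=> j3; have [h1 h2 _] := Hxy _ (kk9 j j3); have := sk j j3; rewrite /v.
    by case: (t) => e; rewrite -e.
  have [c [P0 [P1 [P2 [cA' s0 s1 s2 [d01 d02 d12]]]]]] := tripod gs (cA i) (vA 0 isT) (vA 1 isT) (vA 2 isT).
  have tt k t' : k < 9 -> side t' k = i -> t' = t /\ exists2 j, j < 3 & k = kk j.
    rewrite /kk /t => km; case: t' => /= <-.
      have -> : 2 < 3 + k %% 3 by [].
      by split=> //; exists (k %/ 3); move: km; clear; lia.
    have -> : (2 < k %/ 3) = false by move: km; clear; lia.
    by split=> //; exists (k %% 3); move: km; clear; lia.
  exists (c, fun k => if k == kk 0 then P0 else if k == kk 1 then P1 else P2) => /=.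
  have n10 : kk 1 != kk 0 by rewrite /kk; case: (t); clear; lia.
  have n20 : kk 2 != kk 0 by rewrite /kk; case: (t); clear; lia.
  have n21 : kk 2 != kk 1 by rewrite /kk; case: (t); clear; lia.
  split=> //; split.
    move=> k t' km e; have [-> [j j3 ->]] := tt k t' km e.
    move: j3; do 3?case: j => [|j] //; rewrite ?eqxx ?(negbTE n10) ?(negbTE n20) ?(negbTE n21) //.
  move=> k l t' km lm ek el; have [_ [j j3 ->]] := tt k t' km ek.
  have [_ [j' j'3 ->]] := tt l t' lm el.
  move: j3 j'3; do 3?case: j => [|j] //; do 3?case: j' => [|j'] //;
    rewrite ?eqxx ?(negbTE n10) ?(negbTE n20) ?(negbTE n21) // disjoint_sym //.
exists (fun i => (cP i).1), (fun k => (cP (side false k)).2 k :|: (cP (side true k)).2 k).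
have s6 t k : k < 9 -> side t k < 6 by rewrite /side; case: t; clear; lia.
have sP t k : k < 9 -> (cP (side t k)).2 k \subset A (side t k) :\ (cP (side t k)).1.
  by move=> km; have [_ [/(_ k t km erefl)[]]] := HcP _ (s6 t k km).
split.
- move=> i j im jm e; apply/eqP; rewrite -[_ == _]negbK; apply/negP=> ij.
  apply: (disjointP _ _ (dA i j im jm ij) (cP i).1); first by case: (HcP i im).
  by rewrite e; case: (HcP j jm).
- by move=> i im; apply: (subsetP (sA i)); case: (HcP i im).
- move=> k km; split.
  + by rewrite subUset !(subset_trans (sP _ _ km)) // (subset_trans (subsetDl _ _)).
  + move=> i im; suff H t : (cP i).1 \notin (cP (side t k)).2 k by rewrite in_setU negb_or !H.
    apply/negP=> /(subsetP (sP t k km)); rewrite in_setD1 => /andP[n].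
    have ni : i != side t k by apply: contraNneq n => <-.
    by move=> h; apply: (disjointP _ _ (dA _ _ im (s6 t k km) ni) (cP i).1) => //; case: (HcP i im).
  + rewrite ends33 //=; have [_ _ gxy] := Hxy k km.
    have [_ [/(_ k false km erefl) s1 _]] := HcP _ (s6 false k km).
    have [_ [/(_ k true km erefl) s2 _]] := HcP _ (s6 true k km).
    exact: leg_join s1 s2 gxy.
- move=> k l km lm kl; apply/disjointP=> x /setUP hx /setUP hy.
  have sx t : x \in (cP (side t k)).2 k -> x \in A (side t k).
    by move/(subsetP (sP t k km)); rewrite in_setD1 => /andP[].
  have sy t : x \in (cP (side t l)).2 l -> x \in A (side t l).
    by move/(subsetP (sP t l lm)); rewrite in_setD1 => /andP[].
  have key t t' : x \in (cP (side t k)).2 k -> x \in (cP (side t' l)).2 l -> False.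
    move=> h h'; have [e|n] := eqVneq (side t k) (side t' l); last first.
      exact: (disjointP _ _ (dA _ _ (s6 t k km) (s6 t' l lm) n) x (sx t h) (sy t' h')).
    have et : t' = t.
      by move: e km lm; rewrite /side; clear; case: t; case: t' => //=; lia.
    subst t'; rewrite -e in h'.
    have [_ [_ H]] := HcP _ (s6 t k km).
    exact: (disjointP _ _ (H k l t km lm erefl (esym e) kl) x).
  by case: hx => hx; case: hy => hy; apply: key hx hy.
Qed.

End Tripods.

(** * Four-connected graphs *)

Local Arguments side : simpl never.

Section FourConnectedK33.
Variables (T : finType) (g : rel T) (U : {set T}).
Hypotheses (gs : symmetric g) (k4 : kconn 4 g U).
Implicit Types (x y z : T) (A Z : {set T}) (phi : nat -> T) (L : nat -> {set T}).

(** A permutation moves the two edges to 03 and 14, where the contact yields a subdivision of the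
    Wagner graph. *)
Lemma crossing_legs phi L k l : skel g U 6 es33 phi L -> k < 9 -> l < 9 ->
  side false k != side false l -> side true k != side true l -> adjS g (L k) (L l) ->
  minor k5 g U.
Proof.
move=> sk km lm kl1 kl2 akl.
have := allP (allP table33_perm k _) l; rewrite !mem_iota km lm kl1 kl2 searchE.
case/(_ isT isT)/hasP => al _ /and3P[/skel_reindex R /eqP e0 /eqP e4].
have [|phi' [L' /es8_k5]] := crosslink gs (R _ g _ gs _ _ sk); last exact.
by rewrite e0 e4.
Qed.

Lemma side_lt t k : k < 9 -> side t k < 6.
Proof. by rewrite /side; case: t; clear; lia. Qed.

Lemma side_assigned (o : nat -> nat) : (forall k, k < 9 -> exists t, o k = side t k \/ 6 <= o k) ->
  assigned 6 es33 o.
Proof.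
move=> H k km ok; case: (H k km) => t; rewrite ends33 // => -[->|].
  by case: t; [right|left].
by rewrite leqNgt ok.
Qed.

(** Giving every leg to its end on the side [t] covers [U] by three claws and the three opposite
    branch vertices. By 4-connectedness, deleting the latter leaves two claws in contact.
    [side true 0] is 3, the first vertex of the second side. *)
Lemma adjacent_claws t phi L : skel g U 6 es33 phi L -> U \subset body 6 9 phi L ->
  exists p q r r', [/\ (side true 0 <= r) == t, (side true 0 <= r') == t, r < 6 & r' < 6] /\
   [/\ r != r', p \in node es33 phi L (side t) r, q \in node es33 phi L (side t) r' & g p q].
Proof.
move=> sk sU; have [p1 p2 p3 p4] := sk.
pose b := if t then 3 else 0; pose b' := if t then 0 else 3.
set S := phi b' |: [set phi b'.+1; phi b'.+2].
have cS : conn g (U :\: S).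
  case: k4 => _; apply; first by rewrite !subUset !sub1set !p2 //; rewrite /b'; case: (t).
  by rewrite cardsU1 cards2; case: (phi b' \notin _); case: (phi b'.+1 != _).
have inS i : i < 6 -> (side true 0 <= i) == t -> phi i \in U :\: S.
  move=> im it; have nb j : j < 3 -> phi i != phi (b' + j).
    move=> j3; apply/eqP=> /p1 e; move: (e im); rewrite /b'; move: im it j3; rewrite /side /=.
    by clear; case: t => /=; lia.
  have := nb 0 isT; have := nb 1 isT; have := nb 2 isT; rewrite addn0 addn1 addn2.
  by rewrite in_setD p2 // andbT !inE !negb_or => -> -> ->.
have b6 : b < 6 by rewrite /b; case: (t).
have b61 : b.+1 < 6 by rewrite /b; case: (t).
have bt : (side true 0 <= b) == t by rewrite /b; case: (t).
have bt1 : (side true 0 <= b.+1) == t by rewrite /b; case: (t).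
have nb1 : phi b.+1 \notin node es33 phi L (side t) b.
  apply/negP=> /nodeP[/(p1 _ _ b61 b6)|[k [km _ xk]]]; first by clear; lia.
  by case: (p3 k km) => _ /(_ _ b61); rewrite xk.
have [p [q [/setIP[_ pN] /setDP[qS qN] gpq _]]] :=
  joined_exit (conn_joined cS (inS b b6 bt) (inS b.+1 b61 bt1)) (node_branch _ _ _ _ b) nb1.
have qU : q \in U by case/setDP: qS.
case/bodyP: (subsetP sU q qU) => [[i im e]|[k km qk]].
  exists p, q, b, i; split; split=> //.
  - apply: contraLR qS => it; rewrite in_setD negb_and negbK; apply/orP; left.
    have : exists2 j, j < 3 & i = b' + j.
      exists (i - b'); move: im it; rewrite /b' /side /=; clear; by case: t => /=; lia.
    case=> -[|[|[|j]]] // _ ej; rewrite e ej /S !inE ?addn0 ?addn1 ?addn2 eqxx ?orbT //.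
  - by apply: contraNneq qN => ->; rewrite e node_branch.
  - by rewrite e node_branch.
have qk' : q \in node es33 phi L (side t) (side t k) by apply/nodeP; right; exists k.
exists p, q, b, (side t k); split; split=> //.
- by rewrite /side; case: (t); move: km; clear; lia.
- exact: side_lt.
- by apply: contraNneq qN => ->.
Qed.

(** The leg [k] becomes a vertex of its own, adjacent to its two ends and to one more vertex on each
    side. Contact with the leg of a disjoint edge already gives K5, so a leg through [y] or [y'] may
    be taken to share an end with the leg [k]. *)
Lemma conflicting_leg phi L k x y r x' y' s : skel g U 6 es33 phi L -> k < 9 ->
  x \in L k -> g x y -> y \in node es33 phi L (side true) r -> 2 < r < 6 -> r != side true k ->
  x' \in L k -> g x' y' -> y' \in node es33 phi L (side false) s -> s < 3 -> s != side false k ->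
  minor k5 g U.
Proof.
move=> sk km xk gxy yN r36 rk x'k gxy' y'N s3 sk'; have [p1 p2 p3 p4] := sk.
have [_ _ l3] := p3 k km; move: l3; rewrite /leg; case: eqP => [e|_]; first by rewrite e inE in xk.
rewrite ends33 // => /and3P[cL a1 a2].
have Hy : y = phi r \/ exists l, [/\ l < 9, side true l = r, y \in L l &
    side false l = side false k] \/ minor k5 g U.
  case/nodeP: yN => [|[l [lm ol yl]]]; [by left|right; exists l].
  have [e|ne] := eqVneq (side false l) (side false k); first by left.
  right; apply: (crossing_legs sk lm km) => //; first by rewrite ol.
  by rewrite adjS_sym //; apply: adjS_intro gxy.
have Hy' : y' = phi s \/ exists l, [/\ l < 9, side false l = s, y' \in L l &
    side true l = side true k] \/ minor k5 g U.
  case/nodeP: y'N => [|[l [lm ol yl]]]; [by left|right; exists l].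
  have [e|ne] := eqVneq (side true l) (side true k); first by left.
  right; apply: (crossing_legs sk lm km) => //; first by rewrite ol.
  by rewrite adjS_sym //; apply: adjS_intro gxy'.
(* A leg through [y] shares the first end of the leg [k] and goes to its second end [r]; a leg
   through [y'] shares the second end, hence not the first, and goes to [s]. The value 6 leaves the
   leg [k] out. *)
pose o l := if l == k then 6 else if side false l == side false k then side true l else side false l.
have ho : assigned 6 es33 o.
  apply: side_assigned => l lm; rewrite /o; case: ifP => _; first by exists true; right.
  by case: ifP => _; [exists true|exists false]; left.
have [yr|Hm] : y \in node es33 phi L o r \/ minor k5 g U; last by [].
  case: Hy => [->|[l [[lm ol yl e]|m]]]; [by left; apply: node_branch| |by right].
  left; apply/nodeP; right; exists l; split=> //; rewrite /o e eqxx ol; case: eqP => // lk.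
  by rewrite -lk ol eqxx in rk.
have [ys|Hm] : y' \in node es33 phi L o s \/ minor k5 g U; last by [].
  case: Hy' => [->|[l [[lm ol yl e]|m]]]; [by left; apply: node_branch| |by right].
  left; apply/nodeP; right; exists l; split=> //; rewrite /o ol (negbTE sk'); case: eqP => // lk.
  by rewrite -lk ol eqxx in sk'.
have ok l : l < 9 -> (o l < 6) = (l != k).
  move=> lm; rewrite /o; case: eqP => [//|_]; by case: ifP => _; rewrite side_lt.
have rm : r < 6 by case/andP: r36.
have sm : s < 6 by apply: leq_trans s3 _.
apply: (skel_k5 gs (Zs := [:: L k]) (certs := certs33)
  (ex := [:: (6, side false k); (6, side true k); (6, s); (6, 3 + (r - 3))])
  (es' := [seq ends es33 m | m <- iota 0 9 & m != k]) sk isT ho) => //.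
- by rewrite /= cL andbT; case: (p3 k km) => ->.
- move=> i Z im; rewrite inE => /eqP->; apply: (node_leg_disjoint sk im km).
  by rewrite /o eqxx gtn_eqF.
- rewrite subnKC; last by case/andP: r36.
  move=> e; rewrite !inE => /or4P[]/eqP->; rewrite !nth_nodes /= ?side_lt ?rm ?sm //.
  + by apply: adjS_sub a1; rewrite ?sub1set ?node_branch.
  + by apply: adjS_sub a2; rewrite ?sub1set ?node_branch.
  + exact: adjS_intro gxy'.
  + exact: adjS_intro gxy.
- congr map; apply: eq_in_filter => l; rewrite mem_iota => /andP[_ lm]; exact: ok.
have kI : k \in iota 0 9 by rewrite mem_iota.
have sI : s \in iota 0 3 by rewrite mem_iota.
have rI : r - 3 \in iota 0 3 by rewrite mem_iota; move: r36; clear; lia.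
have := allP (allP (allP table33_split_edge k kI) s sI) (r - 3) rI.
by rewrite sk' subnKC ?rk //; case/andP: r36.
Qed.

(** A contact of two claws on each side adds an edge inside both sides of K33 and gives K5, provided
    that one assignment of the legs serves both contacts. It fails only if a leg through [p'] or
    [q'] also contains [p] or [q]; that leg then touches foreign claws on both sides. *)
Theorem k33_k5 : minor k33 g U -> minor k5 g U.
Proof.
case/(k33_skel gs)=> phi [{}L /skel_max[//|L0 [sk mx]]].
have [sU|[Z [cZ sZ c4]]] := skel_leftover gs k4 sk mx isT; last first.
  have ho : assigned 6 es33 (side true) by apply: side_assigned => k _; exists true; left.
  apply: (skel_attached gs (certs := certs33)
    (js := [seq i <- iota 0 6 | nth false [seq adjS g Z [set phi i] | i <- iota 0 6] i]) sk isT ho _ cZ sZ).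
  - by move=> k; apply: side_lt.
  - move=> i; rewrite mem_filter mem_iota => /and3P[ai _ im]; split=> //.
    by move: ai; rewrite (nth_map 0) ?size_iota // nth_iota.
  - have := allP table33_leftover _ (mem_bits [seq adjS g Z [set phi i] | i <- iota 0 6]).
    by rewrite c4.
have [p [q [r [r' [[rt rt' r6 r'6] [rr pr qr gpq]]]]]] := adjacent_claws true sk sU.
have [p' [q' [s [s' [[st st' s6 s'6] [ss ps qs gpq']]]]]] := adjacent_claws false sk sU.
rewrite /side /= in rt rt' st st'.
have r36 : 2 < r < 6 by rewrite (eqP rt).
have r36' : 2 < r' < 6 by rewrite (eqP rt').
have s3 : s < 3 by rewrite ltnNge (eqP st).
have s3' : s' < 3 by rewrite ltnNge (eqP st').
pose o l := if (p \in L0 l) || (q \in L0 l) then side true l else side false l.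
have ho : assigned 6 es33 o.
  by apply: side_assigned => l lm; rewrite /o; case: ifP => _; [exists true|exists false]; left.
have pN x i : x \in [:: p; q] -> x \in node es33 phi L0 (side true) i -> x \in node es33 phi L0 o i.
  move=> xpq /nodeP[->|[l [lm ol xl]]]; first exact: node_branch.
  apply/nodeP; right; exists l; split=> //; rewrite /o.
  by move: xpq; rewrite !inE => /orP[]/eqP <-; rewrite xl ?orbT.
have qN x i : x \in node es33 phi L0 (side false) i -> x \in node es33 phi L0 o i \/
    exists l, [/\ l < 9, side false l = i, x \in L0 l & (p \in L0 l) || (q \in L0 l)].
  move=> /nodeP[->|[l [lm ol xl]]]; first by left; apply: node_branch.
  case: (boolP ((p \in L0 l) || (q \in L0 l))) => h; first by right; exists l.
  by left; apply/nodeP; right; exists l; rewrite /o (negbTE h).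
have in_claw x l i t : l < 9 -> x \in L0 l -> i < 6 -> x \in node es33 phi L0 (side t) i -> i = side t l.
  move=> lm xl im /nodeP[e|[m [mm <- xm]]].
    by have [_ _ /(_ l lm)[_ /(_ i im)]] := sk; rewrite -e xl.
  have [_ _ _ p4] := sk; have [->//|ml] := eqVneq m l.
  by case: (disjointP _ _ (p4 m l mm lm ml) x xm xl).
have conflict x y i j l : l < 9 -> x \in L0 l -> (p \in L0 l) || (q \in L0 l) ->
    x \in node es33 phi L0 (side false) i -> i < 3 ->
    g x y -> y \in node es33 phi L0 (side false) j -> j < 3 -> i != j -> minor k5 g U.
  move=> lm xl pq xi i3 gxy yj j3 ij.
  have i6 : i < 6 by apply: leq_trans i3 _.
  have ji : j != side false l by rewrite -(in_claw x l i false) // eq_sym.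
  case/orP: pq => xpq.
    apply: (conflicting_leg sk lm xpq gpq qr r36' _ xl gxy yj j3 ji).
    by rewrite -(in_claw p l r true) // eq_sym.
  have gqp : g q p by rewrite gs.
  apply: (conflicting_leg sk lm xpq gqp pr r36 _ xl gxy yj j3 ji).
  by rewrite -(in_claw q l r' true).
case: (qN p' s ps) => [p's|[l [lm _ xl pq]]]; last exact: conflict lm xl pq ps s3 gpq' qs s3' ss.
case: (qN q' s' qs) => [q's|[l [lm _ xl pq]]]; last first.
  by apply: (conflict _ _ _ _ _ lm xl pq qs s3' _ ps s3); rewrite // 1?gs // eq_sym.
apply: (skel_k5 gs (Zs := [::]) (certs := certs33) (ex := [:: (s, s'); (3 + (r - 3), 3 + (r' - 3))])
  (es' := es33) sk isT ho) => //.
- rewrite !subnKC; try by move: r36 r36'; clear; lia.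
  move=> e; rewrite !inE => /orP[]/eqP->; rewrite !nth_nodes /= ?s6 ?s'6 ?r6 ?r'6.
    exact: adjS_intro gpq'.
  by apply: adjS_intro gpq; apply: pN => //; rewrite !inE eqxx ?orbT.
- by apply: ends_all => l lm; rewrite /o; case: ifP => _; apply: side_lt.
have I3 i : i < 3 -> i \in iota 0 3 by rewrite mem_iota.
have I6 i : 2 < i < 6 -> i - 3 \in iota 0 3 by rewrite mem_iota; clear; lia.
have nn : r - 3 != r' - 3 by move: rr r36 r36'; clear; lia.
have := allP (allP (allP (allP table33_two_edges s (I3 s s3)) s' (I3 s' s3'))
  (r - 3) (I6 r r36)) (r' - 3) (I6 r' r36').
by rewrite ss nn.
Qed.

End FourConnectedK33.

(** * Dense bipartite graphs *)

Section Density.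
Variables (T : finType) (s : T -> bool).
Implicit Types (g : rel T) (U V W S A B : {set T}) (x y z u v : T).

(* Twice the number of edges of [(g, U)]. *)
Definition degsum g U := \sum_u \sum_v ((u \in U) && (v \in U) && g u v : nat).

Definition bipartite g := forall u v, g u v -> s u != s v.

Lemma bipartite_irrefl g : bipartite g -> irreflexive g.
Proof. by move=> b u; apply/negP=> /b; rewrite eqxx. Qed.

Lemma nbrsE g U x : #|nbrs g U x| = \sum_v ((v \in U) && g x v : nat).
Proof. by rewrite -sum1dep_card big_mkcond; apply: eq_bigr => v _; case: (_ && _). Qed.

Lemma sum_row (a : T) (P : pred T) : \sum_u \sum_v ((u == a) && P v : nat) = \sum_v (P v : nat).
Proof.
rewrite (bigD1 a) //= eqxx [X in _ + X]big1 ?addn0 // => u /negbTE->.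
by rewrite big1.
Qed.

Lemma sum_col (a : T) (P : pred T) : \sum_u \sum_v ((v == a) && P u : nat) = \sum_v (P v : nat).
Proof. by rewrite exchange_big sum_row. Qed.

Lemma degsumE g U : degsum g U = \sum_(u in U) #|nbrs g U u|.
Proof.
rewrite /degsum [RHS]big_mkcond; apply: eq_bigr => u _; rewrite nbrsE.
by case: (u \in U) => //=; rewrite big1.
Qed.

Lemma degsum_setU1 g V x : symmetric g -> irreflexive g -> x \notin V ->
  degsum g (x |: V) = degsum g V + 2 * #|nbrs g V x|.
Proof.
move=> gs gi xV; rewrite mul2n -addnn {1}nbrsE -(sum_row x) nbrsE -(sum_col x) addnA.
rewrite /degsum -!big_split; apply: eq_bigr => u _; rewrite -!big_split; apply: eq_bigr => v _ /=.
rewrite !in_setU1; have [->|ux] := eqVneq u x; have [->|vx] := eqVneq v x => //=.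
- by rewrite gi (negbTE xV).
- by rewrite (negbTE xV) /= addn0.
- by rewrite (negbTE xV) andbT andbF /= gs.
- by rewrite !addn0.
Qed.

Lemma degsum_even g U : symmetric g -> bipartite g -> exists e, degsum g U = 2 * e.
Proof.
move=> gs b; exists (\sum_u \sum_v ([&& u \in U, v \in U, g u v & s u] : nat)).
rewrite mul2n -addnn {2}exchange_big /degsum -big_split; apply: eq_bigr => u _.
rewrite -big_split; apply: eq_bigr => v _ /=; rewrite [g v u]gs.
case: (u \in U); case: (v \in U); rewrite //=; case: (boolP (g u v)) => //= /b.
by case: (s u); case: (s v).
Qed.

Lemma degsum_le_parts g U : bipartite g ->
  degsum g U <= 2 * (#|[set u in U | s u]| * #|[set u in U | ~~ s u]|).
Proof.
move=> b; rewrite mul2n -addnn -!sum1dep_card !big_distrlr /=.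
rewrite [X in _ <= X + _]big_mkcond [X in _ <= _ + X]exchange_big [X in _ <= _ + X]big_mkcond.
rewrite /degsum -big_split; apply: leq_sum => u _.
rewrite ![X in _ <= (if _ then X else _) + _]big_mkcond ![X in _ <= _ + (if _ then X else _)]big_mkcond.
case: (u \in U) => /=; last by rewrite big1.
case su: (s u) => /=; rewrite ?addn0 ?add0n; apply: leq_sum => v _; case: (v \in U) => //=;
  by case: (boolP (g u v)) => // /b; rewrite su; case: (s v).
Qed.

Lemma density_small g U : bipartite g -> #|U| = 3 -> degsum g U < 6.
Proof.
move=> b U3; have := degsum_le_parts U b.
have := U3; rewrite -(cardsID [set u | s u] U).
have -> : U :&: [set u | s u] = [set u in U | s u] by apply/setP=> u; rewrite !inE.
have -> : U :\: [set u | s u] = [set u in U | ~~ s u] by apply/setP=> u; rewrite !inE andbC.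
move: #|_| #|_| => a c; clear; case: a => [|[|[|[|a]]]]; case: c => [|[|[|[|c]]]] //; lia.
Qed.

(** No edge joins [W] to a vertex outside [W :|: S], and the edges inside [S] are counted on both
    sides. *)
Lemma degsum_separation g U W S : W \subset U -> S \subset U -> [disjoint W & S] -> symmetric g ->
  (forall p q, p \in W -> q \in U -> g p q -> q \in W :|: S) ->
  degsum g U + degsum g S <= degsum g (U :\: W) + degsum g (W :|: S).
Proof.
move=> WU SU dWS gs closed; rewrite /degsum -!big_split; apply: leq_sum => u _.
rewrite -!big_split; apply: leq_sum => v _ /=; case: (boolP (g u v)) => guv; last by rewrite !andbF.
rewrite !andbT !in_setD !in_setU.
have WS z : ~~ ((z \in W) && (z \in S)).
  by apply/andP=> -[zW]; rewrite (disjointFr dWS zW).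
have cl p q : g p q -> (p \in W) && (q \in U) ==> (q \in W) || (q \in S).
  by move=> gpq; apply/implyP=> /andP[pW qU]; have := closed p q pW qU gpq; rewrite inE.
have WU' z : (z \in W) ==> (z \in U) by apply/implyP/(subsetP WU).
have SU' z : (z \in S) ==> (z \in U) by apply/implyP/(subsetP SU).
have := cl u v guv; have := cl v u; rewrite [g v u]gs => /(_ guv).
move: (WS u) (WS v) (WU' u) (WU' v) (SU' u) (SU' v).
by case: (u \in W); case: (u \in S); case: (u \in U); case: (v \in W); case: (v \in S); case: (v \in U).
Qed.

Lemma degsum_del_edge g U a b : degsum g U <=
  degsum (fun u v => g u v && ~~ ((u == a) && (v == b) || (u == b) && (v == a))) U + 2.
Proof.
have E (c d : T) : \sum_u \sum_v ((u == c) && (v == d) : nat) = 1.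
  by rewrite (sum_row c (pred1 d)) (bigD1 d) //= eqxx big1 // => v /negbTE->.
rewrite -[2]/(1 + 1) -{1}(E a b) -(E b a) /degsum -!big_split; apply: leq_sum => u _.
rewrite -!big_split; apply: leq_sum => v _ /=.
by case: (u \in U); case: (v \in U); case: (g u v) => //=;
  case: (u == a); case: (v == b); case: (u == b); case: (v == a).
Qed.

(** Contracting an edge would destroy bipartiteness; contracting a path [y x y'] does not, as [y]
    and [y'] lie on one side. Here [y] inherits the neighbours of [y']; the vertices [x] and [y']
    are removed afterwards. *)
Definition merge g y y' : rel T :=
  fun u v => [|| g u v, (u == y) && g y' v | (v == y) && g u y'].

Lemma degsum_merge g V y y' : symmetric g -> bipartite g -> s y = s y' -> y \in V ->
  degsum g V + 2 * #|nbrs g V y'| <=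
  degsum (merge g y y') V + 2 * #|[set v in V | g y v && g y' v]|.
Proof.
move=> gs b e yV; rewrite !mul2n -!addnn.
have ny : g y' y = false by apply/negP=> /b; rewrite e eqxx.
have E1 : #|nbrs g V y'| = \sum_u \sum_v ((u == y) && ((v \in V) && g y' v) : nat).
  by rewrite sum_row nbrsE.
have E2 : #|nbrs g V y'| = \sum_u \sum_v ((v == y) && ((u \in V) && g y' u) : nat).
  by rewrite sum_col nbrsE.
have F : #|[set v in V | g y v && g y' v]| = \sum_v ([&& v \in V, g y v & g y' v] : nat).
  by rewrite -sum1dep_card big_mkcond; apply: eq_bigr => v _; case: (_ && _).
have F1 := F; rewrite -(sum_row y) in F1; have F2 := F; rewrite -(sum_col y) in F2.
rewrite {1}E1 E2 {1}F1 F2 !addnA /degsum -!big_split; apply: leq_sum => u _.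
rewrite -!big_split; apply: leq_sum => v _ /=; rewrite /merge.
have [->|uy] := eqVneq u y; have [->|vy] := eqVneq v y => /=; rewrite ?yV ?ny ?[g _ y']gs ?[g _ y]gs ?ny ?addn0 //=.
- by case: (g y y).
- by case: (v \in V) => //=; case: (g y v); case: (g y' v).
- by case: (u \in V) => //=; case: (g y u); case: (g y' u).
- by rewrite orbF.
Qed.

Lemma minor_merge (I : finType) (h : rel I) g U x y y' : symmetric g -> x \in U -> y \in U -> y' \in U ->
  g x y -> g x y' -> minor h (merge g y y') (U :\ x :\ y') -> minor h g U.
Proof.
move=> gs xU yU y'U gxy gxy'.
have cM : conn g (y' |: (x |: [set y])).
  apply: (conn_setU1 gs (y := x)); [|by rewrite setU11|by rewrite gs].
  by apply: (conn_setU1 gs (y := y)); rewrite ?inE //; apply: conn1.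
pose M u := if u == y then y' |: (x |: [set y]) else [set u].
have uM u : u \in M u by rewrite /M; case: eqP => [->|_]; rewrite !inE eqxx ?orbT.
apply: (minor_model (M := M)) => //.
- move=> u; rewrite !in_setD1 => /and3P[_ _ uU]; rewrite /M; case: eqP => _.
    by rewrite !subUset !sub1set xU yU y'U.
  by rewrite sub1set; split=> //; apply: conn1.
- move=> u v; rewrite !in_setD1 => /and3P[uy' ux _] /and3P[vy' vx _] uv; rewrite /M.
  case: eqP => [eu|/eqP nu]; case: eqP => [ev|/eqP nv].
  + by rewrite eu ev eqxx in uv.
  + by rewrite disjoint_sym disjoints1 !inE !negb_or vy' vx nv.
  + by rewrite disjoints1 !inE !negb_or uy' ux nu.
  + by rewrite disjoints1 inE.
- have y'M : y' \in M y by rewrite /M eqxx setU11.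
  move=> u v _ _ /or3P[guv|/andP[/eqP-> g']|/andP[/eqP-> g']].
  + exact: adjS_intro guv.
  + exact: adjS_intro g'.
  + exact: adjS_intro g'.
Qed.

Lemma merge_sym g y y' : symmetric g -> symmetric (merge g y y').
Proof. by move=> gs u v; rewrite /merge gs [g y' v]gs [g u y']gs [X in _ || X]orbC. Qed.

Lemma merge_bipartite g y y' : bipartite g -> s y = s y' -> bipartite (merge g y y').
Proof. by move=> b e u v /or3P[/b//|/andP[/eqP-> /b]|/andP[/eqP-> /b]]; rewrite ?e // -e. Qed.

Lemma k33_of_sets g U A1 A2 A3 B1 B2 B3 : symmetric g ->
  all (fun A : {set T} => (A \subset U) && conn g A) [:: A1; A2; A3; B1; B2; B3] ->
  pairwise (fun A B : {set T} => [disjoint A & B]) [:: A1; A2; A3; B1; B2; B3] ->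
  all (fun e => adjS g (nth set0 [:: A1; A2; A3; B1; B2; B3] e.1)
                       (nth set0 [:: A1; A2; A3; B1; B2; B3] e.2)) es33 ->
  minor k33 g U.
Proof.
move=> gs h1 h2 h3.
exact: (list_minor (cl := [:: [:: 0]; [:: 1]; [:: 2]; [:: 3]; [:: 4]; [:: 5]])
  (hn := hk33) gs h1 h2 h3).
Qed.

End Density.

(** * A smallest dense bipartite graph without a K33 minor *)

Section DenseBipartite.
Variables (T : finType) (s : T -> bool).
Implicit Types (g : rel T) (U V W S A B Z : {set T}) (x y z u v p q r : T).

(** At least 2n - 3 edges, in terms of the degree sum. The bound on [#|U|] excludes a single edge,
    which has that many. *)
Definition dense g U := 3 <= #|U| /\ 4 * #|U| <= degsum g U + 6.

Section Minimal.
Variables (g : rel T) (U : {set T}).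
Hypotheses (gs : symmetric g) (b : bipartite s g).
Hypothesis IH : forall g' U', symmetric g' -> bipartite s g' -> #|U'| < #|U| -> dense g' U' ->
  minor k33 g' U'.
Hypotheses (dU : dense g U) (NM : ~ minor k33 g U).

Let gi : irreflexive g := bipartite_irrefl b.

Lemma dense_large : 3 < #|U|.
Proof.
have [U3 d] := dU; rewrite ltn_neqAle U3 andbT; apply/eqP=> e.
by have := density_small b (esym e); rewrite -e in d; move: d; clear; lia.
Qed.

(** A vertex of degree at most 2 takes at most 4 from [degsum], no more than it takes from
    [4 * #|U|]. *)
Lemma mindeg3 x : x \in U -> 3 <= #|nbrs g U x|.
Proof.
move=> xU; rewrite leqNgt; apply/negP=> lt; apply: NM.
apply: (minor_sub (subsetDl U [set x])); have U4 := dense_large.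
have cU : #|U| = #|U :\ x|.+1 by rewrite (cardsD1 x) xU.
apply: IH => //; first by rewrite cU.
have E : degsum g U = degsum g (U :\ x) + 2 * #|nbrs g (U :\ x) x|.
  by rewrite -degsum_setU1 ?setD1K // setD11.
have le : #|nbrs g (U :\ x) x| <= #|nbrs g U x|.
  by apply: subset_leq_card; apply/subsetP=> y; rewrite !inE => /andP[/andP[_ ->] ->].
by split; case: dU; move: U4 cU E lt le; clear; lia.
Qed.

(** Neither side of the separation is dense, so each degree sum, being even, falls short of 4n - 6
    by at least 2. Adding up and correcting for the overlap [S] contradicts the density of [U]. Two
    vertices, or three spanning two edges, are light enough. *)
Lemma no_light_separator W S : W \subset U -> S \subset U -> [disjoint W & S] ->
  (forall p q, p \in W -> q \in U -> g p q -> q \in W :|: S) ->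
  W != set0 -> U :\: W :\: S != set0 -> 4 * #|S| <= degsum g S + 8 -> False.
Proof.
move=> WU SU dWS closed /set0Pn[w wW] /set0Pn[u].
rewrite in_setD => /andP[uS]; rewrite in_setD => /andP[uW uU] dS.
have H := degsum_separation WU SU dWS gs closed.
have cA : #|U :\: W| + #|W| = #|U| by rewrite addnC -(cardsID W U) (setIidPr WU).
have cB : #|W :|: S| = #|W| + #|S| by rewrite cardsU (disjoint_setI0 dWS) cards0 subn0.
have WSU : W :|: S \subset U by rewrite subUset WU.
have lA : #|U :\: W| < #|U|.
  by rewrite -cA -[X in X < _]addn0 ltn_add2l card_gt0; apply/set0Pn; exists w.
have lB : #|W :|: S| < #|U|.
  apply: proper_card; rewrite properE WSU; apply/subsetPn; exists u => //.
  by rewrite inE (negbTE uW).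
have A3 : 3 <= #|U :\: W|.
  apply: leq_trans (mindeg3 uU) _; apply: subset_leq_card; apply/subsetP=> y.
  rewrite !inE => /andP[yU guy]; rewrite yU andbT; apply/negP=> yW.
  have : u \in W :|: S by apply: closed yW uU _; rewrite gs.
  by rewrite inE (negbTE uW) (negbTE uS).
have B3 : 3 <= #|W :|: S|.
  apply: leq_trans (mindeg3 (subsetP WU _ wW)) _; apply: subset_leq_card; apply/subsetP=> y.
  by rewrite inE => /andP[yU gwy]; apply: closed gwy.
have nA : ~ dense g (U :\: W).
  by move=> d; apply: NM; apply: minor_sub (IH gs b lA d); apply: subsetDl.
have nB : ~ dense g (W :|: S) by move=> d; apply: NM; apply: minor_sub (IH gs b lB d).
have {}nA : degsum g (U :\: W) + 6 < 4 * #|U :\: W|.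
  by rewrite ltnNge; apply/negP=> h; apply: nA; split.
have {}nB : degsum g (W :|: S) + 6 < 4 * #|W :|: S|.
  by rewrite ltnNge; apply/negP=> h; apply: nB; split.
have [e1 E1] := degsum_even (U :\: W) gs b; have [e2 E2] := degsum_even (W :|: S) gs b.
case: dU => _; rewrite -cA; move: nA nB H dS cB; rewrite E1 E2; clear; lia.
Qed.

(** Merging [y] and [y'] through [x] removes two vertices, and costs the three edges at [x] and one
    edge for each further common neighbour. With at most one of these, four edges are lost for two
    vertices, and density persists. *)
Lemma common_nbrs x y y' : x \in U -> #|nbrs g U x| = 3 -> y \in nbrs g U x -> y' \in nbrs g U x ->
  y != y' -> 2 < #|[set v in U | g y v && g y' v]|.
Proof.
rewrite !inE => xU d3 /andP[yU gxy] /andP[y'U gxy'] yy'; rewrite ltnNge; apply/negP=> c2; apply: NM.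
have e : s y = s y' by move: (b gxy) (b gxy'); case: (s x); case: (s y); case: (s y').
apply: (minor_merge gs xU yU y'U gxy gxy').
have nxy' : y' != x by apply: contraTneq gxy' => ->; rewrite gi.
have nxy : y != x by apply: contraTneq gxy => ->; rewrite gi.
have y'Ux : y' \in U :\ x by rewrite in_setD1 nxy'.
have c1 : #|U| = #|U :\ x|.+1 by rewrite (cardsD1 x) xU.
have c1' : #|U :\ x| = #|U :\ x :\ y'|.+1 by rewrite (cardsD1 y') y'Ux.
have E : degsum g U = degsum g (U :\ x) + 2 * #|nbrs g (U :\ x) x|.
  by rewrite -degsum_setU1 ?setD1K // setD11.
have le : #|nbrs g (U :\ x) x| <= 3.
  rewrite -d3; apply: subset_leq_card; apply/subsetP=> z.
  by rewrite !inE => /andP[/andP[_ ->] ->].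
have E' : degsum g (U :\ x) = degsum g (U :\ x :\ y') + 2 * #|nbrs g (U :\ x :\ y') y'|.
  by rewrite -degsum_setU1 ?setD1K // setD11.
have yV : y \in U :\ x :\ y' by rewrite !in_setD1 yy' nxy.
have M := degsum_merge gs b e yV.
have cc : #|[set v in U :\ x :\ y' | g y v && g y' v]| < #|[set v in U | g y v && g y' v]|.
  apply: proper_card; rewrite properE; apply/andP; split.
    by apply/subsetP=> v; rewrite !inE => /andP[/and3P[_ _ ->] ->].
  apply/subsetPn; exists x; first by rewrite inE xU ![g _ x]gs gxy gxy'.
  by rewrite !inE eqxx /= andbF.
have big : 5 <= #|U|.
  have y3 := mindeg3 yU.
  have : #|nbrs g U y :|: [set y; y']| <= #|U|.
    apply: subset_leq_card; rewrite !subUset !sub1set yU y'U !andbT.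
    by apply/subsetP=> v; rewrite inE => /andP[].
  rewrite cardsU cards2 yy' (_ : _ :&: _ = set0) ?cards0; first by move: y3; clear; lia.
  apply/setP=> v; rewrite !inE; apply/negP=> /andP[/andP[_ gyv]] /orP[]/eqP ev.
    by rewrite ev gi in gyv.
  by have := b gyv; rewrite ev e eqxx.
apply: IH.
- exact: merge_sym.
- exact: merge_bipartite.
- by rewrite c1 c1' ltnS leqnSn.
- by split; case: dU; move: c1 c1' E le E' M cc c2 big; clear; lia.
Qed.

Section CubicVertex.
Variables x y1 y2 y3 : T.
Hypotheses (xU : x \in U) (Nx : nbrs g U x = [set y1; y2; y3]) (un : uniq [:: y1; y2; y3]).

Let d3 : #|nbrs g U x| = 3.
Proof.
rewrite Nx -setUA !cardsU1 !inE cards1; move: un; rewrite /= !inE !negb_or !andbT.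
by case/andP=> /andP[-> ->] ->.
Qed.

Let ny : [/\ y1 != y2, y1 != y3 & y2 != y3].
Proof. by move: un; rewrite /= !inE !negb_or !andbT => /andP[/andP[]]. Qed.

Let yN y : y \in [set y1; y2; y3] -> y \in U /\ g x y.
Proof. by rewrite -Nx inE => /andP[]. Qed.

Let m1 : y1 \in [set y1; y2; y3]. Proof. by rewrite !inE eqxx. Qed.
Let m2 : y2 \in [set y1; y2; y3]. Proof. by rewrite !inE eqxx orbT. Qed.
Let m3 : y3 \in [set y1; y2; y3]. Proof. by rewrite !inE eqxx orbT. Qed.

Definition rest := U :\: (x |: [set y1; y2; y3]).

Lemma restP v : v \in rest -> [/\ v \in U, v != x & [/\ v != y1, v != y2 & v != y3]].
Proof.
rewrite in_setD in_setU1 negb_or => /andP[/andP[vx vS] vU].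
by move: vS; rewrite !inE !negb_or => /andP[/andP[]].
Qed.

Lemma rest_nbr v : v \in U -> v \notin rest -> v = x \/ v \in [set y1; y2; y3].
Proof. by move=> vU; rewrite in_setD vU andbT negbK in_setU1 => /orP[/eqP|]; auto. Qed.

Lemma common_in_rest y y' : y \in [set y1; y2; y3] -> y' \in [set y1; y2; y3] -> y != y' ->
  exists p q, [/\ p != q, p \in rest, q \in rest, g y p && g y' p & g y q && g y' q].
Proof.
move=> yS y'S yy'; have := common_nbrs xU d3; rewrite Nx => /(_ y y' yS y'S yy').
have [yU gxy] := yN yS; have [y'U gxy'] := yN y'S.
rewrite (cardsD1 x) inE xU ![g _ x]gs gxy gxy' add1n ltnS.
have inr v : v \in [set v in U | g y v && g y' v] :\ x -> v \in rest /\ g y v && g y' v.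
  rewrite in_setD1 inE => /andP[vx /andP[vU gv]]; split=> //.
  rewrite in_setD in_setU1 negb_or vU vx andbT /=.
  have sy : s x != s y by apply: b.
  have sv : s v = s x by case/andP: gv => /b + _; move: sy; case: (s x); case: (s y); case: (s v).
  by apply/negP=> /yN[_ /b]; rewrite sv eqxx.
move=> c2; have /card_gt0P[p pS] : 0 < #|[set v in U | g y v && g y' v] :\ x| by apply: leq_trans c2.
have : 0 < #|([set v in U | g y v && g y' v] :\ x) :\ p|.
  by move: c2; rewrite (cardsD1 p) pS.
case/card_gt0P=> q; rewrite in_setD1 => /andP[qp qS].
by exists p, q; rewrite eq_sym qp; have [? ?] := inr p pS; have [? ?] := inr q qS.
Qed.

Lemma x_only v : v \in rest -> g x v = false.
Proof.
move=> /restP[vU _ [v1 v2 v3]]; apply/negP=> gxv.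
have : v \in nbrs g U x by rewrite inE vU.
by rewrite Nx !inE (negbTE v1) (negbTE v2) (negbTE v3).
Qed.

(** The sides are [y1], [y2], [y3] and [x], [A], [B]. *)
Lemma claw_k33 A B : A \subset rest -> B \subset rest -> conn g A -> conn g B -> [disjoint A & B] ->
  (forall y, y \in [set y1; y2; y3] -> adjS g [set y] A /\ adjS g [set y] B) -> False.
Proof.
move=> Ar Br cA cB dAB adj; apply: NM; have [n12 n13 n23] := ny.
have [y1U g1] := yN m1; have [y2U g2] := yN m2; have [y3U g3] := yN m3.
have [a1 b1] := adj _ m1; have [a2 b2] := adj _ m2; have [a3 b3] := adj _ m3.
have rU : rest \subset U by apply: subsetDl.
have ax y : g x y -> adjS g [set y] [set x] by move=> gxy; apply: (@adjS_intro _ _ _ _ y x); rewrite ?inE // gs.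
have nr (A' : {set T}) y : A' \subset rest -> y \in x |: [set y1; y2; y3] -> y \notin A'.
  by move=> s' yS; apply/negP=> /(subsetP s'); rewrite in_setD yS.
have S1 y : y \in [set y1; y2; y3] -> y \in x |: [set y1; y2; y3] by apply: setU1r.
have nxy y : g x y -> y != x by move=> gxy; apply: contraTneq gxy => ->; rewrite gi.
apply: (k33_of_sets (A1 := [set y1]) (A2 := [set y2]) (A3 := [set y3])
  (B1 := [set x]) (B2 := A) (B3 := B) gs).
- by rewrite /= !sub1set y1U y2U y3U xU !conn1 cA cB !(subset_trans _ rU).
- by rewrite /= !disjoints1 !inE n12 n13 n23 !nxy // !(nr _ x) ?setU11 // !nr ?S1 // dAB.
- by rewrite /es33 /= !ax // a1 a2 a3 b1 b2 b3.
Qed.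

(** Otherwise [p], [y1], [y2] separate [W] from [x], and the edges from [p] to [y1] and [y2] make
    this separator light. *)
Lemma light_separator3 W p : W \subset rest -> W != set0 -> p \in rest -> p \notin W ->
  g y1 p && g y2 p ->
  (forall u v, u \in W -> v \in rest -> g u v -> v \in p |: W) -> adjS g [set y3] W.
Proof.
move=> Wr W0 pr pW /andP[g1 g2] closed; apply: contraT => n3; exfalso.
have [pU px [p1 p2 p3]] := restP pr; have [n12 _ _] := ny.
have [y1U _] := yN m1; have [y2U _] := yN m2.
have nW y : y \in x |: [set y1; y2; y3] -> y \notin W.
  by move=> yS; apply/negP=> /(subsetP Wr); rewrite in_setD yS.
have WU : W \subset U by apply: subset_trans Wr _; apply: subsetDl.
apply: (@no_light_separator W [set p; y1; y2]) => //.
- by rewrite !subUset !sub1set pU y1U y2U.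
- apply/disjointP=> v vW; rewrite !inE -orbA => /or3P[]/eqP e; move: vW; rewrite e; apply/negP => //.
    by apply: nW; apply: setU1r.
  by apply: nW; apply: setU1r.
- move=> u v uW vU guv; rewrite in_setU.
  case: (boolP (v \in rest)) => vr.
    have := closed u v uW vr guv; rewrite in_setU1 => /orP[/eqP->|->//].
    by rewrite !inE eqxx orbT.
  case: (rest_nbr vU vr) => [ev|].
    by rewrite ev gs x_only ?(subsetP Wr) in guv.
  rewrite !inE => /orP[/orP[]|] /eqP ev; rewrite ev ?eqxx ?orbT //.
  by case/negP: n3; apply: (@adjS_intro _ _ _ _ y3 u); rewrite ?inE // gs -ev.
- apply/set0Pn; exists x; rewrite !in_setD xU nW ?setU11 // !andbT !inE !negb_or eq_sym px.
  have [[_ gx1] [_ gx2]] := (yN m1, yN m2).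
  by rewrite /=; apply/andP; split; [apply: contraTneq gx1|apply: contraTneq gx2] => <-; rewrite gi.
rewrite -setUA setUC -setUA degsum_setU1 //; last by rewrite !inE negb_or n12 eq_sym p1.
rewrite degsum_setU1 //; last by rewrite !inE eq_sym p2.
have c1 : 0 < #|nbrs g (y2 |: [set p]) y1| by apply/card_gt0P; exists p; rewrite !inE eqxx orbT.
have c2 : 0 < #|nbrs g [set p] y2| by apply/card_gt0P; exists p; rewrite !inE eqxx.
have c3 : #|y1 |: (y2 |: [set p])| = 3.
  by rewrite !cardsU1 cards1 !inE negb_or n12 ![_ == p]eq_sym p1 p2.
by rewrite c3; move: c1 c2; clear; lia.
Qed.

(** Otherwise the two other neighbours of [x] form a light separator. *)
Lemma comp_rest_adj z y : z \in rest -> y \in [set y1; y2; y3] -> adjS g [set y] (component g rest z).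
Proof.
move=> zr yS; set K := component g rest z; apply: contraT => nyK; exfalso.
have zK : z \in K := comp_self g zr; have Kr : K \subset rest := comp_sub g rest z.
have nK v : v \in x |: [set y1; y2; y3] -> v \notin K.
  by move=> vS; apply/negP=> /(subsetP Kr); rewrite in_setD vS.
set S := [set y1; y2; y3] :\ y.
have c2 : #|S| = 2 by have := d3; rewrite Nx (cardsD1 y) yS => -[].
have nS v : v \in S -> v \in [set y1; y2; y3] by rewrite in_setD1 => /andP[].
apply: (@no_light_separator K S) => //.
- by apply: subset_trans Kr _; apply: subsetDl.
- by apply/subsetP=> v /nS vS; case: (yN vS).
- by apply/disjointP=> v vK /nS vS; move: vK; apply/negP/nK; apply: setU1r.
- move=> u v uK vU guv; rewrite in_setU; case: (boolP (v \in rest)) => vr.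
    by rewrite (comp_closed uK vr guv).
  case: (rest_nbr vU vr) => [ev|vS]; first by rewrite ev gs x_only ?(subsetP Kr) in guv.
  rewrite in_setD1 vS andbT; case: eqP => [e|_]; last by rewrite orbT.
  by case/negP: nyK; apply: (adjS_set1 (z := u)); rewrite // gs -e.
- by apply/set0Pn; exists z.
- apply/set0Pn; exists x; apply/setDP; split; first by apply/setDP; rewrite nK ?setU11.
  by apply/negP=> /nS xS; case: (yN xS); rewrite gi.
- by rewrite c2 leq_addl.
Qed.

(** Two components could serve as [A] and [B] in [claw_k33]. *)
Lemma rest_conn : conn g rest.
Proof.
have [p [_ [_ pr _ _ _]]] := common_in_rest m1 m2 (let: And3 n _ _ := ny in n).
have [/subsetP sub|/subsetPn[z zr zK]] := boolP (rest \subset component g rest p).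
  have -> : rest = component g rest p; last exact: conn_comp.
  by apply/eqP; rewrite eqEsubset comp_sub andbT; apply/subsetP.
exfalso; apply: (@claw_k33 (component g rest p) (component g rest z)); try exact: comp_sub; try exact: conn_comp.
  by apply: comp_disjoint => //; move: zK; rewrite inE zr.
by move=> y yS; split; apply: comp_rest_adj.
Qed.

(** [y1] and [y2] have another common neighbour [p]; its component off [w] touches [y3] by
    [light_separator3]. This component and [w] contradict [claw_k33]. *)
Lemma common3_false w : w \in rest -> (forall y, y \in [set y1; y2; y3] -> g y w) -> False.
Proof.
move=> wr H; have [p [q [pq pr qr /andP[p1 p2] /andP[q1 q2]]]] :=
  common_in_rest m1 m2 (let: And3 n _ _ := ny in n).
have {q qr q1 q2 pq p1 p2 pr} [{}p [pr pw p1 p2]] : exists p, [/\ p \in rest, p != w, g y1 p & g y2 p].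
  have [e|ne] := eqVneq p w; last by exists p.
  by exists q; split=> //; rewrite -e eq_sym.
have pR : p \in rest :\ w by rewrite in_setD1 pw.
set K := component g (rest :\ w) p; have pK : p \in K := comp_self g pR.
have KR : K \subset rest :\ w := comp_sub g _ p.
have Kr : K \subset rest by apply: subset_trans KR _; apply: subsetDl.
have wK : w \notin K by apply/negP=> /(subsetP KR); rewrite in_setD1 eqxx.
have a3 : adjS g [set y3] K.
  apply: (@light_separator3 K w) => //; first by apply/set0Pn; exists p.
    by rewrite !H.
  move=> u v uK vr guv; rewrite in_setU1; case: eqP => //= /eqP vw.
  by apply: (comp_closed uK _ guv); rewrite in_setD1 vw.
apply: (@claw_k33 [set w] K) => //.
- by rewrite sub1set.
- exact: conn1.
- exact: conn_comp.
- by rewrite disjoints1.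
move=> y yS; split; first by apply: (adjS_set1 (H y yS)); rewrite inE.
by move: yS; rewrite !inE -orbA => /or3P[]/eqP-> //; [apply: adjS_set1 p1 pK|apply: adjS_set1 p2 pK].
Qed.

(** [p |: K] sees [y1], [y2] from [p] and [y3] from [r]. The component of [q] off this set has no
    contact with [K], at most with [p], so it sees [y3] by [light_separator3]; the two sets
    contradict [claw_k33]. *)
Lemma bypass_false p q r : p \in rest -> q \in rest -> r \in rest -> p != q -> r != p -> r != q ->
  g y1 p && g y2 p -> g y1 q && g y2 q -> g y1 r && g y3 r ->
  let K := component g (rest :\: [set p; q]) r in
  adjS g K [set p] -> ~~ adjS g K [set q] -> False.
Proof.
move=> pr qr rr pq rp rq Hp Hq Hr K aKp aKq.
have rR : r \in rest :\: [set p; q] by apply/setDP; rewrite in_set2 negb_or rp rq.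
have rK : r \in K := comp_self g rR.
have KR : K \subset rest :\: [set p; q] := comp_sub g _ r.
have Kr : K \subset rest by apply: subset_trans KR _; apply: subsetDl.
have qK : q \notin K by apply/negP=> /(subsetP KR); rewrite !inE eqxx orbT.
have cK : conn g K := conn_comp gs rR.
have qQ0 : q \in rest :\: (p |: K) by rewrite in_setD in_setU1 negb_or eq_sym pq qK.
set Q := component g (rest :\: (p |: K)) q.
have qQ : q \in Q := comp_self g qQ0.
have QR : Q \subset rest :\: (p |: K) := comp_sub g _ q.
have Qr : Q \subset rest by apply: subset_trans QR _; apply: subsetDl.
have dQ : [disjoint p |: K & Q].
  by apply/disjointP=> v vP /(subsetP QR); rewrite in_setD vP.
have pQ : p \notin Q by move: dQ; rewrite disjointsU1 => /andP[].
have a3 : adjS g [set y3] Q.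
  apply: (@light_separator3 Q p) => //; first by apply/set0Pn; exists q.
  move=> u v uQ vr guv; rewrite in_setU1; case: eqP => //= /eqP vp.
  have [vK|vK] := boolP (v \in K); last first.
    by apply: (comp_closed uQ _ guv); rewrite in_setD in_setU1 negb_or vp vK.
  exfalso; have gvu : g v u by rewrite gs.
  have := subsetP QR _ uQ; rewrite in_setD in_setU1 negb_or => /andP[/andP[up uK] ur].
  have [uq|uq] := eqVneq u q.
    by case/negP: aKq; apply: adjS_intro vK _ gvu; rewrite uq set11.
  case/negP: uK; apply: (comp_closed vK _ gvu).
  by rewrite in_setD in_set2 negb_or up uq.
have [p1 p2] := andP Hp; have [q1 q2] := andP Hq; have [r1 r3] := andP Hr.
apply: (@claw_k33 (p |: K) Q) => //.
- by rewrite subUset sub1set pr.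
- by have /adjSP[k [_ [kK /set1P-> gk]]] := aKp; apply: (conn_setU1 gs cK kK); rewrite gs.
- exact: conn_comp.
move=> y; rewrite !inE -orbA => /or3P[]/eqP->; split=> //.
- by apply: adjS_set1 p1 _; apply: setU11.
- exact: adjS_set1 q1 qQ.
- by apply: adjS_set1 p2 _; apply: setU11.
- exact: adjS_set1 q2 qQ.
- by apply: adjS_set1 r3 _; apply: setU1r.
Qed.

(** [p] and [q] are common neighbours of [y1], [y2], and [r] is one of [y1], [y3], different from
    both. The component [K] of [r] off [p], [q] touches both, and K33 appears with sides [y1], [y2],
    [K] and [p], [q], the edge [x y3] contracted. *)
Lemma cubic_false : False.
Proof.
have [n12 n13 n23] := ny.
have [p [q [pq pr qr Hp Hq]]] := common_in_rest m1 m2 n12.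
have [r [_ [_ rr _ Hr _]]] := common_in_rest m1 m3 n13.
have no3 w : w \in rest -> g y1 w && g y2 w -> g y3 w = false.
  move=> wr /andP[w1 w2]; apply/negP=> w3; apply: (common3_false wr) => y.
  by rewrite !inE -orbA => /or3P[]/eqP->.
have [r1 r3] := andP Hr.
have rp : r != p by apply: contraTneq r3 => ->; rewrite no3.
have rq : r != q by apply: contraTneq r3 => ->; rewrite no3.
pose K := component g (rest :\: [set p; q]) r.
have rR : r \in rest :\: [set p; q] by apply/setDP; rewrite in_set2 negb_or rp rq.
have rK : r \in K := comp_self g rR.
have KR : K \subset rest :\: [set p; q] := comp_sub g _ r.
have cK : conn g K := conn_comp gs rR.
have [ap|np] := boolP (adjS g K [set p]); last first.
  have [aq|nq] := boolP (adjS g K [set q]).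
    apply: (bypass_false qr pr rr _ rq rp Hq Hp Hr); rewrite 1?eq_sym //.
      by rewrite (setUC [set q]).
    by rewrite (setUC [set q]).
  have /adjSP[k [v [kK vS gk]]] : adjS g K [set p; q].
    apply: comp_adj => //; first exact: rest_conn.
      by rewrite subUset !sub1set pr.
    by apply/set0Pn; exists p; rewrite !inE eqxx.
  by case/set2P: vS => e; rewrite e in gk; [case/negP: np|case/negP: nq];
    apply: adjS_intro kK _ gk; apply: set11.
have [aq|nq] := boolP (adjS g K [set q]); last exact: (bypass_false pr qr rr pq rp rq Hp Hq Hr ap nq).
apply: NM; have [[p1 p2] [q1 q2]] := (andP Hp, andP Hq).
have [y1U g1] := yN m1; have [y2U g2] := yN m2; have [y3U g3] := yN m3.
have [pU px [np1 np2 np3]] := restP pr; have [qU qx [nq1 nq2 nq3]] := restP qr.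
have nK v : v \in x |: [set y1; y2; y3] -> v \notin K.
  by move=> vS; apply/negP=> /(subsetP KR); rewrite !in_setD vS andbF.
have KU : K \subset U by apply: subset_trans KR _; apply: subset_trans (subsetDl _ _) _; apply: subsetDl.
have pK : p \notin K by apply/negP=> /(subsetP KR); rewrite !inE eqxx.
have qK : q \notin K by apply/negP=> /(subsetP KR); rewrite !inE eqxx orbT.
have cx : conn g (x |: [set y3]) by apply: (conn_setU1 gs (y := y3)); rewrite ?inE //; apply: conn1.
have nx y : g x y -> y != x by move=> gxy; apply: contraTneq gxy => ->; rewrite gi.
have dK (A : {set T}) : (forall v, v \in A -> v \notin K) -> [disjoint K & A].
  by move=> H; apply/disjointP=> v vK /H/negP.
apply: (k33_of_sets (A1 := [set y1]) (A2 := [set y2]) (A3 := K)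
  (B1 := [set p]) (B2 := [set q]) (B3 := x |: [set y3]) gs).
- by rewrite /= subUset !sub1set y1U y2U KU pU qU xU y3U !conn1 cK cx.
- have [f1 f2 f3 f4] : [/\ y1 != p, y1 != q, y2 != p & y2 != q] by rewrite ![_ == p]eq_sym ![_ == q]eq_sym.
  have d4 : [disjoint K & [set p]] by apply: dK => v /set1P->.
  have d5 : [disjoint K & [set q]] by apply: dK => v /set1P->.
  have d6 : [disjoint K & x |: [set y3]].
    by apply: dK => v /setU1P[->|/set1P->]; apply: nK; rewrite ?setU11 // setU1r.
  have [k1 k2] : y1 \notin K /\ y2 \notin K by split; apply/nK/setU1r.
  rewrite /= d4 d5 d6 !disjoints1 k1 k2 !in_setU1 !in_set1 !negb_or.
  by rewrite n12 n13 n23 f1 f2 f3 f4 (nx _ g1) (nx _ g2) pq px qx np3 nq3.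
have ax y : g x y -> adjS g [set y] (x |: [set y3]).
  by move=> gxy; apply: (@adjS_set1 _ _ _ x); rewrite ?setU11 // gs.
have a3 : adjS g K (x |: [set y3]).
  by apply: (@adjS_intro _ _ _ _ r y3) => //; [apply/setU1r/set11|rewrite gs].
by rewrite /es33 /= !(adjS_set1 _ (set11 _)) // !ax // ap aq a3.
Qed.

End CubicVertex.
End Minimal.
(** Induction on vertices, then on edges. Surplus edges are deleted until [degsum] is below
    [4 * #|U|]; then some vertex has degree at most 3, hence exactly 3. *)
Theorem dense_k33 g U : symmetric g -> bipartite s g -> dense g U -> minor k33 g U.
Proof.
have [m] := ubnP #|U|; elim: m g U => // m IHm g U; rewrite ltnS => Um.
have [d] := ubnP (degsum g U); elim: d g => // d IHd g; rewrite ltnS => gd gs b dU.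
have IH g' U' : symmetric g' -> bipartite s g' -> #|U'| < #|U| -> dense g' U' -> minor k33 g' U'.
  by move=> gs' b' lt; apply: IHm => //; apply: leq_trans lt Um.
have gi := bipartite_irrefl b; apply: NNPP => NM; have [U3 dens] := dU.
have [big|small] := leqP (4 * #|U| + 2) (degsum g U + 6).
  have [/existsP[u /existsP[v /and3P[uU vU guv]]]|none] :=
      boolP [exists u, exists v, [&& u \in U, v \in U & g u v]]; last first.
    have D0 : degsum g U = 0.
      rewrite /degsum big1 // => u _; rewrite big1 // => v _; apply/eqP; rewrite eqb0.
      move: none; rewrite negb_exists => /forallP/(_ u); rewrite negb_exists => /forallP/(_ v).
      by rewrite andbA.
    by move: big U3; rewrite D0; clear; lia.
  pose g' := fun a c => g a c && ~~ ((a == u) && (c == v) || (a == v) && (c == u)).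
  have le : degsum g U <= degsum g' U + 2 := degsum_del_edge g U u v.
  have lt : degsum g' U < degsum g U.
    have sub a c : ((a \in U) && (c \in U) && g' a c : nat) <= (a \in U) && (c \in U) && g a c.
      by rewrite /g'; case: (a \in U); case: (c \in U); case: (g a c) => //=; case: (~~ _).
    rewrite /degsum (bigD1 u) //= [X in _ < X](bigD1 u) //= -addSn leq_add //; last first.
      by apply: leq_sum => a _; apply: leq_sum => c _; apply: sub.
    rewrite (bigD1 v) //= [X in _ < X](bigD1 v) //= -addSn leq_add //; last first.
      by apply: leq_sum => c _; apply: sub.
    by rewrite /g' uU vU guv !eqxx.
  have m' : minor k33 g' U.
    apply: IHd; first exact: leq_trans lt gd.
    - by move=> a c; rewrite /g' gs [in RHS]orbC [(c == v) && _]andbC [(c == u) && _]andbC.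
    - by move=> a c /andP[/b].
    - by split=> //; move: big le; clear; lia.
  by apply: NM; apply: minor_subrel m' => a c /andP[].
have [x xU dx] : exists2 x, x \in U & #|nbrs g U x| <= 3.
  have [/existsP[x /andP[xU dx]]|none] := boolP [exists x, (x \in U) && (#|nbrs g U x| <= 3)].
    by exists x.
  have : \sum_(x in U) 4 <= degsum g U.
    rewrite degsumE; apply: leq_sum => x xU; move: none; rewrite negb_exists => /forallP/(_ x).
    by rewrite xU -ltnNge.
  by rewrite sum_nat_const; move: small; clear; lia.
have N3 : #|nbrs g U x| = 3 by apply/eqP; rewrite eqn_leq dx (mindeg3 gs b IH dU NM xU).
have /card_gt0P[y1 y1N] : 0 < #|nbrs g U x| by rewrite N3.
have /cards2P[y2 [y3 [n23 E]]] : #|nbrs g U x :\ y1| == 2.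
  by have := cardsD1 y1 (nbrs g U x); rewrite N3 y1N add1n => -[<-].
apply: (@cubic_false g U gs b IH dU NM x y1 y2 y3 xU); first by rewrite -setUA -E setD1K.
have : y2 \in nbrs g U x :\ y1 by rewrite E !inE eqxx.
have : y3 \in nbrs g U x :\ y1 by rewrite E !inE eqxx orbT.
rewrite !in_setD1 /= !inE negb_or !(eq_sym y1) n23.
by move=> /andP[-> _] /andP[-> _].
Qed.

End DenseBipartite.

(** * The two graphs *)

Section KempeMinor.
Variable T : finType.
Implicit Types (g : rel T) (U : {set T}) (x y : T).

Lemma kempe_induction (I : finType) (h : rel I) :
  (forall g U c f, symmetric g -> irreflexive g -> minor_below h g U -> ~ minor h g U ->
     kempe h g U c f -> False) ->
  forall g U c f, symmetric g -> irreflexive g -> kempe h g U c f -> minor h g U.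
Proof.
move=> H g U; have [m] := ubnP #|U|; elim: m g U => // m IH g U; rewrite ltnS => Um c f gs gi K.
apply: NNPP => NM; apply: (H g U c f gs gi) => // g' U' c' f' gs' gi' lt K'.
by apply: IH K' => //; apply: leq_trans lt Um.
Qed.

Lemma kempe_k5 g U c f : symmetric g -> irreflexive g -> kempe k5 g U c f -> minor k5 g U.
Proof.
move: g U c f; apply: kempe_induction => g U c f gs gi below NM K.
have k4 := kempe_4conn gs gi below NM K.
have k3 : kconn 3 g U.
  by case: k4 => lt k; split=> [|S sS l]; [apply: ltnW|apply: k => //; apply: ltnW].
have [//|/(k33_k5 gs k4)//] := odd_cycle_minor gs gi k3 (kempe_k5_odd gs K).
Qed.

Lemma kempe_k33 g U c f : symmetric g -> irreflexive g -> kempe k33 g U c f -> minor k33 g U.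
Proof.
move: g U c f; apply: kempe_induction => g U c f gs gi below NM K.
have k33s : symmetric k33 by move=> i j; rewrite /k33 eq_sym.
(* Only edges between the two colour sides are kept; the degree bounds of a Kempe colouring count
   just these. *)
pose g' u v := g u v && k33 (c u) (c v).
have gs' : symmetric g' by move=> u v; rewrite /g' gs k33s.
apply: (NM); apply: (@minor_subrel _ _ _ _ g'); first by move=> u v /andP[].
apply: (dense_k33 (s := fun u => c u < 3) gs'); first by move=> u v /andP[].
have [F _] := K; have fi : injective f by move=> i j e; rewrite -(F i).2 -(F j).2 e.
have nbS x j : k33 (c x) j -> nb g U c x j \subset nbrs g' U x.
  by move=> hj; apply/subsetP=> y; rewrite !inE => /and3P[-> gxy /eqP cy]; rewrite /g' gxy cy.
have dterm x : x \in U -> x = f (c x) -> 3 <= #|nbrs g' U x|.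
  move=> xU fx; apply: leq_trans (leq_imset_card c _).
  apply: (@leq_trans #|[set j | k33 (c x) j]|).
    rewrite -sum1dep_card big_mkcond !big_ord_recl big_ord0 /k33 /=.
    by case: (c x < 3).
  apply: subset_leq_card; apply/subsetP=> j; rewrite inE => hj.
  have jx : c x != j by apply: contraTneq hj => <-; rewrite /k33 eqxx.
  have /card_gt0P[y] := kempe_terminal gs gi below NM K hj jx.
  rewrite -fx => yN; have := yN; rewrite inE => /and3P[_ _ /eqP<-].
  by apply: imset_f; apply: (subsetP (nbS x j hj)).
have dint x : x \in U -> x != f (c x) -> 4 <= #|nbrs g' U x|.
  move=> xU xf; apply: leq_trans (kempe_interior_degree k33s gs gi below NM K xU xf) _.
  by apply: subset_leq_card; apply/subsetP=> y; rewrite !inE.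
split.
  have c6 : #|f @: 'I_6| <= #|U| by apply: subset_leq_card; apply/subsetP=> _ /imsetP[i _ ->]; case: (F i).
  by apply: leq_trans c6; rewrite card_imset // card_ord.
rewrite degsumE.
(* Only the six terminals may have degree 3; adding 1 at each of them makes every summand at least
   4. *)
have t6 : \sum_(x in U) (x == f (c x)) <= 6.
  apply: (@leq_trans #|f @: 'I_6|); last by rewrite card_imset // card_ord.
  rewrite -sum1_card big_mkcond [X in _ <= X]big_mkcond; apply: leq_sum => x _.
  by case: (x \in U) => //; case: eqP => // ->; rewrite imset_f.
apply: (@leq_trans (\sum_(x in U) (#|nbrs g' U x| + (x == f (c x))))); last first.
  by rewrite big_split leq_add2l.
rewrite mulnC -sum_nat_const; apply: leq_sum => x xU.
have [e|ne] := eqVneq x (f (c x)); last by rewrite addn0 dint.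
by rewrite addn1 ltnS dterm.
Qed.

End KempeMinor.

Lemma path_joined (T : finType) (g : rel T) (S : {set T}) z q : path g z q ->
  {subset z :: q <= S} -> {in z :: q, forall y, joined g S z y}.
Proof.
elim: q z => [|w q IH] z /=; first by move=> _ _ y; rewrite inE => /eqP->; apply: joined_refl.
move=> /andP[gzw pq] sub y; rewrite inE => /orP[/eqP->|yq]; first exact: joined_refl.
have sub' : {subset w :: q <= S} by move=> v vq; apply: sub; rewrite inE vq orbT.
apply: joined_trans (IH w pq sub' y yq).
by apply: joined1; rewrite // sub ?inE ?eqxx ?orbT.
Qed.

(** The second clause of a scheme supplies a colour for every vertex on some path. A terminal keeps
    its own colour, which is consistent because a path contains no terminals but its ends; vertices
    on no path get the arbitrary [h0]. *)
Lemma scheme_kempe (H G : sgraph) (f : H -> G) (P : {set H} -> seq G) : H -> injective f ->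
  scheme f P -> exists c, kempe (@adj H) (@adj G) setT c f.
Proof.
move=> h0 fi [S1 S2].
have edge e : e \in edges H -> exists u v, adj u v /\ e = [set u; v].
  by case/imsetP=> -[u v]; rewrite inE => uv ->; exists u, v.
have [c Hc] : exists c : G -> H, forall x,
    (forall e, e \in edges H -> x \in P e -> c x \in e) /\ (forall k, x = f k -> c x = k).
  apply: (fin_all_exists (P := fun x u => (forall e, e \in edges H -> x \in P e -> u \in e) /\
    (forall k, x = f k -> u = k))) => x.
  have [/existsP[k /eqP xk]|none] := boolP [exists k, x == f k].
    exists k; split=> [e eE xP|k']; last by rewrite xk => /fi.
    have [u [v [uv ee]]] := edge e eE; have [_ /setP/(_ x)] := S1 u v uv.
    rewrite -ee in_setI in_set xP xk imset_f // in_set2 ee in_set2 => /esym.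
    by rewrite !(inj_eq fi).
  have nk k : x = f k -> False by move=> e; case/negP: none; apply/existsP; exists k; apply/eqP.
  pose E := [set e in edges H | x \in P e].
  have [E0|E0] := eqVneq E set0.
    exists h0; split=> [e eE xP|k /nk//].
    have : e \in E by rewrite inE eE.
    by rewrite E0 inE.
  have [||u Hu] := S2 E _ E0.
  - by apply/subsetP=> e; rewrite inE => /andP[].
  - by exists x => e; rewrite inE => /andP[].
  by exists u; split=> [e eE xP|k /nk//]; apply: Hu; rewrite inE eE.
exists c; split=> [i|i j ij]; first by rewrite inE; split=> //; apply: (Hc (f i)).2.
have ee : [set i; j] \in edges H by apply/imsetP; exists (i, j); rewrite ?inE.
have [p1 p2] := S1 i j ij.
have inP k : k \in [set i; j] -> f k \in P [set i; j].
  move=> kS; have : f k \in [set x in P [set i; j]] :&: [set f w | w : H].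
    by rewrite p2 in_set2 !(inj_eq fi) -in_set2.
  by rewrite !inE => /andP[].
have col y : y \in P [set i; j] -> y \in two_coloured setT c i j.
  by move=> yP; rewrite !inE /=; have := (Hc y).1 _ ee yP; rewrite in_set2.
move: p1 inP col; rewrite /uv_path; case: (P _) => // z q /and3P[_ pq _] inP col.
have J := path_joined pq col.
apply: (@joined_trans _ _ _ z).
  by rewrite joined_sym; [apply: J; apply: inP; rewrite set21|exact: adj_sym].
by apply: J; apply: inP; rewrite set22.
Qed.

Lemma minor_has_minor (G H : sgraph) : minor (@adj H) (@adj G) setT -> has_minor G H.
Proof.
move=> [C [C1 C2 C3]]; exists C; split=> // [v|u v /C3/adjSP//].
by have [_ /connP] := C1 v.
Qed.

Lemma kempe_rename (T I J : finType) (h : rel I) (h' : rel J) (a : I -> J) (b : J -> I)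
    (g : rel T) U c f : cancel a b -> cancel b a -> (forall i j, h' i j -> h (b i) (b j)) ->
  kempe h g U c f -> kempe h' g U (a \o c) (f \o b).
Proof.
move=> ab ba hb [F K]; split=> [i|i j /hb/K] /=.
  by have [fU cf] := F (b i); rewrite cf ba.
apply: joined_sub; apply/subsetP=> x; rewrite !inE => /andP[->] /=.
by rewrite !(can2_eq ab ba).
Qed.

Lemma minor_rename (T I J : finType) (h : rel I) (h' : rel J) (a : I -> J)
    (g : rel T) U : injective a -> (forall i j, h i j -> h' (a i) (a j)) ->
  minor h' g U -> minor h g U.
Proof.
move=> ai ha [C [C1 C2 C3]]; exists (C \o a); split=> [i|i j ij|i j /ha/C3] //=.
by apply: C2; rewrite (inj_eq ai).
Qed.

Theorem theorem5p3 :
  weakly_contractible (complete_graph 5) /\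
  weakly_contractible (complete_bipartite_graph 3 3).
Proof.
split=> G f fi [P sP].
  have [c K] := scheme_kempe (ord0 : complete_graph 5) fi sP.
  exact/minor_has_minor/(kempe_k5 (@adj_sym G) (@adj_irrefl G) K).
have [c K] := scheme_kempe (inl ord0 : complete_bipartite_graph 3 3) fi sP.
have split33 i j : k33 i j -> bipartite_adj (split (i : 'I_(3 + 3))) (split (j : 'I_(3 + 3))).
  by rewrite /k33; case: splitP => i' ->; case: splitP => j' ->; rewrite ?ltn_ord // !ltnNge leq_addr.
have {}K := kempe_rename (@unsplitK 3 3) (@splitK 3 3) split33 K.
apply/minor_has_minor/minor_rename/(kempe_k33 (@adj_sym G) (@adj_irrefl G) K).
  exact: (can_inj (@unsplitK 3 3)).
by move=> [i|i] [j|j] //= _; rewrite /k33 /= ltn_ord ltnNge leq_addr.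
Qed.
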